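(* Let $T>0$, let $\Omega\subset\mathbb{R}^3$ be a bounded domain with smooth boundary, and suppose that $\mathbb{S}$, $\kappa$, $\sigma$, $s$, $p$ satisfy the constitutive assumptions (A1)–(A6) listed in the context. Let $(\rho,u,\theta)$ be a smooth solution, with $\rho,\theta>0$, of the Navier–Stokes–Fourier system on $[0,T)\times\overline\Omega$ (equations and boundary conditions as in the context, holding classically), with $\rho\in L^\infty(0,T;L^\omega(\Omega))$ for some $\omega>3$ and $u\in L^2(0,T;H^1_0(\Omega))$. Then for every $0\le\mathfrak{s}\le t<T$ and every $C>0$, $$\int_{\Omega}\rho\tilde s_C(t,x)\,dx+\int_{\mathfrak{s}}^t\int_{\{\theta\le C\}}\left(\frac{\mu|2D(u)-\frac23 I\operatorname{div}u|^2+2\eta|\operatorname{div}u|^2}{2\theta}+\frac{\kappa|\nabla\theta|^2}{\theta^2}\right)dx\,dr\le\int_{\mathfrak{s}}^t\int_{\{\theta\le C\}}\left(-\rho^2\,\partial_\rho s(\rho,C)\operatorname{div}u\right)dx\,dr+\int_\Omega\rho\tilde s_C(\mathfrak{s},x)\,dx,$$ where $\tilde s_C=s(\rho,C)-s(\rho,\min\{\theta,C\})$.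
   Context: **The system.** The Navier–Stokes–Fourier system for the density $\rho$, velocity $u$ and temperature $\theta$ on $(0,T)\times\Omega$ is $$\partial_t\rho+\operatorname{div}(\rho u)=0,\qquad \partial_t(\rho u)+\operatorname{div}(\rho u\otimes u)+\nabla p=\operatorname{div}\mathbb{S},\qquad \partial_t(\rho s)+\operatorname{div}(\rho s u)+\operatorname{div}\left(\frac{-\kappa\nabla\theta}{\theta}\right)=\sigma,$$ with $\rho(0,\cdot)=\rho_0$, $(\rho u)(0,\cdot)=(\rho u)_0$, $\theta(0,\cdot)=\theta_0$, $u|_{\partial\Omega}=0$, $\nabla\theta\cdot n|_{\partial\Omega}=0$ ($n$ the normal to $\partial\Omega$). Here $p=p(\rho,\theta)$, $s=s(\rho,\theta)$, $\kappa=\kappa(\theta)$, $\mu=\mu(\theta)$, $\eta=\eta(\theta)$. **Constitutive assumptions.** Let $p,e,s\in C^1((0,\infty)\times(0,\infty))$ and $\mu,\eta,\kappa,P\in C^1([0,\infty))$. (A1) With $D(u)=\nabla u+(\nabla u)^\top$, $\mathbb{S}=\mu(2D(u)-\frac23 I\operatorname{div}u)+\eta I\operatorname{div}u$, and $\sigma$ is a Borel measure on $[0,T]\times\overline\Omega$ with $$\sigma\ge\frac{\mu|2D(u)-\frac23 I\operatorname{div}u|^2+2\eta|\operatorname{div}u|^2}{2\theta}+\frac{\kappa|\nabla\theta|^2}{\theta^2}.$$ (A2) Gibbs' equation: for all $\rho,\theta>0$, $\theta D_{(\rho,\theta)}s=D_{(\rho,\theta)}e+p\,D_{(\rho,\theta)}(1/\rho)$,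 where $D_{(\rho,\theta)}=(\partial_\rho,\partial_\theta)$ ($e$ is the internal energy). (A3) For every $\rho>0$ there is $\underline e(\rho)>0$ with $\lim_{\theta\to0^+}e(\rho,\theta)=\underline e(\rho)$; and there is a constant $c$ such that for all $\rho,\theta>0$: $\partial_\rho p(\rho,\theta)>0$, $0<\partial_\theta e(\rho,\theta)\le c$, $|\rho\,\partial_\rho e(\rho,\theta)|\le c\,e(\rho,\theta)$. (A4) $p(\rho,\theta)=\frac23\rho e(\rho,\theta)$. Moreover $p(\rho,\theta)=\theta^{5/2}P(\rho/\theta^{3/2})$ for all $\rho,\theta>0$ with $P(0)=0$, $P'(0)>0$; and $s(\rho,\theta)=S(\rho/\theta^{3/2})$ with $S'(Z)=-\frac32\cdot\frac{\frac53P(Z)-ZP'(Z)}{Z^2}$, and (as a consequence of these hypotheses) $S'(Z)\ge-c_1Z^{-1}$ for all $Z>0$, for some constant $c_1$. (A5) For some $\alpha\in(\frac25,1]$ and constants $0<\underline\mu<\overline\mu<\infty$, $0<\underline\kappa<\overline\kappa<\infty$, $\overline m>0$: $(1+\theta^\alpha)\underline\mu\le\mu(\theta)\le(1+\theta^\alpha)\overline\mu$, $\sup_\theta|\mu'(\theta)|\le\overline m$, $\underline\kappa\le\kappa(\theta)\le\overline\kappa(1+\theta^\alpha)$. (A6) (i) $\theta\le\eta(\theta)$ for all sufficiently small $\theta$; (ii) there is $C_2>0$ with $S'(Z)\le-C_2Z^{-1}$ for all $Z>0$. *)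

(* Defs.v *)
From HB Require Import structures.
From mathcomp Require Import all_boot all_order all_algebra.
From mathcomp Require Import all_classical all_reals all_analysis.

Set Implicit Arguments.
Unset Strict Implicit.
Unset Printing Implicit Defensive.

Import Order.TTheory GRing.Theory Num.Theory.
Import numFieldNormedType.Exports.

Local Open Scope classical_set_scope.
Local Open Scope ring_scope.

(* Used only with [V] finite-dimensional, where existence and continuity of all
   directional derivatives up to order [k] is the usual C^k class. *)
Fixpoint Ck {R : realType} {V : normedModType R} (k : nat) (U : set V)
    (f : V -> R) : Prop :=
  (forall x, U x -> {for x, continuous f}) /\
  if k is k'.+1 then
    forall v, (forall x, U x -> derivable f x v) /\ Ck k' U (fun x => 'D_v f x)
  else True.

(* On a set [A] which need not be open, [f] is C^k (resp. smooth) when it agrees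
   on [A] with a C^k (resp. smooth) function defined near [A]; values of [f]
   outside [A] are irrelevant. *)
Definition Ck_on {R : realType} {V : normedModType R} (k : nat) (A : set V)
    (f : V -> R) : Prop :=
  exists (U : set V) (g : V -> R),
    [/\ open U, A `<=` U, Ck k U g & forall x, A x -> f x = g x].

Definition smooth_on {R : realType} {V : normedModType R} (A : set V)
    (f : V -> R) : Prop :=
  exists (U : set V) (g : V -> R),
    [/\ open U, A `<=` U, forall k, Ck k U g & forall x, A x -> f x = g x].

(* R^3 is [R * R * R]; vector values are row vectors. [mspace3 R] and
   [mtime_space R] are convertible to [space3 R] and [R * space3 R]; they carry
   the products of the Borel sigma-algebra on which the library defines Lebesgue
   measure. *)
Notation space3 R := (R * R * R)%type.
Notation mspace3 R :=
  (measurableTypeR R * measurableTypeR R * measurableTypeR R)%type.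
Notation mtime_space R := (measurableTypeR R * mspace3 R)%type.

(* The library's sigma-finite instance on [\x] is only found for subprobability
   measures. *)
Lemma product_sigma_finite d1 d2 (T1 : measurableType d1)
    (T2 : measurableType d2) (R : realType)
    (m1 : {sigma_finite_measure set T1 -> \bar R})
    (m2 : {sigma_finite_measure set T2 -> \bar R}) :
  sigma_finite setT (m1 \x m2)%E.
Proof.
have /sigma_finiteP[F [TF ndF Foo]] := sigma_finiteT m1.
have /sigma_finiteP[G [TG ndG Goo]] := sigma_finiteT m2.
exists (fun n => F n `*` G n).
  rewrite -setXTT TF TG predeqE => -[x y]; split.
    move=> [/= [n _ Fnx] [k _ Gky]]; exists (maxn n k) => //; split.
    - by move: x Fnx; exact/subsetPset/ndF/leq_maxl.
    - by move: y Gky; exact/subsetPset/ndG/leq_maxr.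
  by move=> [n _ []/= ? ?]; split; exists n.
move=> k; have [? ?] := Foo k; have [? ?] := Goo k.
split; first exact: measurableX.
by rewrite product_measure1E// lte_mul_pinfty// ge0_fin_numE.
Qed.

Definition leb2 {R : realType} :
    set (measurableTypeR R * measurableTypeR R)%type -> \bar R :=
  (@lebesgue_measure R \x @lebesgue_measure R)%E.
HB.instance Definition _ (R : realType) := Measure.on (@leb2 R).
HB.instance Definition _ (R : realType) :=
  @Measure_isSigmaFinite.Build _ _ _ (@leb2 R) (product_sigma_finite _ _).

Definition leb3 {R : realType} : set (mspace3 R) -> \bar R :=
  (@leb2 R \x @lebesgue_measure R)%E.
HB.instance Definition _ (R : realType) := Measure.on (@leb3 R).
HB.instance Definition _ (R : realType) :=
  @Measure_isSigmaFinite.Build _ _ _ (@leb3 R) (product_sigma_finite _ _).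

Definition leb_time_space {R : realType} : set (mtime_space R) -> \bar R :=
  (@lebesgue_measure R \x @leb3 R)%E.
HB.instance Definition _ (R : realType) := Measure.on (@leb_time_space R).
HB.instance Definition _ (R : realType) :=
  @Measure_isSigmaFinite.Build _ _ _ (@leb_time_space R)
    (product_sigma_finite _ _).

Section Calculus.
Variable R : realType.
Implicit Types (f : space3 R -> R) (v : space3 R -> 'rV[R]_3)
  (M : space3 R -> 'M[R]_3) (x : space3 R).

Definition std_basis (i : 'I_3) : space3 R :=
  (((i == 0%N :> nat)%:R, (i == 1%N :> nat)%:R), (i == 2%N :> nat)%:R).

Definition grad f x : 'rV[R]_3 := \row_i 'D_(std_basis i) f x.

Definition gradv v x : 'M[R]_3 :=
  \matrix_(i, j) 'D_(std_basis j) (fun y => v y 0 i) x.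

Definition div v x : R := \sum_i 'D_(std_basis i) (fun y => v y 0 i) x.

Definition divM M x : 'rV[R]_3 :=
  \row_i \sum_j 'D_(std_basis j) (fun y => M y i j) x.

Definition dot (a b : 'rV[R]_3) : R := \sum_i a 0 i * b 0 i.

Definition sqnorm (a : 'rV[R]_3) : R := dot a a.

Definition frob2 (A : 'M[R]_3) : R := \sum_i \sum_j A i j ^+ 2.

End Calculus.

Section Domain.
Variables (R : realType) (Omega : set (space3 R)).

Definition boundary : set (space3 R) := closure Omega `\` interior Omega.

Definition local_defining_function (x : space3 R) (g : space3 R -> R) : Prop :=
  exists U : set (space3 R),
    [/\ open U, U x, forall k, Ck k U g, grad g x != 0
      & forall y, U y -> (Omega y <-> g y < 0) /\ (boundary y <-> g y = 0)].

Definition smooth_bounded_domain : Prop :=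
  [/\ open Omega, connected Omega, Omega !=set0, bounded_set Omega
    & forall x, boundary x -> exists g, local_defining_function x g].

Definition outer_unit_normal (x : space3 R) (n : 'rV[R]_3) : Prop :=
  exists2 g, local_defining_function x g
    & n = (Num.sqrt (sqnorm (grad g x)))^-1 *: grad g x.

Definition test_function (phi : space3 R -> R) : Prop :=
  (forall k, Ck k setT phi) /\
  exists K, [/\ compact K, K `<=` Omega & forall x, ~ K x -> phi x = 0].

(* H^1_0 as the H^1-closure of the test functions. It is only applied to
   functions smooth on [Omega], whose weak gradient is the classical one. *)
Definition H10 (f : space3 R -> R) : Prop :=
  exists phi : nat -> space3 R -> R,
    (forall n, test_function (phi n)) /\
    (\int[leb3]_(x in Omega)
       ((f x - phi n x) ^+ 2 + sqnorm (grad f x - grad (phi n) x))%:E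
     @[n --> \oo] --> 0)%E.

(* The Bochner measurability of a smooth vector field in time is automatic. *)
Definition L2_H10 (T : R) (u : R -> space3 R -> 'rV[R]_3) : Prop :=
  {ae lebesgue_measure, forall t : R, 0 < t < T ->
     forall i, H10 (fun x => u t x 0 i)} /\
  (\int[lebesgue_measure]_(t in `]0%R, T[) \int[leb3]_(x in Omega)
     (sqnorm (u t x) + frob2 (gradv (u t) x))%:E < +oo)%E.

Definition Linfty_Lp (T q : R) (rho : R -> space3 R -> R) : Prop :=
  exists M : R, {ae lebesgue_measure, forall t : R, 0 < t < T ->
    ('N[leb3]_(q%:E)[(EFin \o rho t) \_ Omega] <= M%:E)%E}.

End Domain.

Section Constitutive.
Variable R : realType.
Implicit Types (p e s : R -> R -> R) (mu eta kappa P S : R -> R).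

Definition D_rho (f : R -> R -> R) (rho theta : R) : R :=
  derive1 (fun r => f r theta) rho.

Definition D_theta (f : R -> R -> R) (rho theta : R) : R :=
  derive1 (f rho) theta.

Definition C1_pos_quadrant (f : R -> R -> R) : Prop :=
  Ck_on 1 [set z : R * R | 0 < z.1 /\ 0 < z.2] (fun z => f z.1 z.2).

Definition C1_halfline (f : R -> R) : Prop := Ck_on 1 [set x : R | 0 <= x] f.

Definition gibbs p e s : Prop := forall rho theta : R, 0 < rho -> 0 < theta ->
  theta * D_rho s rho theta =
    D_rho e rho theta + p rho theta * D_rho (fun r _ => r^-1) rho theta /\
  theta * D_theta s rho theta =
    D_theta e rho theta + p rho theta * D_theta (fun r _ => r^-1) rho theta.

Definition thermodynamic_stability p e : Prop :=
  (forall rho : R, 0 < rho ->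
     exists2 e0 : R, 0 < e0 & e rho theta @[theta --> 0^'+] --> e0) /\
  exists c : R, forall rho theta : R, 0 < rho -> 0 < theta ->
    [/\ 0 < D_rho p rho theta,
        0 < D_theta e rho theta, D_theta e rho theta <= c
      & `|rho * D_rho e rho theta| <= c * e rho theta].

Definition monoatomic_gas p e s P S : Prop :=
  [/\ forall rho theta : R, 0 < rho -> 0 < theta ->
        [/\ p rho theta = 2 / 3 * rho * e rho theta,
            p rho theta = theta `^ (5 / 2) * P (rho / theta `^ (3 / 2))
          & s rho theta = S (rho / theta `^ (3 / 2))],
      P 0 = 0,
      exists2 d : R, 0 < d & h^-1 * (P h - P 0) @[h --> 0^'+] --> d,
      forall Z : R, 0 < Z -> derivable S Z 1 /\
        derive1 S Z = - (3 / 2) * ((5 / 3 * P Z - Z * derive1 P Z) / Z ^+ 2)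
    & exists c1 : R, forall Z : R, 0 < Z -> - c1 * Z^-1 <= derive1 S Z].

Definition transport_bounds mu kappa : Prop :=
  exists alpha mu_lo mu_hi kappa_lo kappa_hi m_hi : R,
    [/\ 2 / 5 < alpha <= 1, 0 < mu_lo < mu_hi, 0 < kappa_lo < kappa_hi,
        0 < m_hi
      & [/\ forall theta : R, 0 <= theta ->
              (1 + theta `^ alpha) * mu_lo <= mu theta <=
              (1 + theta `^ alpha) * mu_hi,
            forall theta : R, 0 < theta -> `|derive1 mu theta| <= m_hi
          & forall theta : R, 0 <= theta ->
              kappa_lo <= kappa theta <= kappa_hi * (1 + theta `^ alpha)]].

Definition nondegeneracy eta S : Prop :=
  (\forall theta \near 0^'+, theta <= eta theta) /\
  exists2 C2 : R, 0 < C2 & forall Z : R, 0 < Z -> derive1 S Z <= - C2 * Z^-1.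

Record constitutive_laws p e s mu eta kappa P S : Prop := ConstitutiveLaws {
  law_p_C1 : C1_pos_quadrant p;
  law_e_C1 : C1_pos_quadrant e;
  law_s_C1 : C1_pos_quadrant s;
  law_mu_C1 : C1_halfline mu;
  law_eta_C1 : C1_halfline eta;
  law_kappa_C1 : C1_halfline kappa;
  law_P_C1 : C1_halfline P;
  law_gibbs : gibbs p e s;
  law_stability : thermodynamic_stability p e;
  law_gas : monoatomic_gas p e s P S;
  law_transport : transport_bounds mu kappa;
  law_nondegenerate : nondegeneracy eta S
}.

End Constitutive.

Section System.
Variables (R : realType) (T : R) (Omega : set (space3 R)).
Variables (p s : R -> R -> R) (mu eta kappa : R -> R).
Variables (rho theta : R -> space3 R -> R) (u : R -> space3 R -> 'rV[R]_3).

Definition symgrad (t : R) (x : space3 R) : 'M[R]_3 :=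
  gradv (u t) x + (gradv (u t) x)^T.

Definition shear (t : R) (x : space3 R) : 'M[R]_3 :=
  2 *: symgrad t x - (2 / 3 * div (u t) x)%:M.

Definition stress (t : R) (x : space3 R) : 'M[R]_3 :=
  mu (theta t x) *: shear t x + (eta (theta t x) * div (u t) x)%:M.

Definition dissipation (t : R) (x : space3 R) : R :=
  (mu (theta t x) * frob2 (shear t x)
     + 2 * eta (theta t x) * `|div (u t) x| ^+ 2) / (2 * theta t x)
  + kappa (theta t x) * sqnorm (grad (theta t) x) / theta t x ^+ 2.

Definition continuity_residual (t : R) (x : space3 R) : R :=
  derive1 (fun r => rho r x) t + div (fun y => rho t y *: u t y) x.

Definition momentum_residual (t : R) (x : space3 R) : 'rV[R]_3 :=
  derive1 (fun r => rho r x *: u r x) t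
  + divM (fun y => rho t y *: ((u t y)^T *m u t y)) x
  + grad (fun y => p (rho t y) (theta t y)) x
  - divM (stress t) x.

Definition entropy_production (t : R) (x : space3 R) : R :=
  derive1 (fun r => rho r x * s (rho r x) (theta r x)) t
  + div (fun y => (rho t y * s (rho t y) (theta t y)) *: u t y) x
  + div (fun y => (- kappa (theta t y) / theta t y) *: grad (theta t) y) x.

Variable sigma : {measure set (mtime_space R) -> \bar R}.

(* [sigma] dominates the dissipation as a measure on [0,T] x closure(Omega). The
   right-hand side has the dissipation as density with respect to Lebesgue
   measure, hence ignores the null sets t = 0, t = T and x in the boundary. *)
Definition sigma_ge_dissipation : Prop :=
  forall A : set (mtime_space R), measurable A ->
    A `<=` `[0, T] `*` closure Omega ->
    (\int[leb_time_space]_(z in A `&` (`]0%R, T[ `*` Omega))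
       (dissipation z.1 z.2)%:E <= sigma A)%E.

(* The entropy balance equates a function with a measure: in (0,T) x Omega,
   [sigma] has density [entropy_production]. *)
Definition entropy_balance : Prop :=
  forall A : set (mtime_space R), measurable A -> A `<=` `]0, T[ `*` Omega ->
    (sigma A =
     \int[leb_time_space]_(z in A) (entropy_production z.1 z.2)%:E)%E.

Variables (rho0 theta0 : space3 R -> R) (m0 : space3 R -> 'rV[R]_3).

(* Functions are total and only their values on [0,T) x closure(Omega) matter;
   hence the normal derivative on the boundary is the limit from inside. *)
Record classical_NSF_solution : Prop := ClassicalNSFSolution {
  nsf_rho_smooth :
    smooth_on (`[0, T[ `*` closure Omega) (fun z : R * space3 R => rho z.1 z.2);
  nsf_theta_smooth :
    smooth_on (`[0, T[ `*` closure Omega)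
      (fun z : R * space3 R => theta z.1 z.2);
  nsf_u_smooth : forall i,
    smooth_on (`[0, T[ `*` closure Omega)
      (fun z : R * space3 R => u z.1 z.2 0 i);
  nsf_rho_gt0 : forall (t : R) (x : space3 R),
    0 <= t < T -> closure Omega x -> 0 < rho t x;
  nsf_theta_gt0 : forall (t : R) (x : space3 R),
    0 <= t < T -> closure Omega x -> 0 < theta t x;
  nsf_continuity : forall (t : R) (x : space3 R), 0 < t < T -> Omega x ->
    continuity_residual t x = 0;
  nsf_momentum : forall (t : R) (x : space3 R),
    0 < t < T -> Omega x -> momentum_residual t x = 0;
  nsf_entropy : entropy_balance;
  nsf_sigma : sigma_ge_dissipation;
  nsf_init_rho : forall x : space3 R, closure Omega x -> rho 0 x = rho0 x;
  nsf_init_momentum : forall x : space3 R,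
    closure Omega x -> rho 0 x *: u 0 x = m0 x;
  nsf_init_theta : forall x : space3 R, closure Omega x -> theta 0 x = theta0 x;
  nsf_dirichlet : forall (t : R) (x : space3 R),
    0 <= t < T -> boundary Omega x -> u t x = 0;
  nsf_neumann : forall (t : R) (x : space3 R) n,
    0 <= t < T -> outer_unit_normal Omega x n ->
    boundary Omega x ->
    dot (grad (theta t) y) n @[y --> within Omega (nbhs x)] --> 0
}.

Definition truncated_entropy (C t : R) (x : space3 R) : R :=
  s (rho t x) C - s (rho t x) (Num.min (theta t x) C).

Definition cold_region (C t : R) : set (space3 R) :=
  Omega `&` [set x | theta t x <= C].

End System.

(* Main.v *)
(** For a C^1 function h(theta) the entropy equation may be multiplied by h and
    integrated. With smooth decreasing h converging to the indicator of
    {theta <= C}, integration by parts and the Neumann condition give the flux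
    term the sign of - h'(theta) kappa |grad theta|^2 / theta >= 0, so the heat
    flux through the boundary of {theta <= C} can be dropped. With smooth concave
    functions m of theta, equal to theta below C and converging to min(theta, C)
    with m' converging to the same indicator, the continuity equation and the
    Dirichlet condition give the evolution of the integral of
    rho (s(rho, C) - s(rho, m(theta))). Both limits are dominated convergence,
    and no regularity of the level set {theta = C} is needed.

    The divergence theorem is only needed for fields F tangential to the
    boundary. Multiply F by cutoffs h(- n g) in a local defining function g:
    since F . grad g = O(|g|), the terms grad(h(- n g)) . F are bounded and tend
    to 0 pointwise, and only compactly supported fields are left to integrate. *)

Require Import Defs.
From HB Require Import structures.
From mathcomp Require Import all_boot all_order all_algebra.
From mathcomp Require Import all_classical all_reals all_analysis.
From mathcomp Require Import measurable_realfun ring lra.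
Import Order.TTheory GRing.Theory Num.Theory.
Import numFieldNormedType.Exports.
Local Open Scope classical_set_scope.
Local Open Scope ring_scope.
Set Implicit Arguments.
Unset Strict Implicit.
Unset Printing Implicit Defensive.

(** * Functions of class C^1 *)

(** The function min(theta, C) is not C^1 and {theta = C} may have positive measure, so two
    different regularisations are used. [softmin] has slope exactly 1 up to C and slope tending to 0
    above; [softstep] equals 1 up to C and tends to 0 above; hence both select the closed set {theta
    <= C}. The slope of [softmin] has a kink at C and cannot be placed under a divergence;
    [softstep] is C^1 and takes that role for the heat flux. The measure [sigma] is never multiplied
    by a function: it is evaluated on the cold set alone, between dissipation and entropy
    production, and [softstep] only serves to give the heat term a sign there. All limits have
    constant dominating functions: the fields extend to an open neighbourhood of the compact set
    [t0, t1] x closure(Omega), with positive density and temperature, so every integrand is bounded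
    uniformly in n. As s is only C^1, the calculus stays at order one; the only second derivatives
    are those of theta and of the boundary functions g. *)

Lemma is_derive_lineP (R : realType) (V : normedModType R) (f : V -> R)
    (x v : V) (df : R) :
  is_derive x v f df <-> is_derive (0 : R) 1 (fun h : R => f (h *: v + x)) df.
Proof.
have E : (fun h : R => h^-1 *: ((f \o shift x) (h *: v) - f x)) =
  (fun h : R => h^-1 *: (((fun k : R => f (k *: v + x)) \o shift 0) (h *: 1)
     - f (0 *: v + x))).
  by apply/funext => h /=; rewrite addr0 scale0r add0r [_%:A]mulr1.
split=> -[d e]; split.
- by move: d; rewrite /derivable E.
- by move: e; rewrite /derive E.
- by move: d; rewrite /derivable E.
- by move: e; rewrite /derive E.
Qed.

(** [f] is only derivable along [v], not differentiable. On the line through [x] in direction [v]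
    the two notions agree, so the one-variable chain rule applies. *)
Lemma is_derive_comp1 (R : realType) (V : normedModType R) (f : V -> R)
    (phi : R -> R) (x v : V) (df dphi : R) :
  is_derive x v f df -> is_derive (f x) 1 phi dphi ->
  is_derive x v (fun y => phi (f y)) (dphi * df).
Proof.
move=> /is_derive_lineP df0 dphi0; apply/is_derive_lineP.
have dphi1 : is_derive (f (0 *: v + x)) 1 phi dphi by rewrite scale0r add0r.
split.
- apply/derivable1_diffP/differentiable_comp; apply/derivable1_diffP => //.
- rewrite -derive1E (@derive1_comp _ (fun h : R => f (h *: v + x)) phi)//.
  by rewrite !derive1E !derive_val.
Qed.

Lemma is_derive_continuous (R : realType) (f : R -> R) (x df : R) :
  is_derive x 1 f df -> {for x, continuous f}.
Proof.
by move=> -[d _]; apply: differentiable_continuous; exact/derivable1_diffP.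
Qed.

Lemma is_derive_sndP (R : realType) (V1 V2 : normedModType R)
    (f : V1 * V2 -> R) (x : V1) (y v : V2) (df : R) :
  is_derive (x, y) (0, v) f df <-> is_derive y v (fun z => f (x, z)) df.
Proof.
apply: (iff_trans (is_derive_lineP _ _ _ _)).
apply: iff_sym; apply: (iff_trans (is_derive_lineP _ _ _ _)); apply: iff_sym.
suff -> : (fun h : R => f (h *: (0, v) + (x, y))) =
  (fun h : R => f (x, h *: v + y)) by [].
apply/funext => h; congr f.
by apply/pair_equal_spec; rewrite /= scaler0 add0r.
Qed.

Lemma is_derive_fstP (R : realType) (V1 V2 : normedModType R)
    (f : V1 * V2 -> R) (x v : V1) (y : V2) (df : R) :
  is_derive (x, y) (v, 0) f df <-> is_derive x v (fun z => f (z, y)) df.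
Proof.
apply: (iff_trans (is_derive_lineP _ _ _ _)).
apply: iff_sym; apply: (iff_trans (is_derive_lineP _ _ _ _)); apply: iff_sym.
suff -> : (fun h : R => f (h *: (v, 0) + (x, y))) =
  (fun h : R => f (h *: v + x, y)) by [].
apply/funext => h; congr f.
by apply/pair_equal_spec; rewrite /= scaler0 add0r.
Qed.

Lemma near_eq_continuous (T U : topologicalType) (f g : T -> U) (x : T) :
  (\near x, f x = g x) -> {for x, continuous f} -> {for x, continuous g}.
Proof.
move=> fg cf; rewrite /prop_for /continuous_at -(nbhs_singleton fg).
exact: cvg_trans (near_eq_cvg fg) cf.
Qed.

Lemma continuous_sum (R : realType) (T : topologicalType) n
    (f : 'I_n -> T -> R) (x : T) : (forall i, {for x, continuous (f i)}) ->
  {for x, continuous (fun y => \sum_i f i y)}.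
Proof.
elim: n f => [|n IH] f cf.
  rewrite (_ : (fun y => _) = cst 0); first exact: cst_continuous.
  by apply/funext => y; rewrite big_ord0.
rewrite (_ : (fun y => _) =
  (fun y => \sum_i f (widen_ord (leqnSn n) i) y + f ord_max y)); last first.
  by apply/funext => y; rewrite big_ord_recr.
by apply: cvgD; [apply: IH => i; exact: cf|exact: cf].
Qed.

Section class_C1.
Variables (R : realType) (V : normedModType R).
Implicit Types (W : set V) (f g : V -> R).

Lemma Ck1P W f : Ck 1 W f <->
  (forall x, W x -> {for x, continuous f}) /\
  (forall v, (forall x, W x -> derivable f x v) /\
             forall x, W x -> {for x, continuous ('D_v f)}).
Proof.
by split=> -[cf Df]; split=> // v; case: (Df v) => dv; [case|].
Qed.

Lemma Ck1_is_derive W f x v : Ck 1 W f -> W x -> is_derive x v f ('D_v f x).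
Proof. by move=> /Ck1P[_ /(_ v)[dv _]] Wx; apply: derivableP; exact: dv. Qed.

Lemma Ck1_continuous W f x : Ck 1 W f -> W x -> {for x, continuous f}.
Proof. by move=> /Ck1P[+ _]; exact. Qed.

Lemma Ck1_continuousD W f x v : Ck 1 W f -> W x -> {for x, continuous ('D_v f)}.
Proof. by move=> /Ck1P[_ /(_ v)[_ +]]; exact. Qed.

(** Since [W] is open, the derivative agrees with the candidate [df] near each point, so continuity
    can be transferred. *)
Lemma Ck1_intro W f (df : V -> V -> R) : open W ->
  (forall x, W x -> {for x, continuous f}) ->
  (forall x v, W x -> is_derive x v f (df v x)) ->
  (forall x v, W x -> {for x, continuous (df v)}) -> Ck 1 W f.
Proof.
move=> oW cf Df cdf; apply/Ck1P; split=> // v; split=> x Wx.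
  by have [] := Df x v Wx.
apply: (near_eq_continuous _ (cdf x v Wx)).
near=> y; have [|_ ->//] := Df y v _.
by near: y; exact: open_nbhs_nbhs.
Unshelve. all: by end_near. Qed.

Lemma Ck_subset k W W' f : W' `<=` W -> Ck k W f -> Ck k W' f.
Proof.
move=> W'W; elim: k f => [|k IH] f [cf Df]; split.
- by move=> x /W'W /cf.
- by [].
- by move=> x /W'W /cf.
- by move=> v; case: (Df v) => dv Dv; split; [move=> x /W'W /dv|exact: IH].
Qed.

(** Being C^k is local. This glues cutoffs that are C^1 on one open set and constant near every
    remaining point. *)
Lemma Ck_near k W f : (forall x, W x -> exists2 U, nbhs x U & Ck k U f) ->
  Ck k W f.
Proof.
elim: k f => [|k IH] f H; split=> //.
- by move=> x /H[U Ux [cf _]]; apply: cf; exact: nbhs_singleton.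
- by move=> x /H[U Ux [cf _]]; apply: cf; exact: nbhs_singleton.
- move=> v; split.
    move=> x /H[U Ux [_ Df]]; case: (Df v) => dv _.
    by apply: dv; exact: nbhs_singleton.
  by apply: IH => x /H[U Ux [_ Df]]; exists U => //; case: (Df v).
Qed.

Lemma near_eq_Ck1 W f g : open W -> (forall x, W x -> f x = g x) ->
  Ck 1 W f -> Ck 1 W g.
Proof.
move=> oW fg Cf.
have nfg x : W x -> \near x, f x = g x.
  by move=> Wx; near=> y; apply: fg; near: y; exact: open_nbhs_nbhs.
apply: (@Ck1_intro _ _ (fun v x => 'D_v f x)) => //.
- move=> x Wx; apply: near_eq_continuous (Ck1_continuous Cf Wx); exact: nfg.
- move=> x v Wx; apply: near_eq_is_derive (Ck1_is_derive v Cf Wx); exact: nfg.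
- by move=> x v Wx; exact: (Ck1_continuousD Cf Wx).
Unshelve. all: by end_near. Qed.

Lemma Ck1_cst W (c : R) : open W -> Ck 1 W (fun=> c).
Proof.
move=> oW; apply: (@Ck1_intro _ _ (fun _ _ => 0)) => // *; exact: cst_continuous.
Qed.

Lemma Ck1D W f g : open W -> Ck 1 W f -> Ck 1 W g ->
  Ck 1 W (fun x => f x + g x).
Proof.
move=> oW Cf Cg; apply: (@Ck1_intro _ _ (fun v x => 'D_v f x + 'D_v g x)) => //.
- by move=> x Wx; apply: cvgD; [exact: (Ck1_continuous Cf)|exact: (Ck1_continuous Cg)].
- move=> x v Wx; have := Ck1_is_derive v Cf Wx; have := Ck1_is_derive v Cg Wx.
  by move=> *; exact: is_deriveD.
- move=> x v Wx; apply: cvgD; [exact: (Ck1_continuousD Cf)|exact: (Ck1_continuousD Cg)].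
Qed.

Lemma Ck1M W f g : open W -> Ck 1 W f -> Ck 1 W g ->
  Ck 1 W (fun x => f x * g x).
Proof.
move=> oW Cf Cg.
apply: (@Ck1_intro _ _ (fun v x => f x * 'D_v g x + g x * 'D_v f x)) => //.
- by move=> x Wx; apply: cvgM; [exact: (Ck1_continuous Cf)|exact: (Ck1_continuous Cg)].
- move=> x v Wx; have := Ck1_is_derive v Cf Wx; have := Ck1_is_derive v Cg Wx.
  by move=> *; exact: is_deriveM.
- move=> x v Wx; apply: cvgD; apply: cvgM.
  + exact: (Ck1_continuous Cf).
  + exact: (Ck1_continuousD Cg).
  + exact: (Ck1_continuous Cg).
  + exact: (Ck1_continuousD Cf).
Qed.

Lemma Ck1N W f : open W -> Ck 1 W f -> Ck 1 W (fun x => - f x).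
Proof.
move=> oW Cf; apply: (near_eq_Ck1 oW _ (Ck1M oW (Ck1_cst (-1) oW) Cf)).
by move=> x _; rewrite mulN1r.
Qed.

Lemma Ck1B W f g : open W -> Ck 1 W f -> Ck 1 W g ->
  Ck 1 W (fun x => f x - g x).
Proof. by move=> oW Cf Cg; exact: (Ck1D oW Cf (Ck1N oW Cg)). Qed.

Lemma Ck1_sum W n (f : 'I_n -> V -> R) : open W -> (forall i, Ck 1 W (f i)) ->
  Ck 1 W (fun x => \sum_i f i x).
Proof.
move=> oW; elim: n f => [|n IH] f Cf.
  by apply: (near_eq_Ck1 oW _ (Ck1_cst 0 oW)) => x _; rewrite big_ord0.
apply: (near_eq_Ck1 oW _ (Ck1D oW (IH (fun i => f (widen_ord (leqnSn n) i)) _)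
  (Cf ord_max))) => //.
by move=> x _; rewrite big_ord_recr.
Qed.

(** The derivative is carried along so that products and compositions compute it. It is two-sided at
    every point of [O], even at the end point of a closed half-line. *)
Definition C1fun (O : set R) (phi dphi : R -> R) :=
  forall y, O y -> is_derive y 1 phi (dphi y) /\ {for y, continuous dphi}.

Lemma Ck1_comp W f (O : set R) (phi dphi : R -> R) : open W ->
  C1fun O phi dphi -> (forall x, W x -> O (f x)) -> Ck 1 W f ->
  Ck 1 W (fun x => phi (f x)).
Proof.
move=> oW Cphi Of Cf.
apply: (@Ck1_intro _ _ (fun v x => dphi (f x) * 'D_v f x)) => //.
- move=> x Wx; have [d _] := Cphi _ (Of _ Wx).
  by apply: continuous_comp; [exact: (Ck1_continuous Cf)|exact: is_derive_continuous d].
- move=> x v Wx; have [d _] := Cphi _ (Of _ Wx).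
  by apply: is_derive_comp1 => //; exact: Ck1_is_derive Cf Wx.
- move=> x v Wx; have [d c] := Cphi _ (Of _ Wx).
  apply: cvgM; last exact: (Ck1_continuousD Cf).
  by apply: continuous_comp; [exact: (Ck1_continuous Cf)|].
Qed.

Lemma derive_C1comp W f (O : set R) (phi dphi : R -> R) x v :
  C1fun O phi dphi -> O (f x) -> Ck 1 W f -> W x ->
  'D_v (fun x => phi (f x)) x = dphi (f x) * 'D_v f x.
Proof.
move=> Cphi Ofx Cf Wx; have [d _] := Cphi _ Ofx.
by have [] := is_derive_comp1 (Ck1_is_derive v Cf Wx) d.
Qed.

Lemma derive_C1B W f g x v : Ck 1 W f -> Ck 1 W g -> W x ->
  'D_v (fun x => f x - g x) x = 'D_v f x - 'D_v g x.
Proof.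
move=> Cf Cg Wx.
by have [_ ->] := is_deriveB (Ck1_is_derive v Cf Wx) (Ck1_is_derive v Cg Wx).
Qed.

Lemma derive_C1M W f g x v : Ck 1 W f -> Ck 1 W g -> W x ->
  'D_v (fun x => f x * g x) x = f x * 'D_v g x + g x * 'D_v f x.
Proof.
move=> Cf Cg Wx.
by have [_ ->] := is_deriveM (Ck1_is_derive v Cf Wx) (Ck1_is_derive v Cg Wx).
Qed.

End class_C1.

(** * Cutoff profiles of one real variable *)

Section one_variable.
Variable R : realType.
Implicit Types (phi psi : R -> R) (O : set R).

Lemma C1fun_comp O O' phi dphi psi dpsi : C1fun O phi dphi ->
  C1fun O' psi dpsi -> (forall y, O y -> O' (phi y)) ->
  C1fun O (fun y => psi (phi y)) (fun y => dpsi (phi y) * dphi y).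
Proof.
move=> Cphi Cpsi OO' y Oy; have [d c] := Cphi y Oy.
have [d' c'] := Cpsi _ (OO' y Oy); split; first exact: is_derive_comp1.
by apply: cvgM => //; apply: continuous_comp => //; exact: is_derive_continuous d.
Qed.

Lemma C1funM O phi dphi psi dpsi : C1fun O phi dphi -> C1fun O psi dpsi ->
  C1fun O (fun y => phi y * psi y) (fun y => phi y * dpsi y + psi y * dphi y).
Proof.
move=> Cphi Cpsi y Oy; have [d c] := Cphi y Oy; have [d' c'] := Cpsi y Oy.
split; first exact: is_deriveM.
by apply: cvgD; apply: cvgM => //; apply: is_derive_continuous; eassumption.
Qed.

Lemma C1funD O phi dphi psi dpsi : C1fun O phi dphi -> C1fun O psi dpsi ->
  C1fun O (fun y => phi y + psi y) (fun y => dphi y + dpsi y).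
Proof.
move=> Cphi Cpsi y Oy; have [d c] := Cphi y Oy; have [d' c'] := Cpsi y Oy.
by split; [exact: is_deriveD|exact: cvgD].
Qed.

Lemma C1fun_affine O (a b : R) : C1fun O (fun y => a * y + b) (fun=> a).
Proof.
move=> y _; split; last exact: cst_continuous.
have := is_deriveD (is_deriveM (is_derive_cst a y 1) (is_derive_id y 1))
  (is_derive_cst b y 1).
by move=> /is_derive_eq; apply; rewrite /cst/= scaler0 !addr0 [_%:A]mulr1.
Qed.

Lemma C1fun_inv O : (forall y, O y -> y != 0) ->
  C1fun O (fun y => y^-1) (fun y => - y ^- 2).
Proof.
move=> O0 y Oy; have y0 := O0 y Oy; split.
  split; first exact: (@derivableV _ _ id).
  by rewrite (@deriveV _ _ id)// derive_id [_%:A]mulr1.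
apply: cvgN; apply: cvgV; first by rewrite expf_neq0.
exact: exprn_continuous.
Qed.

Lemma C1fun_ext O phi dphi dpsi : dphi =1 dpsi -> C1fun O phi dphi ->
  C1fun O phi dpsi.
Proof. by move=> /funext ->. Qed.

Lemma max0_continuous : continuous (fun y : R => Num.max y 0).
Proof. by move=> y; apply: continuous_max; [exact: cvg_id|exact: cvg_cst]. Qed.

(** Truncation freezes [G] on the negative axis. The critical point is 0, where the left slope 0
    meets the right slope [dG 0 = 0]. *)
Lemma C1fun_max0 (G dG : R -> R) : C1fun [set y | 0 <= y] G dG -> dG 0 = 0 ->
  C1fun setT (fun y => G (Num.max y 0)) (fun y => dG (Num.max y 0)).
Proof.
move=> CG dG0 y _; split; last first.
  have [_ c] := CG (Num.max y 0) (ltac:(by rewrite /= le_max lexx orbT)).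
  by apply: continuous_comp => //; exact: max0_continuous.
have [y0|y0|y0] := ltgtP y 0.
- apply: (@near_eq_is_derive _ _ _ (cst (G 0))).
    near=> z; rewrite /cst max_r//; apply: ltW.
    by near: z; exact: lt_nbhsl.
  by rewrite dG0; exact: is_derive_cst.
- apply: (@near_eq_is_derive _ _ _ G).
    near=> z; rewrite max_l//; apply: ltW.
    by near: z; exact: lt_nbhsr.
  by apply: (CG y (ltW y0)).1.
rewrite y0 dG0.
have [[dG_ e] _] := CG 0 (lexx 0).
suff : (fun h : R => h^-1 *: (((fun y => G (Num.max y 0)) \o shift 0) (h *: 1) -
    G (Num.max 0 0))) @ 0^' --> (0 : R).
  by move=> H; split; [apply/cvg_ex; exists 0|exact: cvg_lim H].
have cG : (fun h : R => h^-1 *: ((G \o shift 0) (h *: 1) - G 0)) @ 0^' --> dG 0.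
  by rewrite -e; exact: dG_.
rewrite dG0 in cG.
(* The difference quotient at 0 is that of [G] for h > 0 and 0 for h <= 0, so a bound on the former
   bounds it. *)
apply/cvgr0Pnorm_lt => eps eps0.
move/cvgr0Pnorm_lt : cG => /(_ _ eps0); apply: filterS => h /=.
rewrite maxxx [h *: 1]mulr1 addr0; case: (lerP h 0) => // h0.
by rewrite subrr scaler0 normr0.
Unshelve. all: by end_near. Qed.

Definition sqpos (y : R) : R := Num.max y 0 ^+ 2.

Lemma sqpos_ge0 y : 0 <= sqpos y. Proof. exact: sqr_ge0. Qed.

Lemma sqpos_le0 y : y <= 0 -> sqpos y = 0.
Proof. by move=> y0; rewrite /sqpos max_r// expr0n. Qed.

Lemma sqpos_C1 : C1fun setT sqpos (fun y => 2 * Num.max y 0).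
Proof.
apply: (@C1fun_max0 (fun y => y ^+ 2) (fun y => 2 * y)); last by rewrite mulr0.
move=> y _; split; last by apply: cvgM; [exact: cvg_cst|exact: cvg_id].
have := is_deriveX 2 (is_derive_id y 1).
by move=> /is_derive_eq; apply; rewrite [_%:A]mulr1.
Qed.

Definition plateau (y : R) : R := sqpos (1 - sqpos (y - 1)).

Lemma plateau_C1 : exists dphi, C1fun setT plateau dphi.
Proof.
have H1 := C1fun_comp (@C1fun_affine setT 1 (-1)) sqpos_C1 (fun _ _ => I).
have H2 := C1fun_comp H1 (@C1fun_affine setT (-1) 1) (fun _ _ => I).
have H3 := C1fun_comp H2 sqpos_C1 (fun _ _ => I).
eexists; move: H3; rewrite (_ : (fun y => sqpos _) = plateau); first by exact.
by apply/funext => y; rewrite /plateau; congr sqpos; rewrite mulN1r addrC mul1r.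
Qed.

Lemma plateau1 y : y <= 1 -> plateau y = 1.
Proof.
move=> y1; rewrite /plateau (@sqpos_le0 (y - 1)) ?subr_le0// subr0.
by rewrite /sqpos max_l ?ler01// expr1n.
Qed.

Lemma plateau0 y : 2 <= y -> plateau y = 0.
Proof.
move=> y2; rewrite /plateau sqpos_le0// subr_le0 /sqpos max_l; last lra.
by rewrite expr_ge1//; lra.
Qed.

Lemma plateau_itv y : 0 <= plateau y <= 1.
Proof.
rewrite sqpos_ge0 /plateau /sqpos /= expr_le1// ?le_max ?lexx ?orbT//.
by rewrite ge_max ler01 andbT gerBl sqr_ge0.
Qed.

(** This will be evaluated at t = -n g - 1: the shift by 1 makes it vanish in a whole neighbourhood
    of {g = 0}, and the slow approach to 1 gives the decay of the slope in [dramp_bound]. *)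
Definition ramp (y : R) : R := 1 - (1 + sqpos y)^-1.
Definition dramp (y : R) : R := (1 + sqpos y) ^- 2 * (2 * Num.max y 0).

Lemma ramp_C1 : C1fun setT ramp dramp.
Proof.
have H1 := C1fun_comp sqpos_C1 (@C1fun_affine setT 1 1) (fun _ _ => I).
have H2 := C1fun_comp H1 (@C1fun_inv [set y | y != 0] (fun y => id)).
have /H2 {}H2 : forall y : R, setT y -> [set y : R | y != 0] (1 * sqpos y + 1).
  by move=> y _ /=; rewrite gt_eqF// mul1r ltr_wpDl ?sqpos_ge0.
have H3 := C1fun_comp H2 (@C1fun_affine setT (-1) 1) (fun _ _ => I).
rewrite (_ : ramp = (fun y => -1 * (1 * sqpos y + 1)^-1 + 1)); last first.
  by apply/funext => y; rewrite /ramp mulN1r mul1r [in RHS]addrC (addrC 1 (sqpos y)).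
apply: C1fun_ext H3 => y /=.
by rewrite /dramp !mul1r mulN1r (addrC (sqpos y)) mulNr opprK.
Qed.

Lemma ramp_le0 y : y <= 0 -> ramp y = 0.
Proof. by move=> y0; rewrite /ramp sqpos_le0// addr0 invr1 subrr. Qed.

Lemma ramp_itv y : 0 <= ramp y <= 1.
Proof.
have h : 1 <= 1 + sqpos y by rewrite lerDl sqpos_ge0.
have h0 : 0 < 1 + sqpos y by apply: lt_le_trans h.
by rewrite /ramp subr_ge0 invf_le1// h gerBl invr_ge0 ltW.
Qed.

Lemma dramp_ge0 y : 0 <= dramp y.
Proof.
rewrite /dramp mulr_ge0 ?invr_ge0 ?exprn_ge0 ?addr_ge0 ?sqpos_ge0//.
by rewrite mulr_ge0// le_max lexx orbT.
Qed.

(** For t = -n g - 1 and g < 0 one has n |g| = 1 + t, so this controls n ramp'(t) |g|: the right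
    side is at most 4 and tends to 0 as t grows. *)
Lemma dramp_bound y : (1 + y) * dramp y <= 4 / (1 + sqpos y).
Proof.
rewrite /dramp; have s0 := sqpos_ge0 y; rewrite /sqpos in s0 *.
case: (leP y 0) => y0; first by rewrite !mulr0 expr0n/= addr0 divr1.
have D0 : 1 + y ^+ 2 != 0 by rewrite gt_eqF//; nra.
rewrite -subr_ge0 (_ : _ - _ = (4 * (1 + y ^+ 2) - (1 + y) * (2 * y)) /
  (1 + y ^+ 2) ^+ 2); last by field.
by rewrite divr_ge0 ?sqr_ge0//; nra.
Qed.

End one_variable.

(** * Measurability and integration of continuous functions *)

(* [e] is the identity between a measurable space and a topological space with
   the same carrier; the two structures live on convertible types. *)
Definition countable_base_measurable (T : topologicalType) d
    (M : measurableType d) (e : M -> T) :=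
  exists B : nat -> set T, (forall n, measurable (e @^-1` B n)) /\
    forall (U : set T) x, open U -> U x -> exists n, B n x /\ B n `<=` U.

(** An open set is the union of the base sets it contains; there are countably many, each measurable
    for the product sigma-algebra. *)
Lemma base_open_measurable (T : topologicalType) d (M : measurableType d)
    (e : M -> T) (U : set T) :
  countable_base_measurable e -> open U -> measurable (e @^-1` U).
Proof.
move=> [B [mB baseB]] oU.
have -> : e @^-1` U = \bigcup_(n in [set n | B n `<=` U]) (e @^-1` B n).
  rewrite predeqE => x; split=> [Ux|[n /= BU Bx]]; last exact: BU.
  by have [n [Bnx BnU]] := baseB U (e x) oU Ux; exists n.
by apply: bigcup_measurable => n _; exact: mB.
Qed.

Lemma base_continuous_measurable (R : realType) (T : topologicalType) d
    (M : measurableType d) (e : M -> T) (D : set T) (f : T -> R) :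
  countable_base_measurable e -> open D ->
  (forall x, D x -> {for x, continuous f}) ->
  measurable_fun (e @^-1` D) (f \o e).
Proof.
move=> Be oD cf; apply: (measurability _ (RGenOpens.measurableE R)).
move=> _ [_ [a [b ->] <-]].
rewrite (_ : _ `&` _ = e @^-1` (D `&` f @^-1` `]a, b[)) //.
apply: base_open_measurable => //.
rewrite openE => x [Dx fx]; apply: filterI; first exact: open_nbhs_nbhs.
by apply: (cf x Dx); apply: open_nbhs_nbhs; split => //; exact: interval_open.
Qed.

Lemma countable_base_measurable_prod (T1 T2 : topologicalType) d1 d2
    (M1 : measurableType d1) (M2 : measurableType d2) (e1 : M1 -> T1)
    (e2 : M2 -> T2) :
  countable_base_measurable e1 -> countable_base_measurable e2 ->
  countable_base_measurable (fun z : M1 * M2 => (e1 z.1, e2 z.2)).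
Proof.
move=> [B1 [mB1 base1]] [B2 [mB2 base2]].
(* One natural number codes a pair of indices; a number coding no pair gets (0, 0), a harmless
   repetition. *)
pose B n := let: (i, j) := odflt (0, 0)%N (@unpickle (nat * nat)%type n) in
  B1 i `*` B2 j.
exists B; split=> [n|U [x y] oU Uxy].
  rewrite /B; case: (odflt _ _) => i j.
  by rewrite (_ : _ @^-1` _ = (e1 @^-1` B1 i) `*` (e2 @^-1` B2 j))//;
    apply: measurableX.
have /= [[A1 A2] /= [A1x A2y] A12] := open_nbhs_nbhs (conj oU Uxy).
have [i [B1x B1A]] := base1 _ x (open_interior A1) A1x.
have [j [B2y B2A]] := base2 _ y (open_interior A2) A2y.
exists (pickle (i, j)); rewrite /B pickleK /=; split=> // -[a b] [/= Ba Bb].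
by apply: A12; split; apply: interior_subset; [exact: B1A|exact: B2A].
Qed.

Lemma countable_base_R (R : realType) :
  countable_base_measurable (id : measurableTypeR R -> R).
Proof.
pose B n : set R := let: (p, q) := odflt (0, 0) (@unpickle (rat * rat)%type n) in
  `]ratr p, ratr q[%classic.
exists B; split=> [n|U x oU Ux].
  by rewrite /B; case: (odflt _ _) => p q; exact: measurable_itv.
have /nbhs_ballP[eps /= eps0 xU] := open_nbhs_nbhs (conj oU Ux).
have [p] : {p : rat | ratr p \in `]x - eps, x[ : Prop}.
  by apply: cid; apply: rat_in_itvoo; rewrite ltrBlDr ltrDl.
rewrite in_itv/= => /andP[p1 p2].
have [q] : {q : rat | ratr q \in `]x, x + eps[ : Prop}.
  by apply: cid; apply: rat_in_itvoo; rewrite ltrDl.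
rewrite in_itv/= => /andP[q1 q2].
exists (pickle (p, q)); rewrite /B pickleK /=; split.
  by rewrite in_itv/= p2 q1.
move=> y; rewrite /= in_itv/= => /andP[py yq]; apply: xU.
rewrite /ball/= ltr_norml; apply/andP; split; lra.
Qed.

Section integration.
Context d (M : measurableType d) (R : realType).
Variable mu : {measure set M -> \bar R}.
Implicit Types (D : set M) (f : M -> R).

Lemma bounded_integrable D f (b : R) : measurable D -> (mu D < +oo)%E ->
  measurable_fun D f -> (forall x, D x -> `|f x| <= b) ->
  mu.-integrable D (EFin \o f).
Proof.
move=> mD muD mf fb; apply: measurable_bounded_integrable => //.
by exists b; split; [exact: num_real|move=> c bc x /fb /le_trans; apply; exact: ltW].
Qed.

(** A constant is an integrable dominating function because [D] has finite measure; measurability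
    and the bound pass to the limit. *)
Lemma Rintegral_bounded_cvg D (f_ : nat -> M -> R) f (b : R) :
  measurable D -> (mu D < +oo)%E ->
  (forall n, measurable_fun D (f_ n)) ->
  (forall n x, D x -> `|f_ n x| <= b) ->
  (forall x, D x -> f_ n x @[n --> \oo] --> f x) ->
  \int[mu]_(x in D) f_ n x @[n --> \oo] --> \int[mu]_(x in D) f x.
Proof.
move=> mD muD mf fb ff.
have mflim : measurable_fun D f.
  apply: (measurable_fun_cvg mf) => //.
have flim x : D x -> `|f x| <= b.
  move=> Dx; have h : `|f_ n x| @[n --> \oo] --> `|f x|.
    by apply: cvg_norm; exact: ff.
  apply: (cvgr_to_le h).
  by apply: nearW => n; exact: fb.
have int_f := bounded_integrable mD muD mflim flim.
apply: fine_cvg; rewrite fineK; last exact: integrable_fin_num.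
apply: (@dominated_cvg _ _ _ mu D mD _ _ (cst b%:E)) => //.
- by move=> n; apply/measurable_EFinP.
- by move=> x Dx; apply: cvg_EFin; [exact: nearW|exact: ff].
- apply: (@bounded_integrable _ (cst b) `|b|) => //; exact: measurable_cst.
Qed.

Lemma EFin_Rintegral D f : measurable D -> mu.-integrable D (EFin \o f) ->
  (\int[mu]_(x in D) (f x)%:E)%E = (\int[mu]_(x in D) f x)%:E.
Proof. by move=> mD /(integrable_fin_num mD) ?; rewrite /Rintegral fineK. Qed.

Lemma Rintegral_sum D n (f : 'I_n -> M -> R) : measurable D ->
  (forall i, mu.-integrable D (EFin \o f i)) ->
  mu.-integrable D (EFin \o (fun x => \sum_i f i x)) /\
  \int[mu]_(x in D) (\sum_i f i x) = \sum_i \int[mu]_(x in D) f i x.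
Proof.
move=> mD; elim: n f => [|n IH] f intf.
  have E : (fun x => \sum_(i < 0) f i x) = cst 0.
    by apply/funext => x; rewrite big_ord0.
  rewrite E big_ord0; split; first exact: integrable0.
  by rewrite /Rintegral integral0_eq.
have E : (fun x => \sum_i f i x) =
    (fun x => \sum_i f (widen_ord (leqnSn n) i) x + f ord_max x).
  by apply/funext => x; rewrite big_ord_recr.
have [intS eS] := IH (fun i => f (widen_ord (leqnSn n) i)) (fun i => intf _).
rewrite E big_ord_recr /=; split; first exact: (integrableD mD intS (intf ord_max)).
by rewrite RintegralD// eS.
Qed.

End integration.

Lemma compact_bounded_fun (R : realType) (T : topologicalType) (K : set T)
    (f : T -> R) : compact K -> (forall x, K x -> {for x, continuous f}) ->
  exists2 b : R, 0 <= b & forall x, K x -> `|f x| <= b.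
Proof.
move=> cK cf.
have /compact_bounded[b [_ fb]] : compact (f @` K).
  apply: continuous_compact => //; apply: continuous_in_subspaceT => x.
  by rewrite inE => /cf.
exists (`|b| + 1); first by rewrite addr_ge0.
by move=> x Kx; apply: (fb (`|b| + 1)); [rewrite ltr_pwDr// ler_norm|exists x].
Qed.

Section lebesgue_products.
Variable R : realType.

Lemma countable_base2 : countable_base_measurable
  (id : (measurableTypeR R * measurableTypeR R)%type -> (R * R)%type).
Proof.
rewrite (_ : id = (fun z : measurableTypeR R * measurableTypeR R => (z.1, z.2))).
  exact: (countable_base_measurable_prod (countable_base_R R) (countable_base_R R)).
by apply/funext => -[].
Qed.

Lemma countable_base3 : countable_base_measurable (id : mspace3 R -> space3 R).
Proof.
rewrite (_ : id = (fun z : mspace3 R => (z.1, z.2))).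
  exact: (countable_base_measurable_prod countable_base2 (countable_base_R R)).
by apply/funext => -[].
Qed.

Lemma countable_base_time_space : countable_base_measurable
  (id : mtime_space R -> (R * space3 R)%type).
Proof.
rewrite (_ : id = (fun z : mtime_space R => (z.1, z.2))).
  exact: (countable_base_measurable_prod (countable_base_R R) countable_base3).
by apply/funext => -[].
Qed.

Definition box2 (a : R) : set (R * R) := `[-a, a] `*` `[-a, a].
Definition box3 (a : R) : set (space3 R) := box2 a `*` `[-a, a].

Lemma measurable_box2 a :
  measurable (box2 a : set (measurableTypeR R * measurableTypeR R)%type).
Proof. by apply: measurableX; exact: measurable_itv. Qed.

Lemma measurable_box3 a : measurable (box3 a : set (mspace3 R)).
Proof. by apply: measurableX; [exact: measurable_box2|exact: measurable_itv]. Qed.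

Lemma lebesgue_itvcc_lty (a b : R) :
  (@lebesgue_measure R `[a, b]%classic < +oo)%E.
Proof.
by rewrite lebesgue_measure_itv/=; case: ifPn => // _; rewrite -EFinB ltry.
Qed.

Lemma leb2_box_lty a : (leb2 (box2 a) < +oo)%E.
Proof.
rewrite /leb2 product_measure1E; [|exact: measurable_itv..].
by apply: lte_mul_pinfty => //; [rewrite ge0_fin_numE// lebesgue_itvcc_lty
  |exact: lebesgue_itvcc_lty].
Qed.

Lemma leb3_box_lty a : (leb3 (box3 a) < +oo)%E.
Proof.
rewrite /leb3 product_measure1E; [|exact: measurable_box2|exact: measurable_itv].
apply: lte_mul_pinfty => //; last exact: lebesgue_itvcc_lty.
by rewrite ge0_fin_numE//; exact: leb2_box_lty.
Qed.

Lemma leb_time_space_lty (a b : R) (A : set (mspace3 R)) : measurable A ->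
  (leb3 A < +oo)%E -> (leb_time_space (`]a, b[ `*` A) < +oo)%E.
Proof.
move=> mA Afin; rewrite /leb_time_space product_measure1E//.
apply: lte_mul_pinfty => //; rewrite ge0_fin_numE//.
apply: le_lt_trans (lebesgue_itvcc_lty a b).
apply: le_measure; rewrite ?inE; try exact: measurable_itv.
exact: subset_itv_oo_cc.
Qed.

Lemma bounded_set_box3 (A : set (space3 R)) : bounded_set A ->
  exists a : R, A `<=` box3 a.
Proof.
move=> [b [_ Ab]]; exists (`|b| + 1) => -[[x y] z] Axyz.
have {Ab}: `|(x, y, z)| <= `|b| + 1.
  by apply: Ab Axyz; rewrite ltr_pwDr// ler_norm.
rewrite !prod_normE/= !ge_max => /andP[/andP[xb yb] zb].
by rewrite /box3 /box2 /= !in_itv/= -!ler_norml.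
Qed.

Lemma compact_box3 a : compact (box3 a).
Proof.
by apply: compact_setX; [apply: compact_setX|]; exact: segment_compact.
Qed.

Lemma integrable_compact_support d (M : measurableType d) (T : topologicalType)
    (e : M -> T) (mu : {measure set M -> \bar R}) (f : T -> R) (K : set T) :
  countable_base_measurable e -> continuous f -> compact K ->
  measurable (e @^-1` K) -> (mu (e @^-1` K) < +oo)%E ->
  (forall x, ~ K x -> f x = 0) -> mu.-integrable setT (EFin \o (f \o e)).
Proof.
move=> Be cf cK mK muK f0.
have mf : measurable_fun setT (f \o e).
  by apply: (base_continuous_measurable Be openT) => x _; exact: cf.
have [b _ fb] := compact_bounded_fun cK (fun x _ => cf x).
have fK : EFin \o (f \o e) = (EFin \o (f \o e)) \_ (e @^-1` K).
  apply/funext => x; rewrite patchE; case: ifPn => //; rewrite notin_setE.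
  by move=> /= nK; rewrite f0.
rewrite fK; apply/(integrable_restrict _ mK) => //; rewrite setTI.
apply: (@bounded_integrable _ _ _ _ _ _ b) => //.
- exact: measurable_funS mf.
- by move=> x Kx; exact: fb.
Qed.

Lemma integral_derive_line (g g' : R -> R) (a : R) :
  continuous g' -> (forall x : R, is_derive x 1 g (g' x)) ->
  (forall x, ~ `[-a, a]%classic x -> g x = 0) ->
  (\int[lebesgue_measure]_x (g' x)%:E = 0)%E.
Proof.
(* The hypothesis on [g] only concerns points outside [-a, a]. The larger [b] makes [g] vanish at
   both end points of [-b, b], and it is positive even if [a] is negative. *)
move=> cg' dg g0; pose b := `|a| + 1.
have b0 : 0 < b by rewrite /b ltr_pwDr.
have bab x : ~ `]-b, b[%classic x -> ~ `[-a, a]%classic x.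
  apply: contra_not; rewrite /= !in_itv/= => /andP[xa ax].
  by have := ler_norm a; rewrite /b => ?; apply/andP; split; lra.
have g'0 x : ~ `[-b, b]%classic x -> g' x = 0.
  move=> xb; have [_ <-] := dg x.
  rewrite (@near_eq_derive _ _ _ g (cst 0)) ?derive_cst//.
  have oC : open (~` `[-b, b]%classic) by apply: closed_openC; exact: itv_closed.
  near=> y; apply: g0; apply: bab => yb.
  have : (~` `[-b, b]%classic) y by near: y; exact: open_nbhs_nbhs.
  by apply; apply: subset_itv_oo_cc.
rewrite (_ : (fun x => _) = (fun x => (g' x)%:E) \_ `[-b, b]%classic); last first.
  apply/funext => x; rewrite patchE; case: ifPn => //; rewrite notin_setE.
  by move=> /g'0 ->.
rewrite -integral_mkcond (@continuous_FTC2 _ g' g).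
- rewrite !g0 ?sube0//; apply: bab; rewrite /= in_itv/= ?ltxx ?andbF//.
- lra.
- exact: continuous_subspaceT.
- split.
  + by move=> x _; have [] := dg x.
  + by apply: cvg_at_right_filter; exact: is_derive_continuous (dg _).
  + by apply: cvg_at_left_filter; exact: is_derive_continuous (dg _).
- by move=> x _; rewrite derive1E; have [] := dg x.
Unshelve. all: by end_near. Qed.

End lebesgue_products.

Lemma continuous_slicer (T1 T2 U : topologicalType) (f : T1 * T2 -> U)
    (c : T1) (x : T2) :
  {for (c, x), continuous f} -> {for x, continuous (fun y => f (c, y))}.
Proof.
move=> cf; apply: continuous_comp; last exact: cf.
by apply: (cvg_pair (f := cst c) (g := id)); [exact: cvg_cst|exact: cvg_id].
Qed.

Lemma continuous_slicel (T1 T2 U : topologicalType) (f : T1 * T2 -> U)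
    (c : T2) (x : T1) :
  {for (x, c), continuous f} -> {for x, continuous (fun y => f (y, c))}.
Proof.
move=> cf; apply: continuous_comp; last exact: cf.
by apply: (cvg_pair (f := id) (g := cst c)); [exact: cvg_id|exact: cvg_cst].
Qed.

Section compact_support.
Variable R : realType.

Lemma derive_support (V : normedModType R) (G : V -> R) (K : set V) (x v : V) :
  closed K -> (forall y, ~ K y -> G y = 0) -> ~ K x -> 'D_v G x = 0.
Proof.
move=> cK G0 Kx; rewrite (@near_eq_derive _ _ _ G (cst 0)) ?derive_cst//.
near=> y; apply: G0; rewrite -/((~` K) y); near: y.
by apply: open_nbhs_nbhs; split=> //; exact: closed_openC.
Unshelve. all: by end_near. Qed.

Lemma closed_box3 (a : R) : closed (box3 a : set (space3 R)).
Proof.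
by apply: compact_closed; [exact: norm_hausdorff|exact: compact_box3].
Qed.

(** Fubini with the differentiated coordinate innermost reduces the claim to [integral_derive_line].
    Coordinates are nested pairs, so the first two need two splittings and the third one. *)
Lemma integral_derive_compact_support (G : space3 R -> R) (a : R) (i : 'I_3) :
  Ck 1 setT G -> (forall x, ~ box3 a x -> G x = 0) ->
  (\int[leb3]_x ('D_(std_basis R i) G x)%:E = 0)%E.
Proof.
move=> CG G0; set v := std_basis R i.
have cDG : continuous ('D_v G) by move=> x; exact: (Ck1_continuousD CG).
have DG0 x : ~ box3 a x -> 'D_v G x = 0.
  by move=> Kx; apply: (derive_support _ (@closed_box3 a) G0 Kx).
have iDG : leb3.-integrable setT (fun x : mspace3 R => ('D_v G x)%:E).
  apply: (integrable_compact_support (countable_base3 R) cDG (compact_box3 (a := a))) => //.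
  - exact: measurable_box3.
  - exact: leb3_box_lty.
have dG x : is_derive x v G ('D_v G x) by exact: (Ck1_is_derive v CG).
case: i @v cDG DG0 iDG dG => -[|[|[|//]]] Hi v cDG DG0 iDG dG.
- have Ev : v = ((1, 0), 0) by rewrite /v /std_basis /=.
  rewrite -(integral21_prod_meas1 iDG) /fubini_G.
  apply: integral0_eq => c _.
  have cDGc : continuous (fun p : R * R => 'D_v G (p, c)).
    by move=> p; exact: (@continuous_slicel (R * R)%type R R ('D_v G) c p (cDG _)).
  have iDGc : leb2.-integrable setT
      (fun p : measurableTypeR R * measurableTypeR R => ('D_v G (p, c))%:E).
    apply: (integrable_compact_support (countable_base2 R) cDGc (K := box2 a)) => //.
    + by apply: compact_setX; exact: segment_compact.
    + exact: measurable_box2.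
    + exact: leb2_box_lty.
    + by move=> p np; apply: DG0 => -[].
  rewrite -(integral21_prod_meas1 iDGc) /fubini_G.
  apply: integral0_eq => b _.
  apply: (@integral_derive_line _ (fun x => G (x, b, c)) _ a).
  + by move=> x; exact: (@continuous_slicel R R R (fun p => 'D_v G (p, c)) b x (cDGc _)).
  + move=> x; have := dG (x, b, c); rewrite Ev.
    by move=> /(is_derive_fstP (V1 := (R * R)%type) (V2 := R)) /(is_derive_fstP (V1 := R) (V2 := R) (fun p => G (p, c))).
  + by move=> x nx; apply: G0 => -[[]].
- have Ev : v = ((0, 1), 0) by rewrite /v /std_basis /=.
  rewrite -(integral21_prod_meas1 iDG) /fubini_G.
  apply: integral0_eq => c _.
  have cDGc : continuous (fun p : R * R => 'D_v G (p, c)).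
    by move=> p; exact: (@continuous_slicel (R * R)%type R R ('D_v G) c p (cDG _)).
  have iDGc : leb2.-integrable setT
      (fun p : measurableTypeR R * measurableTypeR R => ('D_v G (p, c))%:E).
    apply: (integrable_compact_support (countable_base2 R) cDGc (K := box2 a)) => //.
    + by apply: compact_setX; exact: segment_compact.
    + exact: measurable_box2.
    + exact: leb2_box_lty.
    + by move=> p np; apply: DG0 => -[].
  rewrite -(integral12_prod_meas1 iDGc) /fubini_F.
  apply: integral0_eq => b _.
  apply: (@integral_derive_line _ (fun x => G (b, x, c)) _ a).
  + by move=> x; exact: (@continuous_slicer R R R (fun p => 'D_v G (p, c)) b x (cDGc _)).
  + move=> x; have := dG (b, x, c); rewrite Ev.
    by move=> /(is_derive_fstP (V1 := (R * R)%type) (V2 := R)) /(is_derive_sndP (V1 := R) (V2 := R) (fun p => G (p, c))).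
  + by move=> x nx; apply: G0 => -[[]].
- have Ev : v = ((0, 0), 1) by rewrite /v /std_basis /=.
  rewrite -(integral12_prod_meas1 iDG) /fubini_F.
  apply: integral0_eq => p _.
  apply: (@integral_derive_line _ (fun x => G (p, x)) _ a).
  + by move=> x; exact: (@continuous_slicer (R * R)%type R R ('D_v G) p x (cDG _)).
  + move=> x; have := dG (p, x); rewrite Ev.
    by move=> /(is_derive_sndP (V1 := (R * R)%type) (V2 := R)).
  + by move=> x nx; apply: G0 => -[].
Qed.

End compact_support.

(** * The divergence theorem for tangential fields *)

Lemma is_derive_line_at (R : realType) (V : normedModType R) (f : V -> R)
    (x v : V) (s df : R) :
  is_derive (s *: v + x) v f df ->
  is_derive s 1 (fun h : R => f (h *: v + x)) df.
Proof.
move=> /is_derive_lineP H; apply/is_derive_lineP.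
suff -> : (fun h : R => f ((h *: 1 + s) *: v + x)) =
  (fun h => f (h *: v + (s *: v + x))) by [].
by apply/funext => h; rewrite [h *: 1]mulr1 scalerDl addrA.
Qed.

Lemma is_deriveZv (R : realType) (V : normedModType R) (f : V -> R)
    (x v : V) (c df : R) :
  is_derive x v f df -> is_derive x (c *: v) f (c * df).
Proof.
move=> /is_derive_lineP H; apply/is_derive_lineP.
have [d _] := @C1fun_affine R setT c 0 0 I.
rewrite mulrC.
have H' : is_derive (c * 0 + 0) 1 (fun h : R => f (h *: v + x)) df.
  by rewrite mulr0 addr0.
have := is_derive_comp1 d H'.
suff -> : (fun y : R => f ((c * y + 0) *: v + x)) = (fun h => f (h *: (c *: v) + x)) by [].
by apply/funext => h; rewrite addr0 scalerA mulrC.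
Qed.

(* Following a direction transverse to {g = 0} from y, one meets {g = 0} at
   distance O(|g y|). *)
Lemma transversal_bound (R : realType) (V : normedModType R) (U : set V)
    (g q : V -> R) (x v : V) :
  open U -> U x -> Ck 1 U g -> Ck 1 U q -> 'D_v g x != 0 ->
  (forall y, U y -> g y = 0 -> q y = 0) ->
  exists r C : R, [/\ 0 < r, 0 <= C, ball x r `<=` U &
    forall y, ball x r y -> `|q y| <= C * `|g y|].
Proof.
move=> oU Ux Cg Cq gx0 gq.
(* Normalised so that the slope of [g] along [w] is 1 at [x], hence at least 1/2 nearby. *)
pose w := ('D_v g x)^-1 *: v.
have Dw : 'D_w g x = 1.
  have [_ ->] := is_deriveZv ('D_v g x)^-1 (Ck1_is_derive v Cg Ux).
  by rewrite mulVf.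
pose L := `|'D_w q x| + `|q x| + 1.
have L0 : 0 < L by rewrite /L ltr_wpDl.
have : \forall y \near x, [/\ U y, 2^-1 <= 'D_w g y, `|'D_w q y| <= L & `|q y| <= L].
  have nU : \forall y \near x, U y by exact: open_nbhs_nbhs.
  have nDg : \forall y \near x, 2^-1 < 'D_w g y.
    by apply: (cvgr_gt _ (Ck1_continuousD Cg Ux)); rewrite Dw; lra.
  have nDq : \forall y \near x, `|'D_w q y| < L.
    apply: (cvgr_norm_lt _ (Ck1_continuousD Cq Ux)).
    by rewrite /L; have := normr_ge0 (q x); lra.
  have nq : \forall y \near x, `|q y| < L.
    apply: (cvgr_norm_lt _ (Ck1_continuous Cq Ux)).
    by rewrite /L; have := normr_ge0 ('D_w q x); lra.
  near=> y; split; [near: y; exact: nU|apply: ltW; near: y; exact: nDg|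
    apply: ltW; near: y; exact: nDq|apply: ltW; near: y; exact: nq].
move=> /nbhs_ballP[rho /= rho0 B].
(* Half of the radius is for [y], the other half for moving along [w]: parameters up to [k] displace
   by at most [r]. *)
pose r := rho / 2; pose k := r / (`|w| + 1).
have r0 : 0 < r by rewrite /r; lra.
have w0 : 0 < `|w| + 1 by rewrite ltr_wpDl.
have k0 : 0 < k by rewrite /k divr_gt0.
have kw : k * (`|w| + 1) = r by rewrite /k divfK// gt_eqF.
have rrho : r <= rho by rewrite /r; lra.
clearbody k L.
have L2 : 0 <= 2 * L by lra.
have Lk : 0 <= 2 * L / k by apply: divr_ge0 => //; exact: ltW.
exists r, (2 * L / k + 2 * L); split=> //.
- exact: (addr_ge0 Lk L2).
- by move=> y xy; have [] := B y (le_ball rrho xy).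
move=> y xy.
have Bs (s : R) : `|s| <= k -> ball x rho (s *: w + y).
  move=> sk; rewrite -ball_normE /=; rewrite -ball_normE /= in xy.
  have -> : x - (s *: w + y) = (x - y) - s *: w by rewrite opprD addrCA addrC.
  rewrite (splitr rho); apply: le_lt_trans (ler_normB _ _) _.
  apply: ltr_leD => //; rewrite normrZ.
  apply: le_trans (ler_wpM2r (normr_ge0 w) sk) _.
  have : k * `|w| <= r by rewrite -kw ler_pM2l// lerDl.
  by rewrite /r.
have [By1 By2 By3 By4] := B y (le_ball rrho xy).
have g0 := normr_ge0 (g y).
rewrite mulrDl.
(* If 2 |g y| exceeds [k], the crude bound [L] on [q] is at most (2 L / k) |g y|; this is the first
   summand of the constant. *)
have [large|small] := ltP k (2 * `|g y|).
  apply: (le_trans By4); apply: (@le_trans _ _ (2 * L / k * `|g y|)).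
    by rewrite mulrAC ler_pdivlMr// (mulrC 2) -mulrA ler_pM2l// ltW.
  by rewrite lerDl; exact: (mulr_ge0 L2 g0).
apply: (@le_trans _ _ (2 * L * `|g y|)); last first.
  by rewrite lerDr; exact: (mulr_ge0 Lk g0).
(* With slope at least 1/2, moving by [tau] either way changes [g] by at least |g y|, so [g] has a
   zero in between. There [q] vanishes, and on the way back to [y] it varies by at most
   [L * tau]. *)
set tau := 2 * `|g y| in small.
have tau0 : 0 <= tau by rewrite /tau mulr_ge0.
have dline (f : V -> R) (s : R) : Ck 1 U f -> `|s| <= k ->
    is_derive s 1 (fun h : R => f (h *: w + y)) ('D_w f (s *: w + y)).
  move=> Cf sk; apply: is_derive_line_at; apply: (Ck1_is_derive _ Cf).
  by have [] := B _ (Bs s sk).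
have cline (f : V -> R) (a b : R) : Ck 1 U f -> `|a| <= k -> `|b| <= k ->
    {within `[a, b], continuous (fun h : R => f (h *: w + y))}.
  move=> Cf ak bk; apply: continuous_in_subspaceT => s; rewrite inE/= in_itv/= => /andP[as_ sb].
  apply: (is_derive_continuous (dline f s Cf _)).
  by move: ak bk; rewrite !ler_norml => /andP[? ?] /andP[? ?]; apply/andP; split; lra.
have mvt (f : V -> R) (a b : R) : Ck 1 U f -> a <= b -> `|a| <= k -> `|b| <= k ->
    exists2 c, ball x rho (c *: w + y) &
      f (b *: w + y) - f (a *: w + y) = 'D_w f (c *: w + y) * (b - a).
  move=> Cf ab ak bk.
  have inab (s : R) : a <= s <= b -> `|s| <= k.
    by move: ak bk; rewrite !ler_norml => /andP[? ?] /andP[? ?] /andP[? ?]; apply/andP; split; lra.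
  have [c cab ->] := @MVT_segment _ (fun h : R => f (h *: w + y)) (fun s : R => 'D_w f (s *: w + y)) a b ab
    (fun s sab => dline f s Cf (inab s (subset_itv_oo_cc sab))) (cline f a b Cf ak bk).
  by exists c => //; apply: Bs; apply: inab; rewrite in_itv in cab.
have k0n : `|0 : R| <= k by rewrite normr0 ltW.
have tk : `|tau| <= k by rewrite ger0_norm.
have ntk : `|- tau| <= k by rewrite normrN.
have gtau : 0 <= g (tau *: w + y).
  have [c /B[_ dc _ _]] := mvt g 0 tau Cg tau0 k0n tk.
  rewrite scale0r add0r subr0 => /eqP; rewrite subr_eq => /eqP ->.
  have := ler_wpM2r tau0 dc; have := ler_norm (- g y); rewrite normrN /tau; lra.
have gntau : g (- tau *: w + y) <= 0.
  have [c /B[_ dc _ _]] := mvt g (- tau) 0 Cg (ltac:(lra)) ntk k0n.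
  rewrite scale0r add0r sub0r opprK => /eqP; rewrite subr_eq addrC -subr_eq => /eqP <-.
  have := ler_wpM2r tau0 dc; have := ler_norm (g y); rewrite /tau; lra.
have [s stau gs0] : exists2 s, s \in `[- tau, tau] & g (s *: w + y) = 0.
  apply: (@IVT _ (fun s : R => g (s *: w + y))); [lra|exact: cline|].
  by rewrite ge_min gntau /= le_max gtau orbT.
have stau' : `|s| <= tau by rewrite ler_norml; rewrite in_itv in stau.
have sk : `|s| <= k by exact: le_trans small.
have qs : q (s *: w + y) = 0 by apply: gq => //; have [] := B _ (Bs s sk).
have [s0|s0] := leP 0 s.
  have [c /B[_ _ Dc _]] := mvt q 0 s Cq s0 k0n sk.
  rewrite qs scale0r !add0r subr0 => /(congr1 Num.norm); rewrite normrN normrM => ->.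
  apply: (le_trans (ler_pM (normr_ge0 _) (normr_ge0 _) Dc stau')).
  by rewrite /tau mulrCA mulrA.
have [c /B[_ _ Dc _]] := mvt q s 0 Cq (ltW s0) sk k0n.
rewrite qs scale0r add0r subr0 sub0r => ->; rewrite normrM normrN.
apply: (le_trans (ler_pM (normr_ge0 _) (normr_ge0 _) Dc stau')).
by rewrite /tau mulrCA mulrA.
Unshelve. all: by end_near. Qed.

Lemma is_derive_fst (R : realType) (V1 V2 : normedModType R) (f : V1 -> R)
    (x v : V1 * V2) (df : R) :
  is_derive x.1 v.1 f df -> is_derive x v (fun z => f z.1) df.
Proof. by move=> /is_derive_lineP H; apply/is_derive_lineP. Qed.

Lemma is_derive_snd (R : realType) (V1 V2 : normedModType R) (f : V2 -> R)
    (x v : V1 * V2) (df : R) :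
  is_derive x.2 v.2 f df -> is_derive x v (fun z => f z.2) df.
Proof. by move=> /is_derive_lineP H; apply/is_derive_lineP. Qed.

Lemma Ck1_fst (R : realType) (V1 V2 : normedModType R) (f : V1 -> R) :
  Ck 1 setT f -> Ck 1 setT (fun z : V1 * V2 => f z.1).
Proof.
move=> Cf; apply: (@Ck1_intro _ _ _ _ (fun v z => 'D_(v.1) f z.1)) => //.
- exact: openT.
- by move=> x _; apply: continuous_comp; [exact: cvg_fst|exact: (Ck1_continuous Cf)].
- by move=> x v _; apply: is_derive_fst; exact: (Ck1_is_derive _ Cf).
- move=> x v _; apply: (@continuous_comp _ _ _ fst ('D_(v.1) f)); first exact: cvg_fst.
  exact: (Ck1_continuousD Cf).
Qed.

Lemma Ck1_snd (R : realType) (V1 V2 : normedModType R) (f : V2 -> R) :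
  Ck 1 setT f -> Ck 1 setT (fun z : V1 * V2 => f z.2).
Proof.
move=> Cf; apply: (@Ck1_intro _ _ _ _ (fun v z => 'D_(v.2) f z.2)) => //.
- exact: openT.
- by move=> x _; apply: continuous_comp; [exact: cvg_snd|exact: (Ck1_continuous Cf)].
- by move=> x v _; apply: is_derive_snd; exact: (Ck1_is_derive _ Cf).
- move=> x v _; apply: (@continuous_comp _ _ _ snd ('D_(v.2) f)); first exact: cvg_snd.
  exact: (Ck1_continuousD Cf).
Qed.

Lemma Ck1_C1fun (R : realType) (phi dphi : R -> R) (O : set R) : open O ->
  C1fun O phi dphi -> Ck 1 O phi.
Proof.
move=> oO Cphi; apply: (@Ck1_intro R R O phi (fun v y : R => v * dphi y)) => //.
- by move=> y Oy; have [d _] := Cphi y Oy; exact: is_derive_continuous d.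
- move=> y v Oy; have [d _] := Cphi y Oy; have := is_deriveZv v d.
  by rewrite [v *: 1]mulr1.
- by move=> y v Oy; have [_ c] := Cphi y Oy; apply: cvgM => //; exact: cvg_cst.
Qed.

(** * Bump functions on cubes *)

Section bump.
Variable R : realType.

Definition bump1 (a r y : R) : R := plateau (((y - a) / r) ^+ 2).
(** The norm on nested pairs is the maximum norm: balls are cubes, and a product of one-variable
    bumps fits them. *)
Definition bump3 (a : space3 R) (r : R) (x : space3 R) : R :=
  bump1 a.1.1 r x.1.1 * bump1 a.1.2 r x.1.2 * bump1 a.2 r x.2.

Lemma bump1_C1 (a r : R) : Ck 1 setT (bump1 a r).
Proof.
have [dp Cp] := plateau_C1 R.
have H := @C1fun_affine R setT r^-1 (- (r^-1 * a)).
have H' := C1fun_comp (C1funM H H) Cp (fun _ _ => I).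
have -> : bump1 a r = (fun y => plateau ((r^-1 * y - r^-1 * a) * (r^-1 * y - r^-1 * a))).
  by apply/funext => y; rewrite /bump1 expr2 -mulrBr (mulrC r^-1).
exact: (Ck1_C1fun openT H').
Qed.

Lemma bump3_C1 (a : space3 R) r : Ck 1 setT (bump3 a r).
Proof.
apply: Ck1M; [exact: openT| |].
  apply: Ck1M; [exact: openT| |].
  - apply: (@Ck1_fst R (R * R)%type R (fun p => bump1 a.1.1 r p.1)).
    by apply: (@Ck1_fst R R R (bump1 a.1.1 r)); exact: bump1_C1.
  - apply: (@Ck1_fst R (R * R)%type R (fun p => bump1 a.1.2 r p.2)).
    by apply: (@Ck1_snd R R R (bump1 a.1.2 r)); exact: bump1_C1.
by apply: (@Ck1_snd R (R * R)%type R (bump1 a.2 r)); exact: bump1_C1.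
Qed.

Lemma bump1_itv a r y : 0 <= bump1 a r y <= 1. Proof. exact: plateau_itv. Qed.

Lemma bump3_itv a r x : 0 <= bump3 a r x <= 1.
Proof.
have /andP[x0 x1] := bump1_itv a.1.1 r x.1.1.
have /andP[y0 y1] := bump1_itv a.1.2 r x.1.2.
have /andP[z0 z1] := bump1_itv a.2 r x.2.
have xy0 := mulr_ge0 x0 y0; have xy1 := mulr_ile1 x0 y0 x1 y1.
by apply/andP; split; [exact: mulr_ge0|exact: mulr_ile1].
Qed.

Lemma bump1_near a r y : 0 < r -> `|a - y| < r -> bump1 a r y = 1.
Proof.
move=> r0 ay; apply: plateau1; rewrite -[_ ^+ 2]ger0_norm ?sqr_ge0// normrX.
rewrite expr_le1// normrM normfV (gtr0_norm r0) ler_pdivrMr// mul1r distrC.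
exact: ltW.
Qed.

Lemma bump1_far a r y : 0 < r -> 2 * r <= `|a - y| -> bump1 a r y = 0.
Proof.
move=> r0 ay; apply: plateau0; rewrite -[_ ^+ 2]ger0_norm ?sqr_ge0// normrX.
have : 2 <= `|(y - a) / r|.
  by rewrite normrM normfV (gtr0_norm r0) ler_pdivlMr// distrC.
nra.
Qed.

Lemma ball3E (a x : space3 R) (r : R) : ball a r x <->
  [/\ `|a.1.1 - x.1.1| < r, `|a.1.2 - x.1.2| < r & `|a.2 - x.2| < r].
Proof. by split=> [[[]]|[]]. Qed.

Lemma bump3_near a r x : ball a r x -> bump3 a r x = 1.
Proof.
move=> /ball3E[x1 x2 x3].
have r0 : 0 < r by apply: le_lt_trans x1.
by rewrite /bump3 !bump1_near// !mulr1.
Qed.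

Lemma bump3_far a r x : 0 < r -> ~ ball a (2 * r) x -> bump3 a r x = 0.
Proof.
move=> r0 nx; rewrite /bump3.
have [x1|x1] := ltP `|a.1.1 - x.1.1| (2 * r); last by rewrite bump1_far// !mul0r.
have [x2|x2] := ltP `|a.1.2 - x.1.2| (2 * r); last by rewrite (bump1_far r0 x2) mulr0 mul0r.
have [x3|x3] := ltP `|a.2 - x.2| (2 * r); last by rewrite (bump1_far r0 x3) mulr0.
by exfalso; apply: nx; apply/ball3E.
Qed.

End bump.

(** * Cutoffs adapted to a vector field *)

Section divergence.
Variables (R : realType) (Omega : set (space3 R)) (F : 'I_3 -> space3 R -> R).

Definition transport (chi : space3 R -> R) (x : space3 R) : R :=
  \sum_i 'D_(std_basis R i) chi x * F i x.

(** These are the properties for passing to the limit in div(chi F) = chi div F + F . grad chi. Only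
    the component of grad chi along [F] is controlled; the full gradient may grow like n near the
    boundary. *)
Record cutoff (chi : nat -> space3 R -> R) : Prop := Cutoff {
  cutoff_C1 : forall n, Ck 1 setT (chi n);
  cutoff_itv : forall n x, Omega x -> 0 <= chi n x <= 1;
  cutoff_cvg : forall x, Omega x -> chi n x @[n --> \oo] --> (1 : R);
  cutoff_bound : exists b : R, forall n x, Omega x -> `|transport (chi n) x| <= b;
  cutoff_transport : forall x, Omega x ->
    transport (chi n) x @[n --> \oo] --> (0 : R)
}.

Lemma transportM (chi1 chi2 : space3 R -> R) x :
  Ck 1 setT chi1 -> Ck 1 setT chi2 ->
  transport (fun x => chi1 x * chi2 x) x =
  chi1 x * transport chi2 x + chi2 x * transport chi1 x.
Proof.
move=> C1 C2; rewrite /transport !mulr_sumr -big_split/=.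
apply: eq_bigr => i _.
have d1 := Ck1_is_derive (std_basis R i) C1 (I : setT x).
have d2 := Ck1_is_derive (std_basis R i) C2 (I : setT x).
by have [_ ->] := is_deriveM d1 d2; rewrite mulrDl !mulrA.
Qed.

Lemma cutoff1 : cutoff (fun _ _ => 1).
Proof.
have t0 x : transport (fun=> 1) x = 0.
  by rewrite /transport big1// => i _; rewrite derive_cst mul0r.
split.
- by move=> n; apply: Ck1_cst; exact: openT.
- by move=> *; rewrite ler01 lexx.
- by move=> *; exact: cvg_cst.
- by exists 0 => n x _; rewrite t0 normr0.
- by move=> x _; under eq_fun do rewrite t0; exact: cvg_cst.
Qed.

(** [transport F] is a derivation and the factors lie in [0, 1], so bounds add and limits survive.
    Products assemble local cutoffs over a finite cover. *)
Lemma cutoffM chi1 chi2 : cutoff chi1 -> cutoff chi2 ->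
  cutoff (fun n x => chi1 n x * chi2 n x).
Proof.
case=> C1 i1 c1 [b1 hb1] t1 [C2 i2 c2 [b2 hb2] t2]; split.
- by move=> n; apply: Ck1M => //; exact: openT.
- move=> n x Ox; have /andP[? ?] := i1 n x Ox; have /andP[? ?] := i2 n x Ox.
  by rewrite mulr_ge0 ?mulr_ile1.
- by move=> x Ox; rewrite -[1]mulr1; apply: cvgM; [exact: c1|exact: c2].
- exists (b2 + b1) => n x Ox; rewrite transportM//.
  have /andP[p1 q1] := i1 n x Ox; have /andP[p2 q2] := i2 n x Ox.
  apply: (le_trans (ler_normD _ _)); rewrite !normrM (ger0_norm p1) (ger0_norm p2).
  apply: lerD.
    by rewrite -[b2]mul1r; apply: ler_pM => //; exact: hb2.
  by rewrite -[b1]mul1r; apply: ler_pM => //; exact: hb1.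
- move=> x Ox; under eq_fun do rewrite transportM//.
  have -> : (0 : R) = 1 * 0 + 1 * 0 by rewrite mulr0 addr0.
  by apply: cvgD; apply: cvgM; [exact: c1|exact: t2|exact: c2|exact: t1].
Qed.

End divergence.

Lemma inv_sqpos_cvg0 (R : realType) (c : R) : 0 < c ->
  (1 + sqpos (n%:R * c - 1))^-1 @[n --> \oo] --> 0.
Proof.
move=> c0; apply/cvgr0Pnorm_lt => eps eps0.
near=> n.
have s0 := sqpos_ge0 (n%:R * c - 1).
(* With x = n c, the linear minorant x / 2 of 1 + max(x - 1, 0)^2 is enough for the limit. *)
have h : n%:R * c / 2 <= 1 + sqpos (n%:R * c - 1).
  move: s0; rewrite /sqpos; case: (leP (n%:R * c - 1) 0) => ? ?; nra.
have nc : eps^-1 < n%:R * c / 2.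
  rewrite ltr_pdivlMr// -ltr_pdivrMr//; near: n; exact: nbhs_infty_gtr.
have p0 : 0 < 1 + sqpos (n%:R * c - 1) by lra.
by rewrite gtr0_norm ?invr_gt0// invf_plt ?posrE//; exact: lt_le_trans h.
Unshelve. all: by end_near. Qed.

Lemma compact_closure_bounded (R : realType) (A : set (space3 R)) :
  bounded_set A -> compact (closure A).
Proof.
move=> /bounded_set_box3[a Aa].
apply: (@subclosed_compact _ _ (box3 a)); [exact: closed_closure|exact: compact_box3|].
have /closure_id -> := @closed_box3 R a.
exact: closure_subset.
Qed.

Section local_cutoffs.
Variables (R : realType) (Omega W : set (space3 R)) (F : 'I_3 -> space3 R -> R).
Hypothesis domain : smooth_bounded_domain Omega.
Hypothesis oW : open W.
Hypothesis OmegaW : closure Omega `<=` W.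
Hypothesis C1F : forall i, Ck 1 W (F i).
Hypothesis tangential : forall x g, boundary Omega x ->
  local_defining_function Omega x g -> transport F g x = 0.

Lemma Ck1_transport (U : set (space3 R)) g : open U -> U `<=` W ->
  (forall i, Ck 1 U ('D_(std_basis R i) g)) -> Ck 1 U (transport F g).
Proof.
move=> oU UW Cg; apply: (Ck1_sum oU) => i.
exact: (Ck1M oU (Cg i) (Ck_subset UW (@C1F i))).
Qed.

Lemma open_domain : open Omega. Proof. by case: domain. Qed.

Lemma compact_closure_domain : compact (closure Omega).
Proof. by apply: compact_closure_bounded; case: domain. Qed.

(** Near [x0] the cutoff is ramp(-n g - 1); the bump [b] blends it into 1 further away. In Omega [g]
    is negative, so -n g grows and the cutoff tends to 1; around a boundary point -n g - 1 stays
    negative, so it vanishes. The singular part of F . grad chi is n ramp' times F . grad g, which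
    vanishes on {g = 0} by tangency and is therefore O(|g|). *)
Lemma local_cutoff x0 : boundary Omega x0 ->
  exists (chi : nat -> space3 R -> R) (N : set (space3 R)),
    [/\ cutoff Omega F chi, open N, N x0 & forall n y, boundary Omega y -> N y ->
      \near y, chi n y = 0].
Proof.
move=> bx0; have [_ _ _ _ /(_ _ bx0)[g [U [oU Ux0 Cg grad0 HU]]]] := domain.
have [k Dk0] : exists k, 'D_(std_basis R k) g x0 != 0.
  apply/existsP; apply: contra_neqT grad0 => /existsPn H.
  by apply/rowP => i; rewrite !mxE; apply/eqP; have := H i; rewrite negbK.
pose v := std_basis R k.
have C1g : Ck 1 U g by exact: Cg.
have C1Dg i : Ck 1 U ('D_(std_basis R i) g).
  by have [_ /(_ (std_basis R i))[_]] := Cg 2%N.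
(* A nonzero derivative along [v] keeps grad g nonzero, so [g] is a local defining function at every
   boundary point of [U1] and tangency applies at all of them. *)
pose U1 := [set y | [/\ U y, W y & 'D_v g y != 0]].
have oU1 : open U1.
  rewrite openE => y [Uy Wy Dy].
  have nD : \forall z \near y, 'D_v g z != 0.
    exact: (cvgr_neq0 _ (Ck1_continuousD C1g Uy) Dy).
  near=> z; split.
  - by near: z; exact: open_nbhs_nbhs.
  - by near: z; exact: open_nbhs_nbhs.
  - by near: z.
have U1U : U1 `<=` U by move=> y [].
have U1W : U1 `<=` W by move=> y [].
have U1x0 : U1 x0 by split=> //; apply: OmegaW; case: bx0.
have C1q : Ck 1 U1 (transport F g).
  by apply: Ck1_transport => // i; exact: Ck_subset (C1Dg i).
have gq y : U1 y -> g y = 0 -> transport F g y = 0.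
  move=> [Uy Wy Dy] gy0; have [_ bg] := HU y Uy; have by_ := bg.2 gy0.
  apply: tangential => //; exists U; split=> //.
  by apply: contraNneq Dy => /rowP/(_ k); rewrite !mxE => ->.
have [r [C [r0 C0 BU Bq]]] := transversal_bound oU1 U1x0
  (Ck_subset U1U C1g) C1q Dk0 gq.
pose B := ball x0 r; have oB : open B by exact: ball_open.
(* The bump vanishes off the ball of radius 2 rho = r / 2; the margin r / 2 makes it vanish in a
   neighbourhood of each point outside [B]. *)
pose rho := r / 4; have rho0 : 0 < rho by rewrite /rho divr_gt0.
pose b := bump3 x0 rho.
have C1b : Ck 1 setT b by exact: bump3_C1.
have b0 y : ~ B y -> \near y, b y = 0.
  move=> By; near=> z; apply: bump3_far => // zx0; apply: By.
  have : ball z (r / 2) y.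
    by near: z; apply/nbhs_ballP; exists (r / 2); [rewrite /= divr_gt0|move=> z; exact: ball_sym].
  move=> zy; have := ball_triangle zx0 zy; apply: le_ball.
  rewrite /rho; lra.
pose rmp n y : R := ramp (- n%:R * g y + -1).
pose chi n y : R := 1 - b y * (1 - rmp n y).
have C1affine (n : nat) := @C1fun_affine R setT (- n%:R) (-1).
have BU' : B `<=` U by move=> y /BU[].
have C1gB : Ck 1 B g by exact: Ck_subset C1g.
have C1rmp n : Ck 1 B (rmp n).
  exact: (Ck1_comp oB (C1fun_comp (C1affine n) (@ramp_C1 R) (fun _ _ => I)) (fun _ _ => I) C1gB).
have C1chiB n : Ck 1 B (chi n).
  apply: (Ck1B oB (Ck1_cst 1 oB)).
  apply: (Ck1M oB (Ck_subset (@subsetT _ B) C1b)).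
  exact: (Ck1B oB (Ck1_cst 1 oB) (C1rmp n)).
have chi1 n y : ~ B y -> \near y, 1 = chi n y.
  move=> /b0; apply: filterS => z bz0.
  by rewrite /chi bz0 mul0r subr0.
have C1chi n : Ck 1 setT (chi n).
  apply: Ck_near => y _; have [By|/(chi1 n) nBy] := pselect (B y).
    by exists B => //; exact: open_nbhs_nbhs.
  exists [set z | 1 = chi n z]°; first by exact: nbhs_interior.
  apply: (near_eq_Ck1 (open_interior _) _ (Ck1_cst 1 (open_interior _))).
  by move=> z /interior_subset.
have tB n y : B y -> transport F (chi n) y =
    - ((1 - rmp n y) * transport F b y) -
    b y * (dramp (- n%:R * g y + -1) * n%:R * transport F g y).
  move=> By; rewrite /transport !mulr_sumr -!sumrN -big_split/=.
  apply: eq_bigr => i _.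
  set e := std_basis R i.
  have dr : 'D_e (rmp n) y = dramp (- n%:R * g y + -1) * - n%:R * 'D_e g y.
    exact: (derive_C1comp e (C1fun_comp (C1affine n) (@ramp_C1 R)
      (fun _ _ => I)) (I : setT (g y)) C1gB By).
  have Cb : Ck 1 B b by exact: (Ck_subset (@subsetT _ B) C1b).
  have C1 := Ck1_cst (1 : R) oB; have C2 := Ck1B oB C1 (C1rmp n).
  rewrite /chi (derive_C1B e C1 (Ck1M oB Cb C2) By) (derive_C1M e Cb C2 By).
  by rewrite (derive_C1B e C1 (C1rmp n) By) dr derive_cst; ring.
have tnB n y : ~ B y -> transport F (chi n) y = 0.
  move=> By; rewrite /transport big1// => i _.
  by rewrite -(near_eq_derive _ (chi1 n y By)) derive_cst mul0r.
have OB y : Omega y -> B y -> g y < 0.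
  by move=> Oy /BU'/HU[[+ _] _]; apply.
have [b1 b10 tb] : exists2 b1, 0 <= b1 & forall y, closure Omega y -> `|transport F b y| <= b1.
  apply: compact_bounded_fun; first exact: compact_closure_domain.
  move=> y /OmegaW Wy; apply: continuous_sum => i; apply: cvgM.
    exact: (Ck1_continuousD C1b).
  exact: (Ck1_continuous (@C1F i)).
(* The first term comes from the variation of the bump and fades as [rmp] tends to 1. The second
   combines the transversal estimate |F . grad g| <= C |g| with [dramp_bound]. *)
have tbound n y : Omega y -> B y -> `|transport F (chi n) y| <=
    (1 - rmp n y) * b1 + 4 * C * (1 + sqpos (n%:R * (- g y) - 1))^-1.
  move=> Oy By; rewrite tB//; have gy := OB y Oy By.
  have /andP[rm0 rm1] : 0 <= rmp n y <= 1 by exact: ramp_itv.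
  have /andP[by0 by1] : 0 <= b y <= 1 by exact: bump3_itv.
  apply: (le_trans (ler_normB _ _)); rewrite normrN.
  apply: lerD.
    rewrite (normrM (1 - rmp n y)) (@ger0_norm _ (1 - rmp n y)) ?subr_ge0//.
    rewrite ler_wpM2l ?subr_ge0//.
    by apply: tb; exact: subset_closure.
  have E : - n%:R * g y + -1 = n%:R * (- g y) - 1 by rewrite mulrN mulNr.
  rewrite E; set t := n%:R * (- g y) - 1.
  have dr0 := dramp_ge0 t; have := dramp_bound t.
  have -> : 1 + t = n%:R * (- g y) by rewrite /t addrC subrK.
  move=> dr; have qy := Bq y By; rewrite (ltr0_norm gy) in qy.
  have n0 : 0 <= n%:R :> R by [].
  rewrite (normrM (b y)) (ger0_norm by0) (normrM (dramp t * n%:R)).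
  rewrite (ger0_norm (mulr_ge0 dr0 n0)).
  apply: (@le_trans _ _ (1 * (dramp t * n%:R * (C * - g y)))).
    apply: (ler_pM by0 (mulr_ge0 (mulr_ge0 dr0 n0) (normr_ge0 _)) by1).
    exact: (ler_wpM2l (mulr_ge0 dr0 n0) qy).
  rewrite mul1r (_ : _ * _ = C * (n%:R * - g y * dramp t)); last by ring.
  by rewrite [leRHS]mulrAC [leRHS]mulrC; exact: (ler_wpM2l C0 dr).
exists chi, (ball x0 rho); split.
- split=> //.
  + move=> n y Oy; have /andP[? ?] : 0 <= rmp n y <= 1 by exact: ramp_itv.
    have /andP[? ?] : 0 <= b y <= 1 by exact: bump3_itv.
    rewrite /chi; apply/andP; split; nra.
  + move=> y Oy; have [By|nBy] := pselect (B y); last first.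
      rewrite (_ : (fun n => chi n y) = cst 1); first exact: cvg_cst.
      by apply/funext => n; rewrite -(nbhs_singleton (chi1 n y nBy)).
    rewrite -[X in _ --> X](subr0 (1 : R)) -(mulr0 (b y)).
    apply: cvgB; first exact: cvg_cst.
    apply: cvgM; first exact: cvg_cst.
    under eq_fun do rewrite /rmp /ramp subKr mulNr -mulrN.
    by apply: inv_sqpos_cvg0; rewrite oppr_gt0; exact: OB.
  + exists (b1 + 4 * C) => n y Oy; have [By|nBy] := pselect (B y); last first.
      by rewrite tnB// normr0; apply: addr_ge0 => //; apply: mulr_ge0.
    apply: (le_trans (tbound n y Oy By)); apply: lerD.
      have /andP[rm0 rm1] : 0 <= rmp n y <= 1 by exact: ramp_itv.
      by rewrite -[leRHS]mul1r; apply: (ler_wpM2r b10); lra.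
    have s0 := sqpos_ge0 (n%:R * - g y - 1).
    rewrite -[leRHS]mulr1; apply: ler_wpM2l; first exact: mulr_ge0.
    by rewrite invf_le1; lra.
  + move=> y Oy; have [By|nBy] := pselect (B y); last first.
      by under eq_fun do rewrite tnB//; exact: cvg_cst.
    have := inv_sqpos_cvg0 (c := - g y); rewrite oppr_gt0 => /(_ (OB y Oy By)) h.
    have up : (1 - rmp n y) * b1 + 4 * C * (1 + sqpos (n%:R * (- g y) - 1))^-1
        @[n --> \oo] --> (0 : R).
      have -> : (0 : R) = 0 * b1 + 4 * C * 0 by rewrite mul0r mulr0 addr0.
      apply: cvgD; (apply: cvgM; last exact: cvg_cst || exact: h).
        by under eq_fun do rewrite /rmp /ramp subKr mulNr -mulrN.
      exact: cvg_cst.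
    apply/norm_cvg0P; apply: (squeeze_cvgr _ (cvg_cst 0) up).
    by near=> n; rewrite normr_ge0 /=; exact: tbound.
- exact: ball_open.
- exact: ballxx.
- move=> n y by_ /= yx0.
  have By : B y by apply: le_ball yx0; rewrite /rho; lra.
  have gy0 : g y = 0 by have [_ [+ _]] := HU y (BU' y By); exact.
  near=> z.
  have bz : b z = 1.
    by apply: bump3_near; near: z; apply: open_nbhs_nbhs; split=> //; exact: ball_open.
  rewrite /chi bz /rmp ramp_le0 ?subr0 ?mulr1 ?subrr//.
  apply: ltW; near: z.
  have : (fun z => - n%:R * g z + -1) @ y --> - n%:R * g y + -1.
    apply: cvgD; last exact: cvg_cst.
    by apply: cvgM; [exact: cvg_cst|exact: (Ck1_continuous C1gB)].
  by rewrite gy0 mulr0 add0r => /cvgr_lt; apply; lra.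
Unshelve. all: by end_near. Qed.

End local_cutoffs.

Lemma finite_subcover (R : realType) (V : normedModType R) (K : set V)
    (N : V -> set V) : compact K -> (forall x, K x -> open (N x)) ->
  (forall x, K x -> N x x) ->
  exists2 s : seq V, {in s, forall x, K x} &
    forall y, K y -> exists2 x, x \in s & N x y.
Proof.
rewrite compact_cover => /(_ V K N) cK oN Nx.
have [|D' D'K KD'] := cK oN; first by move=> x Kx; exists x => //; exact: Nx.
exists (finmap.enum_fset D') => [x /D'K|y /KD'[x xD' Nxy]]; first by rewrite inE.
by exists x.
Qed.

Section tangential_divergence.
Variables (R : realType) (Omega W : set (space3 R)) (F : 'I_3 -> space3 R -> R).
Hypothesis domain : smooth_bounded_domain Omega.
Hypothesis oW : open W.
Hypothesis OmegaW : closure Omega `<=` W.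
Hypothesis C1F : forall i, Ck 1 W (F i).
Hypothesis tangential : forall x g, boundary Omega x ->
  local_defining_function Omega x g -> transport F g x = 0.

Lemma compact_boundary : compact (boundary Omega).
Proof.
apply: (subclosed_compact _ (compact_closure_domain domain)); last by move=> x [].
by apply: closedI; [exact: closed_closure|exact/open_closedC/open_interior].
Qed.

Lemma global_cutoff : exists chi : nat -> space3 R -> R,
  cutoff Omega F chi /\
  forall n y, boundary Omega y -> \near y, chi n y = 0.
Proof.
(* Only the neighbourhoods are chosen as a function of the point, as compactness requires; the
   cutoffs stay existential. Off the boundary the empty set is a dummy value. *)
pose P (x : space3 R) (Nx : set (space3 R)) := boundary Omega x ->
  exists chi, [/\ cutoff Omega F chi, open Nx, Nx x &
    forall n y, boundary Omega y -> Nx y -> \near y, chi n y = 0].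
have [N HN] : {N : space3 R -> set (space3 R) & forall x, P x (N x)}.
  apply: choice => x; rewrite /P.
  have [bx|nbx] := pselect (boundary Omega x); last by exists set0.
  have [chi [Nx [? ? ? ?]]] := local_cutoff domain oW OmegaW C1F tangential bx.
  by exists Nx => _; exists chi.
have [D' D'b coverD'] := finite_subcover compact_boundary
  (fun x bx => let: ex_intro _ (And4 _ oN _ _) := HN x bx in oN)
  (fun x bx => let: ex_intro _ (And4 _ _ Nx _) := HN x bx in Nx).
(* Restricted to boundary points covered by the list of centres, the claim follows by induction on
   the list, with one factor per centre. *)
suff [chi [cchi chi0]] : exists chi, cutoff Omega F chi /\
    forall n y, boundary Omega y -> (exists2 x, x \in D' & N x y) ->
      \near y, chi n y = 0.
  exists chi; split=> // n y by_; apply: chi0 => //.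
  exact: coverD'.
elim: D' D'b {coverD'} => [_|x s IH bs].
  by exists (fun _ _ => 1); split; [exact: cutoff1|move=> n y _ []].
have [chi1 [c1 z1]] : exists chi, cutoff Omega F chi /\
    forall n y, boundary Omega y -> (exists2 x, x \in s & N x y) ->
      \near y, chi n y = 0.
  by apply: IH => z zs; apply: bs; rewrite in_cons zs orbT.
have [chi2 [c2 _ _ z2]] := HN x (bs x (mem_head _ _)).
exists (fun n x => chi1 n x * chi2 n x); split; first exact: cutoffM.
move=> n y by_ [z]; rewrite in_cons => /predU1P[->|zs] Ny.
- by have := z2 n y by_ Ny; apply: filterS => w ->; rewrite mulr0.
- have := z1 n y by_ (ex_intro2 _ _ z zs Ny).
  by apply: filterS => w ->; rewrite mul0r.
Qed.

Lemma measurable_domain : measurable (Omega : set (mspace3 R)).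
Proof. exact: (base_open_measurable (countable_base3 R) (open_domain domain)). Qed.

Lemma leb3_domain_lty : (leb3 Omega < +oo)%E.
Proof.
have [_ _ _ bO _] := domain; have [a Oa] := bounded_set_box3 bO.
apply: le_lt_trans (leb3_box_lty a); apply: le_measure; rewrite ?inE//.
- exact: measurable_domain.
- exact: measurable_box3.
Qed.

Lemma domain_integrable (f : space3 R -> R) :
  (forall x, closure Omega x -> {for x, continuous f}) ->
  leb3.-integrable Omega (EFin \o f).
Proof.
move=> cf; have [b _ fb] := compact_bounded_fun (compact_closure_domain domain) cf.
apply: (@bounded_integrable _ _ _ _ _ _ b); first exact: measurable_domain.
- exact: leb3_domain_lty.
- apply: (base_continuous_measurable (countable_base3 R) (open_domain domain)).
  by move=> x Ox; apply: cf; exact: subset_closure.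
- by move=> x Ox; apply: fb; exact: subset_closure.
Qed.

Lemma divergence_theorem :
  \int[leb3]_(x in Omega) (\sum_i 'D_(std_basis R i) (F i) x) = 0.
Proof.
have [chi [[C1chi ichi cchi [b hb] tchi] chi0]] := global_cutoff.
(* [F] is only controlled near closure(Omega), so chi F is extended by zero. Around a point off
   Omega the extension vanishes: on the boundary because chi does, elsewhere because a neighbourhood
   misses Omega. *)
pose G n i x : R := if x \in Omega then chi n x * F i x else 0.
have OW : Omega `<=` W by move=> x Ox; apply: OmegaW; exact: subset_closure.
have oO := open_domain domain.
have G0 n i x : ~ Omega x -> \near x, 0 = G n i x.
  move=> nOx; have [cx|ncx] := pselect (closure Omega x).
    have /(chi0 n) : boundary Omega x by split => // /interior_subset.
    by apply: filterS => y cy0; rewrite /G; case: ifP => // _; rewrite cy0 mul0r.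
  near=> y; rewrite /G; case: ifPn => //; rewrite inE => Oy.
  have : (~` closure Omega) y.
    near: y; apply: open_nbhs_nbhs; split=> //.
    by apply: closed_openC; exact: closed_closure.
  by move=> /(_ (subset_closure Oy)).
have C1O n i : Ck 1 Omega (fun x => chi n x * F i x).
  exact: (Ck1M oO (Ck_subset (@subsetT _ Omega) (C1chi n)) (Ck_subset OW (C1F i))).
have GO n i x : Omega x -> \near x, chi n x * F i x = G n i x.
  by move=> Ox; near=> y; rewrite /G ifT// inE; near: y; exact: open_nbhs_nbhs.
have C1G n i : Ck 1 setT (G n i).
  apply: Ck_near => x _; have [Ox|nOx] := pselect (Omega x).
    exists Omega; first exact: open_nbhs_nbhs.
    by apply: near_eq_Ck1 oO _ (C1O n i) => y /GO/nbhs_singleton; exact.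
  exists [set y | 0 = G n i y]°; first by apply: nbhs_interior; exact: G0.
  apply: (near_eq_Ck1 (open_interior _) _ (Ck1_cst 0 (open_interior _))).
  by move=> z /interior_subset.
have [a Oa] : exists a, Omega `<=` box3 a.
  by apply: bounded_set_box3; case: domain.
have intG n i : \int[leb3]_(x in Omega) ('D_(std_basis R i) (G n i) x) = 0.
  rewrite /Rintegral integral_mkcond -[RHS]/(fine (0%:E)).
  congr fine; rewrite -[RHS](@integral_derive_compact_support R (G n i) a i (C1G n i)).
    apply: eq_integral => x _; rewrite patchE; case: ifPn => //.
    rewrite notin_setE => nOx.
    by rewrite -(near_eq_derive _ (G0 n i x nOx)) derive_cst.
  by move=> x nx; rewrite /G ifF//; apply/negP; rewrite inE => /Oa.
pose f n x : R := \sum_i 'D_(std_basis R i) (G n i) x.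
pose dF x : R := \sum_i 'D_(std_basis R i) (F i) x.
have int_f n : \int[leb3]_(x in Omega) f n x = 0.
  have iG i : leb3.-integrable Omega (EFin \o 'D_(std_basis R i) (G n i)).
    by apply: domain_integrable => x _; exact: (Ck1_continuousD (C1G n i)).
  rewrite /f (Rintegral_sum measurable_domain iG).2 big1//.
have fE n x : Omega x -> f n x = chi n x * dF x + transport F (chi n) x.
  move=> Ox; rewrite /f /dF /transport mulr_sumr -big_split/=.
  apply: eq_bigr => i _; rewrite -(near_eq_derive _ (GO n i x Ox)).
  rewrite (derive_C1M _ (Ck_subset (@subsetT _ Omega) (C1chi n)) (Ck_subset OW (C1F i)) Ox).
  by rewrite [X in _ + X]mulrC.
have cdF x : W x -> {for x, continuous dF}.
  by move=> Wx; apply: continuous_sum => i; exact: (Ck1_continuousD (C1F i)).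
have [m m0 hm] := compact_bounded_fun (compact_closure_domain domain)
  (fun x cx => cdF x (OmegaW cx)).
have cvgf : \int[leb3]_(x in Omega) f n x @[n --> \oo] --> \int[leb3]_(x in Omega) dF x.
  apply: (@Rintegral_bounded_cvg _ _ _ _ _ _ _ (m + b)).
  - exact: measurable_domain.
  - exact: leb3_domain_lty.
  - move=> n; apply: (base_continuous_measurable (f := f n) (countable_base3 R) oO) => x _.
    by apply: continuous_sum => i; exact: (Ck1_continuousD (C1G n i)).
  - move=> n x Ox; rewrite fE//; apply: (le_trans (ler_normD _ _)).
    apply: lerD; last exact: hb.
    rewrite normrM -[leRHS]mul1r; apply: ler_pM => //.
      by have /andP[? ?] := ichi n x Ox; rewrite ger0_norm.
    by apply: hm; exact: subset_closure.
  - move=> x Ox; under eq_fun do rewrite fE//.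
    suff : chi n x * dF x + transport F (chi n) x @[n --> \oo] --> 1 * dF x + 0.
      by rewrite mul1r addr0.
    apply: cvgD; last exact: tchi.
    by apply: cvgM; [exact: cchi|exact: cvg_cst].
have cvg0 : \int[leb3]_(x in Omega) f n x @[n --> \oo] --> (0 : R).
  by under eq_fun do rewrite int_f; exact: cvg_cst.
exact: (cvg_unique _ cvgf cvg0).
Unshelve. all: by end_near. Qed.

End tangential_divergence.

(** * Truncations of the temperature and of the entropy *)

Section truncations.
Variables (R : realType) (C : R).

(** With x = max(y - C, 0) one has min(y, C) = y - x, so this is min(y, C) + x / (1 + n x). The
    bracket x / (1 + n x) - x has slope 0 at x = 0, which is what [C1fun_max0] asks for. *)
Definition softmin (n : nat) (y : R) : R :=
  let x := Num.max (y - C) 0 in y + (x / (1 + n%:R * x) - x).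
Definition dsoftmin (n : nat) (y : R) : R := (1 + n%:R * Num.max (y - C) 0) ^- 2.

Lemma softmin_C1 n : C1fun setT (softmin n) (dsoftmin n).
Proof.
pose O : set R := [set x | 0 <= x].
have pos (x : R) : 0 <= x -> 1 + n%:R * x != 0.
  by move=> x0; rewrite gt_eqF// ltr_wpDr// mulr_ge0.
have Hid := @C1fun_affine R O 1 0.
have Hden := C1fun_comp (@C1fun_affine R O n%:R 1)
  (@C1fun_inv R [set x | x != 0] (fun _ => id)).
have {}Hden := Hden (fun x Ox => ltac:(by rewrite /= addrC; exact: pos)).
have HG := C1funD (C1funM Hid Hden) (@C1fun_affine R O (-1) 0).
have := C1fun_comp (@C1fun_affine R setT 1 (- C))
  (C1fun_max0 HG _) (fun _ _ => I).
rewrite !mulr0 !add0r invr1 !mul1r mul0r add0r subrr => /(_ erefl) H.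
have {H} H := C1funD (@C1fun_affine R setT 1 0) H.
move=> y _; have [d c] := H y I.
have -> : softmin n = (fun y => 1 * y + 0 + ((1 * Num.max (1 * y - C) 0 + 0) *
    (n%:R * Num.max (1 * y - C) 0 + 1)^-1 + (-1 * Num.max (1 * y - C) 0 + 0))).
  by apply/funext => z; rewrite /softmin !mul1r !addr0 mulN1r (addrC 1).
have E (z : R) : dsoftmin n z = 1 + ((1 * Num.max (1 * z - C) 0 + 0) *
    (- (n%:R * Num.max (1 * z - C) 0 + 1) ^- 2 * n%:R) +
    (n%:R * Num.max (1 * z - C) 0 + 1)^-1 * 1 + -1) * 1.
  rewrite /dsoftmin !mul1r !addr0; set x := Num.max _ _.
  have x0 : 0 <= x by rewrite /x le_max lexx orbT.
  by have := pos x x0; rewrite (addrC 1) => h; field.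
have {}E := funext E; rewrite E; split; [exact: d|exact: c].
Qed.

Lemma softmin_le n y : y <= C -> softmin n y = y /\ dsoftmin n y = 1.
Proof.
move=> yC; rewrite /softmin /dsoftmin max_r ?subr_le0//.
by rewrite mulr0 addr0 mul0r subrr addr0 expr1n invr1.
Qed.

(** These bounds do not depend on n: they keep the regularised temperature positive and in a compact
    range. *)
Lemma softmin_itv n y : Num.min y C <= softmin n y <= y.
Proof.
rewrite /softmin; set x := Num.max _ _.
have x0 : 0 <= x by rewrite /x le_max lexx orbT.
have n0 : 0 <= n%:R * x by rewrite mulr_ge0.
have d0 : 0 < 1 + n%:R * x by rewrite ltr_wpDr.
have q0 : 0 <= x / (1 + n%:R * x) by rewrite divr_ge0// ltW.
have q1 : x / (1 + n%:R * x) <= x.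
  by rewrite ler_pdivrMr// mulrDr mulr1 lerDl mulr_ge0.
have -> : Num.min y C = y - x.
  rewrite /x; case: (leP (y - C) 0) => h; [rewrite min_l|rewrite min_r]; lra.
by apply/andP; split; lra.
Qed.

Lemma dsoftmin_itv n y : 0 <= dsoftmin n y <= 1.
Proof.
rewrite /dsoftmin; set x := Num.max _ _.
have x0 : 0 <= x by rewrite /x le_max lexx orbT.
have d0 : 1 <= 1 + n%:R * x by rewrite lerDl mulr_ge0.
have p0 : 0 < 1 + n%:R * x by exact: lt_le_trans d0.
rewrite invr_ge0 sqr_ge0 /= invf_le1 ?exprn_gt0//.
by rewrite expr_ge1// ltW.
Qed.

Lemma inv_natM_cvg0 (x : R) : 0 < x -> (1 + n%:R * x)^-1 @[n --> \oo] --> 0.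
Proof.
move=> x0; apply/cvgr0Pnorm_lt => eps eps0; near=> n.
have nx : eps^-1 < n%:R * x.
  by rewrite -ltr_pdivrMr//; near: n; exact: nbhs_infty_gtr.
have e0 : 0 < eps^-1 by rewrite invr_gt0.
have p0 : 0 < 1 + n%:R * x by lra.
by rewrite gtr0_norm ?invr_gt0// invf_plt ?posrE//; lra.
Unshelve. all: by end_near. Qed.

Lemma softmin_cvg y : softmin n y @[n --> \oo] --> Num.min y C.
Proof.
have [yC|Cy] := leP y C.
  by under eq_fun do rewrite (softmin_le _ yC).1; exact: cvg_cst.
rewrite /softmin max_l; last lra.
have H : y + ((y - C) / (1 + n%:R * (y - C)) - (y - C)) @[n --> \oo] -->
    y + ((y - C) * 0 - (y - C)).
  apply: cvgD; first exact: cvg_cst.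
  apply: cvgB; last exact: cvg_cst.
  apply: cvgM; first exact: cvg_cst.
  by apply: inv_natM_cvg0; lra.
by move: H; rewrite mulr0 sub0r subKr.
Qed.

Lemma dsoftmin_cvg y : C < y -> dsoftmin n y @[n --> \oo] --> 0.
Proof.
move=> Cy; rewrite /dsoftmin max_l; last lra.
have H : (1 + n%:R * (y - C))^-1 * (1 + n%:R * (y - C))^-1 @[n --> \oo] --> (0 * 0 : R).
  by apply: cvgM; apply: inv_natM_cvg0; lra.
by move: H; rewrite mulr0; under eq_fun do rewrite -expr2 exprVn.
Qed.

(** Squaring the positive part makes this C^1 across C, so it can multiply the heat flux under a
    divergence, unlike [dsoftmin]. *)
Definition softstep (n : nat) (y : R) : R := (1 + n%:R * sqpos (y - C))^-1.

Lemma softstep_C1 n : exists2 dpsi, C1fun setT (softstep n) dpsi &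
  forall y, dpsi y <= 0.
Proof.
have pos (x : R) : 1 + n%:R * sqpos x != 0.
  by rewrite gt_eqF// ltr_wpDr// mulr_ge0// sqpos_ge0.
have H1 := C1fun_comp (@C1fun_affine R setT 1 (- C)) (@sqpos_C1 R) (fun _ _ => I).
have H2 := C1fun_comp H1 (@C1fun_affine R setT n%:R 1) (fun _ _ => I).
have H3 := C1fun_comp H2 (@C1fun_inv R [set x | x != 0] (fun _ => id)).
have {}H3 := H3 (fun x _ => ltac:(by rewrite /= addrC; exact: pos)).
eexists; first by move: H3; rewrite (_ : (fun y => _) = softstep n); [exact|];
  apply/funext => y; rewrite /softstep mul1r addrC.
move=> y /=; rewrite mulNr oppr_le0 mulr_ge0 ?invr_ge0 ?sqr_ge0//.
by rewrite mulr_ge0// mulr1 mulr_ge0// le_max lexx orbT.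
Qed.

Lemma softstep_le n y : y <= C -> softstep n y = 1.
Proof.
by move=> yC; rewrite /softstep sqpos_le0 ?subr_le0// mulr0 addr0 invr1.
Qed.

Lemma softstep_itv n y : 0 <= softstep n y <= 1.
Proof.
have d0 : 1 <= 1 + n%:R * sqpos (y - C) by rewrite lerDl mulr_ge0 ?sqpos_ge0.
have p0 : 0 < 1 + n%:R * sqpos (y - C) by exact: lt_le_trans d0.
by rewrite /softstep invr_ge0 ltW//= invf_le1.
Qed.

Lemma softstep_cvg y : C < y -> softstep n y @[n --> \oo] --> 0.
Proof.
move=> Cy; apply: inv_natM_cvg0.
by rewrite /sqpos max_l; [rewrite exprn_gt0//; lra|lra].
Qed.

End truncations.

(** * The chain rule for the entropy *)

Section entropy.
Variable R : realType.
Implicit Types (s a b : R -> R -> R).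

(** Joint continuity on the open quadrant along arbitrary filters, so that it serves both at points
    of space-time and for sequences in n. *)
Definition continuous_quadrant (f : R -> R -> R) := forall (T : Type)
    (F : set_system T) (FF : Filter F) (r m : T -> R) (r0 m0 : R),
  0 < r0 -> 0 < m0 -> r x @[x --> F] --> r0 -> m x @[x --> F] --> m0 ->
  f (r x) (m x) @[x --> F] --> f r0 m0.

(* [a] and [b] are the partial derivatives of [s]. *)
Record entropy_chain s a b : Prop := EntropyChain {
  chain_s : continuous_quadrant s;
  chain_a : continuous_quadrant a;
  chain_b : continuous_quadrant b;
  chain_C1 : forall (V : normedModType R) (W : set V) (r m : V -> R), open W ->
    Ck 1 W r -> Ck 1 W m -> (forall x, W x -> 0 < r x) ->
    (forall x, W x -> 0 < m x) ->
    Ck 1 W (fun x => s (r x) (m x)) /\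
    forall x v, W x -> 'D_v (fun x => s (r x) (m x)) x =
      a (r x) (m x) * 'D_v r x + b (r x) (m x) * 'D_v m x
}.

Lemma powR_C1 (c : R) : C1fun [set x | 0 < x] (fun x => x `^ c)
  (fun x => c * x `^ (c - 1)).
Proof.
have D (e y : R) : 0 < y -> is_derive y 1 (fun x => x `^ e) (e * y `^ (e - 1)).
  move=> y0; have y0' : y \in `]0, +oo[ by rewrite in_itv/= y0.
  split; first exact: derivable_powR.
  by rewrite -derive1E powR_derive1.
move=> y y0; split; first exact: D.
apply: cvgM; first exact: cvg_cst.
exact: is_derive_continuous (D _ _ y0).
Qed.

(** [f] agrees with its C^1 extension only on the closed half-line, so two-sided derivatives are
    compared in its interior. *)
Lemma C1_halfline_C1fun (f : R -> R) : C1_halfline f ->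
  C1fun [set x | 0 < x] f (derive1 f).
Proof.
move=> [U [g [oU HU Cg fg]]] y y0.
have Uy : U y by apply: HU; exact: ltW.
have nfg (z : R) : 0 < z -> \near z, g z = f z.
  move=> z0; near=> w; rewrite fg//; apply: ltW.
  by near: w; exact: lt_nbhsr.
split.
  apply: near_eq_is_derive (nfg y y0) _.
  rewrite derive1E -(near_eq_derive _ (nfg y y0)).
  exact: (Ck1_is_derive _ Cg Uy).
apply: (@near_eq_continuous R R (fun z => 'D_1 g z) (derive1 f)); last first.
  exact: (Ck1_continuousD Cg Uy).
near=> z; rewrite derive1E; apply: near_eq_derive; apply: nfg.
by near: z; exact: lt_nbhsr.
Unshelve. all: by end_near. Qed.

(** The form s(rho, theta) = S(rho theta^(-3/2)) turns the two-variable chain rule into products and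
    one-variable compositions. Continuity of S' comes from its formula in P and P'. *)
Lemma entropy_chain_exists p e s mu eta kappa P S :
  constitutive_laws p e s mu eta kappa P S -> exists a b, entropy_chain s a b.
Proof.
move=> laws; have [gas _ _ dS _] := law_gas laws.
have CP := C1_halfline_C1fun (law_P_C1 laws).
have CS : C1fun [set x | 0 < x] S (derive1 S).
  move=> Z Z0; have [dSZ _] := dS Z Z0.
  split; first by rewrite derive1E; exact: derivableP.
  have [dP cP] := CP Z Z0.
  pose f z : R := - (3 / 2) * ((5 / 3 * P z - z * derive1 P z) / z ^+ 2).
  apply: (@near_eq_continuous _ _ f).
    near=> z; have [] // := dS z; near: z; exact: lt_nbhsr.
  apply: cvgM; first exact: cvg_cst.
  apply: cvgM.
    apply: cvgB; apply: cvgM; [exact: cvg_cst|exact: is_derive_continuous dP|exact: cvg_id|exact: cP].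
  apply: cvgV; first by rewrite expf_neq0// gt_eqF.
  exact: exprn_continuous.
have pow0 (y : R) : 0 < y -> y `^ (3 / 2) != 0 by move=> y0; rewrite gt_eqF// powR_gt0.
have Cw := C1fun_comp (@powR_C1 (3 / 2)) (@C1fun_inv R [set x | x != 0] (fun _ => id)) pow0.
set w := (fun y : R => (y `^ (3 / 2))^-1) in Cw.
set dw := (X in C1fun _ _ X) in Cw.
have w0 (y : R) : 0 < y -> 0 < w y by move=> y0; rewrite /w invr_gt0 powR_gt0.
have cvg_C1 (f df : R -> R) (T : Type) (F : set_system T) (FF : Filter F) (m : T -> R) (m0 : R) :
    C1fun [set x | 0 < x] f df -> 0 < m0 -> m x @[x --> F] --> m0 ->
    f (m x) @[x --> F] --> f m0 /\ df (m x) @[x --> F] --> df m0.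
  move=> Cf m00 mm; have [d c] := Cf m0 m00.
  by split; [apply: cvg_comp mm _; exact: is_derive_continuous d|exact: cvg_comp mm c].
exists (fun r m => derive1 S (r * w m) * w m), (fun r m => derive1 S (r * w m) * (r * dw m)).
split.
- move=> T F FF r m r0 m0 r00 m00 rr mm.
  have sS (x y : R) : 0 < x -> 0 < y -> S (x * w y) = s x y.
    by move=> x0 y0; have [_ _ ->] := gas x y x0 y0.
  rewrite -sS//.
  have [wm _] := cvg_C1 _ _ _ _ _ _ _ Cw m00 mm.
  have [H _] := cvg_C1 _ _ _ _ _ _ _ CS (mulr_gt0 r00 (w0 _ m00)) (cvgM rr wm).
  apply: cvg_trans H; apply: near_eq_cvg.
  near=> x; apply: sS; near: x; [exact: cvgr_gt rr _ r00|exact: cvgr_gt mm _ m00].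
- move=> T F FF r m r0 m0 r00 m00 rr mm.
  have [wm _] := cvg_C1 _ _ _ _ _ _ _ Cw m00 mm.
  have [_ H] := cvg_C1 _ _ _ _ _ _ _ CS (mulr_gt0 r00 (w0 _ m00)) (cvgM rr wm).
  exact: cvgM H wm.
- move=> T F FF r m r0 m0 r00 m00 rr mm.
  have [wm dwm] := cvg_C1 _ _ _ _ _ _ _ Cw m00 mm.
  have [_ H] := cvg_C1 _ _ _ _ _ _ _ CS (mulr_gt0 r00 (w0 _ m00)) (cvgM rr wm).
  exact: cvgM H (cvgM rr dwm).
- move=> V W r m oW Cr Cm r0 m0.
  have sS x : W x -> S (r x * w (m x)) = s (r x) (m x).
    by move=> Wx; have [_ _ ->] := gas _ _ (r0 x Wx) (m0 x Wx).
  have Cwm := Ck1_comp oW Cw m0 Cm.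
  have Crw := Ck1M oW Cr Cwm.
  have rw0 x : W x -> [set x : R | 0 < x] (r x * w (m x)).
    by move=> Wx; exact: mulr_gt0 (r0 x Wx) (w0 _ (m0 x Wx)).
  have CSrw := Ck1_comp oW CS rw0 Crw.
  split; first exact: near_eq_Ck1 oW sS CSrw.
  move=> x v Wx.
  have nS : \near x, S (r x * w (m x)) = s (r x) (m x).
    by near=> y; apply: sS; near: y; exact: open_nbhs_nbhs.
  rewrite -(near_eq_derive _ nS) (derive_C1comp v CS (rw0 x Wx) Crw Wx).
  rewrite (derive_C1M v Cr Cwm Wx) (derive_C1comp v Cw (m0 x Wx) Cm Wx).
  by ring.
Unshelve. all: by end_near. Qed.

Lemma entropy_chain_D_rho s a b (r C : R) : entropy_chain s a b -> 0 < r ->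
  0 < C -> D_rho s r C = a r C.
Proof.
move=> [_ _ _ Cs] r0 C0; rewrite /D_rho derive1E.
have oW : open [set x : R | 0 < x] by exact: open_gt.
have Cid : Ck 1 [set x : R | 0 < x] (fun x : R => x).
  have := Ck1_C1fun oW (@C1fun_affine R [set x | 0 < x] 1 0).
  by apply: near_eq_Ck1 => // x _; rewrite mul1r addr0.
have [_ /(_ r 1 r0)] := Cs R _ (fun x => x) (fun=> C) oW Cid (Ck1_cst C oW)
  (fun _ => id) (fun _ _ => C0).
by move=> ->; rewrite derive_id derive_cst mulr0 addr0 mulr1.
Qed.

End entropy.

(** * Integration over space-time cylinders *)

Lemma open_slice (T1 T2 : topologicalType) (W : set (T1 * T2)) (c : T1) :
  open W -> open [set x | W (c, x)].
Proof.
move=> oW; rewrite openE => x Wx; have := open_nbhs_nbhs (conj oW Wx).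
apply: (@continuous_slicer T1 T2 _ id c x); exact: cvg_id.
Qed.

Lemma Ck1_slice (R : realType) (V1 V2 : normedModType R) (W : set (V1 * V2))
    (f : V1 * V2 -> R) (c : V1) : open W -> Ck 1 W f ->
  Ck 1 [set x | W (c, x)] (fun x => f (c, x)) /\
  forall x v, W (c, x) -> 'D_v (fun x => f (c, x)) x = 'D_(0, v) f (c, x).
Proof.
move=> oW Cf.
have D x v : W (c, x) -> is_derive x v (fun x => f (c, x)) ('D_(0, v) f (c, x)).
  by move=> Wx; apply/is_derive_sndP; exact: (Ck1_is_derive _ Cf).
split; last by move=> x v /(D x v)[].
apply: (@Ck1_intro R V2 _ _ (fun v x : V2 => 'D_(0, v) f (c, x))) => //.
- exact: (open_slice c oW).
- by move=> x Wx; apply: (@continuous_slicer V1 V2 R f c x); exact: (Ck1_continuous Cf).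
- move=> x v Wx; apply: (@continuous_slicer V1 V2 R ('D_(0, v) f) c x).
  exact: (Ck1_continuousD Cf).
Qed.

Lemma eq_integral_EFin d (M : measurableType d) (R : realType)
    (mu : {measure set M -> \bar R}) (D : set M) (f g : M -> R) :
  (forall x, D x -> f x = g x) ->
  (\int[mu]_(x in D) (f x)%:E = \int[mu]_(x in D) (g x)%:E)%E.
Proof. by move=> fg; apply: eq_integral => x /set_mem /fg ->. Qed.

Section cylinder.
Variables (R : realType) (Omega : set (space3 R)) (t0 t1 : R).
Hypothesis domain : smooth_bounded_domain Omega.
Hypothesis t01 : t0 < t1.

Definition ex (i : 'I_3) : R * space3 R := (0, std_basis R i).
Definition et : R * space3 R := (1, 0).

Definition cylinder : set (R * space3 R) := `]t0, t1[ `*` Omega.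

Definition closed_cylinder : set (R * space3 R) := `[t0, t1] `*` closure Omega.

Lemma compact_cylinder : compact closed_cylinder.
Proof.
by apply: compact_setX; [exact: segment_compact|exact: compact_closure_domain].
Qed.

Lemma cylinder_closed : cylinder `<=` closed_cylinder.
Proof.
by move=> [r x] [/= /subset_itv_oo_cc ? Ox]; split=> //=; exact: subset_closure.
Qed.

Lemma open_cylinder : open cylinder.
Proof.
rewrite openE => -[r x] [/= rt Ox].
exists (`]t0, t1[%classic, Omega); last by move=> z.
split; apply: open_nbhs_nbhs; split=> //; exact: open_domain.
Qed.

Lemma measurable_cylinder : measurable (cylinder : set (mtime_space R)).
Proof. exact: (base_open_measurable (countable_base_time_space R) open_cylinder). Qed.

Lemma cylinder_lty : (leb_time_space cylinder < +oo)%E.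
Proof.
by apply: leb_time_space_lty; [exact: measurable_domain|exact: leb3_domain_lty].
Qed.

Lemma cylinder_measurable_fun (f : R * space3 R -> R) :
  (forall z, closed_cylinder z -> {for z, continuous f}) ->
  measurable_fun (cylinder : set (mtime_space R)) f.
Proof.
move=> cf.
apply: (base_continuous_measurable (f := f) (countable_base_time_space R) open_cylinder).
by move=> z /cylinder_closed; exact: cf.
Qed.

Lemma cylinder_integrable (B : set (mtime_space R)) (f : R * space3 R -> R) :
  measurable B -> B `<=` cylinder ->
  (forall z, closed_cylinder z -> {for z, continuous f}) ->
  leb_time_space.-integrable B (EFin \o f).
Proof.
move=> mB BQ cf; have [b _ fb] := compact_bounded_fun compact_cylinder cf.
apply: (integrableS measurable_cylinder mB BQ).
apply: (@bounded_integrable _ _ _ _ _ _ b); first exact: measurable_cylinder.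
- exact: cylinder_lty.
- exact: cylinder_measurable_fun.
- by move=> z /cylinder_closed; exact: fb.
Qed.

(** [h] is only prescribed on the open interval: the end points are negligible and carry no slice of
    [B]. The measurability of [h] needed to drop them comes from Fubini. *)
Lemma integral_time_slices (B : set (mtime_space R)) (f : R * space3 R -> R)
    (h : R -> \bar R) : measurable B -> B `<=` cylinder ->
  leb_time_space.-integrable B (EFin \o f) ->
  (forall r, `]t0, t1[%classic r ->
    h r = \int[leb3]_(x in [set x | B (r, x)]) (f (r, x))%:E)%E ->
  (\int[lebesgue_measure]_(r in `[t0, t1]) h r =
   \int[leb_time_space]_(z in B) (f z)%:E)%E.
Proof.
move=> mB BQ intf hE; pose g := (EFin \o f) \_ B.
have intg : leb_time_space.-integrable setT g by exact/(integrable_mkcond _ mB).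
have E : fubini_F leb3 g = h \_ `]t0, t1[.
  apply/funext => r; rewrite patchE /fubini_F; case: ifPn => [|].
    rewrite inE => rt; rewrite hE// [RHS]integral_mkcond; apply: eq_integral => x _.
    rewrite /g !patchE; have [Bx|nBx] := pselect (B (r, x)).
      by rewrite !mem_set.
    by rewrite !memNset.
  rewrite notin_setE => nrt; apply: integral0_eq => x _.
  by rewrite /g patchE memNset// => /BQ[/nrt].
have mh : measurable_fun `]t0, t1[ h.
  have := measurable_fubini_F intg; rewrite E.
  by move/(measurable_restrictT _ (measurable_itv _)).
rewrite integral_itv_bndoo// integral_mkcond -E (integral12_prod_meas1 intg).
by rewrite /g -integral_mkcond.
Qed.

Lemma integral_div_cylinder (W : set (R * space3 R))
    (F : 'I_3 -> R * space3 R -> R) :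
  open W -> closed_cylinder `<=` W -> (forall i, Ck 1 W (F i)) ->
  (forall r x g, t0 < r < t1 -> boundary Omega x ->
    local_defining_function Omega x g ->
    \sum_i 'D_(std_basis R i) g x * F i (r, x) = 0) ->
  \int[leb_time_space]_(z in cylinder) (\sum_i 'D_(ex i) (F i) z) = 0.
Proof.
move=> oW KW CF tang; rewrite /Rintegral -[RHS]/(fine (0%:E)); congr fine.
rewrite -(@integral_time_slices _ _ (cst 0%E)) ?integral0//.
- exact: measurable_cylinder.
- apply: cylinder_integrable => //; first exact: measurable_cylinder.
  move=> z /KW Wz; apply: continuous_sum => i; exact: (Ck1_continuousD (CF i)).
- move=> r rt; rewrite (_ : [set x | _] = Omega); last first.
    by rewrite predeqE => x; split=> [[]|].
  have OW : closure Omega `<=` [set x | W (r, x)].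
    by move=> x cx; apply: KW; split=> //=; exact: subset_itv_oo_cc.
  have CFr i := (Ck1_slice r oW (CF i)).1.
  have oWr := open_slice r oW.
  have OWi : Omega `<=` [set x | W (r, x)].
    by move=> x Ox; apply: OW; exact: subset_closure.
  pose div1 x := \sum_i 'D_(ex i) (F i) (r, x).
  pose div2 x := \sum_i 'D_(std_basis R i) (fun x => F i (r, x)) x.
  have E x : Omega x -> div1 x = div2 x.
    move=> /OWi Wx; apply: eq_bigr => i _.
    by rewrite (Ck1_slice r oW (CF i)).2.
  rewrite [RHS](eq_integral_EFin leb3 E) /div2.
  rewrite EFin_Rintegral; first last.
  + apply: domain_integrable => // x /OW Wx; apply: continuous_sum => i.
    exact: (Ck1_continuousD (CFr i)).
  + exact: measurable_domain.
  rewrite (@divergence_theorem _ _ _ (fun i x => F i (r, x)) domain oWr OW)//.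
  by move=> x g bx lg; apply: tang.
Qed.

(** Fubini with time innermost. [W] contains the closed cylinder, so the fundamental theorem of
    calculus holds up to both end points, even for t0 = 0. *)
Lemma integral_dt_cylinder (W : set (R * space3 R)) (f : R * space3 R -> R) :
  open W -> closed_cylinder `<=` W -> Ck 1 W f ->
  \int[leb_time_space]_(z in cylinder) ('D_et f z) =
  \int[leb3]_(x in Omega) f (t1, x) - \int[leb3]_(x in Omega) f (t0, x).
Proof.
move=> oW KW Cf.
have t0i : `[t0, t1]%classic t0 by rewrite /= in_itv/= lexx ltW.
have t1i : `[t0, t1]%classic t1 by rewrite /= in_itv/= lexx ltW.
have intf r : `[t0, t1]%classic r -> leb3.-integrable Omega (EFin \o (fun x => f (r, x))).
  move=> rt; apply: domain_integrable => // x cx.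
  by apply: (@continuous_slicer R (space3 R) R f r x); apply: (Ck1_continuous Cf); exact: KW.
rewrite -RintegralB; [|exact: measurable_domain|exact: intf|exact: intf].
rewrite /Rintegral; congr fine.
pose g : mtime_space R -> \bar R := (EFin \o 'D_et f) \_ cylinder.
have mQ := measurable_cylinder.
have intg : leb_time_space.-integrable setT g.
  apply/(integrable_mkcond _ mQ); apply: cylinder_integrable => //.
  by move=> z /KW Wz; exact: (Ck1_continuousD Cf).
rewrite integral_mkcond -/g -(integral21_prod_meas1 intg) [RHS]integral_mkcond.
apply: eq_integral => x _; rewrite patchE /fubini_G; case: ifPn; last first.
  rewrite notin_setE => nOx; apply: integral0_eq => r _.
  by rewrite /g patchE memNset// => -[_ /nOx].
rewrite inE => Ox.
have Wr r : `[t0, t1]%classic r -> W (r, x).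
  by move=> rt; apply: KW; split=> //; exact: subset_closure.
have D r : `[t0, t1]%classic r ->
    is_derive r 1 (fun r => f (r, x)) ('D_et f (r, x)).
  by move=> /Wr Wrx; apply/(is_derive_fstP (V2 := space3 R)); exact: (Ck1_is_derive _ Cf).
have cD (r : R) : `[t0, t1]%classic r -> {for r, continuous (fun r => 'D_et f (r, x))}.
  move=> /Wr Wrx; apply: (@continuous_slicel R (space3 R) R ('D_et f) x r).
  exact: (Ck1_continuousD Cf).
transitivity (\int[lebesgue_measure]_(r in `]t0, t1[) ('D_et f (r, x))%:E)%E.
  rewrite [RHS]integral_mkcond; apply: eq_integral => r _.
  rewrite /g !patchE; have [rt|nrt] := pselect (`]t0, t1[%classic r).
    by rewrite !mem_set.
  by rewrite !memNset// => -[].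
have mD : measurable_fun `]t0, t1[ (fun r => ('D_et f (r, x))%:E).
  apply/measurable_EFinP; apply: open_continuous_measurable_fun; first exact: itv_open.
  by move=> r; rewrite inE => /subset_itv_oo_cc; exact: cD.
rewrite -(@integral_itv_bndoo _ _ _ _ true false mD).
rewrite (@continuous_FTC2 _ (fun r => 'D_et f (r, x)) (fun r => f (r, x)))//.
- by apply: continuous_in_subspaceT => r; rewrite inE; exact: cD.
- split.
  + by move=> r /subset_itv_oo_cc /D[].
  + by apply: cvg_at_right_filter; exact: is_derive_continuous (D _ t0i).
  + by apply: cvg_at_left_filter; exact: is_derive_continuous (D _ t1i).
- by move=> r rt; rewrite derive1E; have [] := D r (subset_itv_oo_cc rt).
Qed.

End cylinder.

(** * The truncated entropy balance *)

Section entropy_balance.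
Variables (R : realType) (Omega : set (space3 R)) (t0 t1 : R).
Hypothesis domain : smooth_bounded_domain Omega.
Hypothesis t01 : t0 < t1.
Variables (W : set (R * space3 R)) (rho th : R * space3 R -> R)
  (w : 'I_3 -> R * space3 R -> R).
Hypothesis oW : open W.
Hypothesis KW : closed_cylinder Omega t0 t1 `<=` W.
Hypothesis Crho : Ck 1 W rho.
Hypothesis Cth : Ck 1 W th.
Hypothesis Cdth : forall i, Ck 1 W ('D_(ex R i) th).
Hypothesis Cw : forall i, Ck 1 W (w i).
Hypothesis rho0 : forall z, W z -> 0 < rho z.
Hypothesis th0 : forall z, W z -> 0 < th z.
Hypothesis dirichlet : forall r x i, t0 < r < t1 -> boundary Omega x ->
  w i (r, x) = 0.
Hypothesis neumann : forall r x g, t0 < r < t1 -> boundary Omega x ->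
  local_defining_function Omega x g ->
  \sum_i 'D_(std_basis R i) g x * 'D_(ex R i) th (r, x) = 0.
Hypothesis continuity : forall z, cylinder Omega t0 t1 z ->
  'D_(et R) rho z + \sum_i 'D_(ex R i) (fun y => rho y * w i y) z = 0.
Variables (k dk : R -> R).
Hypothesis Ck_k : C1fun [set x | 0 < x] k dk.
Hypothesis k0 : forall x, 0 < x -> 0 <= k x.
Variables (s a b : R -> R -> R) (C : R).
Hypothesis chain : entropy_chain s a b.
Hypothesis C0 : 0 < C.

Let Q := cylinder Omega t0 t1.
Let K := closed_cylinder Omega t0 t1.
Let QK : Q `<=` K. Proof. exact: cylinder_closed. Qed.
Let QW : Q `<=` W. Proof. by move=> z /QK /KW. Qed.
Let mQ : measurable (Q : set (mtime_space R)).
Proof. exact: measurable_cylinder. Qed.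
Let cK : compact K. Proof. exact: compact_cylinder. Qed.

Definition material (f : R * space3 R -> R) (z : R * space3 R) : R :=
  'D_(et R) f z + \sum_i w i z * 'D_(ex R i) f z.

(** For [k y = kappa y / y] this is div(kappa grad theta / theta); the entropy equation contains it
    with a minus sign. *)
Definition heat (z : R * space3 R) : R :=
  \sum_i 'D_(ex R i) (fun y => k (th y) * 'D_(ex R i) th y) z.

Definition cold : set (R * space3 R) := Q `&` [set z | th z <= C].

Lemma measurable_cold : measurable (cold : set (mtime_space R)).
Proof.
have -> : cold = Q `\` (Q `&` [set z | C < th z]).
  rewrite predeqE => z; split=> [[Qz thz]|[Qz nQ]].
    by split=> // -[_ /=]; rewrite ltNge thz.
  by split=> //=; rewrite leNgt; apply/negP => Cth_; apply: nQ.
apply: measurableD; first exact: mQ.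
apply: (base_open_measurable (U := Q `&` [set z | C < th z])
  (countable_base_time_space R)).
rewrite openE => z [Qz Cz]; apply: filterI.
  by apply: open_nbhs_nbhs; split=> //; exact: open_cylinder.
exact: (cvgr_gt _ (Ck1_continuous Cth (QW Qz)) _ Cz).
Qed.

Lemma continuous_material f z : Ck 1 W f -> W z ->
  {for z, continuous (material f)}.
Proof.
move=> Cf Wz; apply: cvgD; first exact: (Ck1_continuousD Cf).
apply: continuous_sum => i; apply: cvgM; first exact: (Ck1_continuous (Cw i)).
exact: (Ck1_continuousD Cf).
Qed.

Lemma material_rho z : Q z ->
  material rho z = - (rho z * \sum_i 'D_(ex R i) (w i) z).
Proof.
move=> Qz; have Wz := QW Qz; have := continuity Qz.
under eq_bigr do rewrite (derive_C1M _ Crho (Cw _) Wz).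
rewrite big_split/= -mulr_sumr => h; rewrite /material; lra.
Qed.

Lemma material_lin f al be z : (forall v, 'D_v f z = al * 'D_v rho z + be * 'D_v th z) ->
  material f z = al * material rho z + be * material th z.
Proof.
move=> Df; rewrite /material Df; under eq_bigr do rewrite Df mulrDr.
rewrite big_split/= !mulrDr !mulr_sumr.
under eq_bigr do rewrite mulrCA; under [X in _ + (_ + X) = _]eq_bigr do rewrite mulrCA.
ring.
Qed.

Let intK f (B : set (mtime_space R)) : measurable B -> B `<=` Q ->
  (forall z, W z -> {for z, continuous f}) ->
  leb_time_space.-integrable B (EFin \o f).
Proof.
by move=> mB BQ cf; apply: (cylinder_integrable (t0 := t0) (t1 := t1) domain) => // z /KW/cf.
Qed.

(** Expanding the left side leaves [q] times the continuity equation besides the right side. *)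
Lemma material_conservative q z : Ck 1 W q -> Q z ->
  'D_(et R) (fun y => rho y * q y) z +
  \sum_i 'D_(ex R i) (fun y => rho y * q y * w i y) z = rho z * material q z.
Proof.
move=> Cq Qz; have Cf := Ck1M oW Crho Cq; have Wz := QW Qz.
rewrite (derive_C1M _ Crho Cq Wz).
under eq_bigr do rewrite (derive_C1M _ Cf (Cw _) Wz) (derive_C1M _ Crho Cq Wz).
pose S := \sum_i (rho z * 'D_(ex R i) (w i) z + w i z * 'D_(ex R i) rho z).
have h : 'D_(et R) rho z + S = 0.
  rewrite -(continuity Qz); congr (_ + _); apply: eq_bigr => i _.
  by rewrite (derive_C1M _ Crho (Cw i) Wz).
have -> : \sum_i (rho z * q z * 'D_(ex R i) (w i) z +
    w i z * (rho z * 'D_(ex R i) q z + q z * 'D_(ex R i) rho z)) =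
    rho z * (\sum_i w i z * 'D_(ex R i) q z) + q z * S.
  by rewrite !mulr_sumr -big_split/=; apply: eq_bigr => i _; ring.
by rewrite /material -[RHS]addr0 -(mulr0 (q z)) -h; ring.
Qed.

(** The flux rho q u vanishes on the boundary by the Dirichlet condition, so its divergence
    integrates to 0 and only the time derivative remains. *)
Lemma integral_material q : Ck 1 W q ->
  \int[leb3]_(x in Omega) (rho (t1, x) * q (t1, x)) -
  \int[leb3]_(x in Omega) (rho (t0, x) * q (t0, x)) =
  \int[leb_time_space]_(z in Q) (rho z * material q z).
Proof.
move=> Cq; have Cf := Ck1M oW Crho Cq.
rewrite -(integral_dt_cylinder domain t01 oW KW Cf) -/Q.
have CF i := Ck1M oW Cf (Cw i).
have divQ0 : \int[leb_time_space]_(z in Q)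
    (\sum_i 'D_(ex R i) (fun z => rho z * q z * w i z) z) = 0.
  apply: (@integral_div_cylinder R Omega t0 t1 domain W
    (fun i z => rho z * q z * w i z) oW KW CF) => r x g rt bx _.
  by apply: big1 => i _; rewrite dirichlet// !mulr0.
rewrite -[LHS]addr0 -{}divQ0 -RintegralD//; last 2 first.
- by apply: intK => // z Wz; exact: (Ck1_continuousD Cf).
- by apply: intK => // z Wz; apply: continuous_sum => i; exact: (Ck1_continuousD (CF i)).
by apply: eq_Rintegral => z /set_mem Qz; exact: material_conservative.
Qed.

(** The interval from min(th, C) to th contains every value of [softmin], so the bound is uniform in
    n. Parametrising it by [0, 1] makes the range of arguments the image of the compact set K x
    [0, 1]. *)
Lemma quadrant_bound h : continuous_quadrant h -> exists2 m, 0 <= m &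
  forall z y, K z -> Num.min (th z) C <= y <= th z -> `|h (rho z) y| <= m.
Proof.
move=> ch.
pose phi (p : (R * space3 R) * R) : R :=
  h (rho p.1) (Num.min (th p.1) C + p.2 * (th p.1 - Num.min (th p.1) C)).
have c01 : compact (K `*` `[0 : R, 1]%classic).
  by apply: compact_setX; [exact: cK|exact: segment_compact].
have min0 z : W z -> 0 < Num.min (th z) C by move=> Wz; rewrite lt_min th0.
have minle z : Num.min (th z) C <= th z by rewrite ge_min lexx.
have [p [/= Kp p01]|m m0 hm] := @compact_bounded_fun R _ _ phi c01.
  have Wp := KW Kp; move: p01; rewrite in_itv/= => /andP[p0 p1].
  have cth : (fun q : (R * space3 R) * R => th q.1) @ p --> th p.1.
    by apply: (@continuous_comp _ _ _ fst th); [exact: cvg_fst|exact: (Ck1_continuous Cth)].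
  have cmin : (fun q : (R * space3 R) * R => Num.min (th q.1) C) @ p --> Num.min (th p.1) C.
    by apply: continuous_min => //; exact: cvg_cst.
  apply: ch.
  - exact: rho0.
  - by rewrite ltr_pwDl ?min0// mulr_ge0// subr_ge0.
  - by apply: (@continuous_comp _ _ _ fst rho); [exact: cvg_fst|exact: (Ck1_continuous Crho)].
  - apply: cvgD => //; apply: cvgM; last exact: cvgB.
    exact: cvg_snd.
exists m => // z y Kz /andP[ly uy].
(* A degenerate interval is treated apart: the parameter [l] below divides by its length. *)
have [e|ne] := eqVneq (th z - Num.min (th z) C) 0.
  have := hm (z, 0); rewrite /phi /= mul0r addr0 => H.
  have -> : y = Num.min (th z) C by lra.
  by apply: H; split=> //=; rewrite in_itv/= lexx ler01.
have d0 : 0 < th z - Num.min (th z) C by rewrite lt0r ne subr_ge0 minle.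
pose l := (y - Num.min (th z) C) / (th z - Num.min (th z) C).
have := hm (z, l); rewrite /phi /= /l divfK// subrKC; apply.
split=> //=; rewrite in_itv/=; apply/andP; split.
  by rewrite divr_ge0 ?subr_ge0// ltW.
by rewrite ler_pdivrMr// mul1r; lra.
Qed.

Lemma Rintegral_cold f :
  \int[leb_time_space]_(z in Q) (f \_ [set z | th z <= C]) z =
  \int[leb_time_space]_(z in cold) f z.
Proof. by rewrite /cold [RHS]Rintegral_mkcondr. Qed.

Lemma cold_heat_ge0 : 0 <= \int[leb_time_space]_(z in cold) heat z.
Proof.
have Ckth : Ck 1 W (fun z => k (th z)) by exact: (Ck1_comp oW Ck_k th0 Cth).
have CG i : Ck 1 W (fun z => k (th z) * 'D_(ex R i) th z) := Ck1M oW Ckth (Cdth i).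
have cheat z : W z -> {for z, continuous heat}.
  by move=> Wz; apply: continuous_sum => i; exact: (Ck1_continuousD (CG i)).
have [m m0 hm] := compact_bounded_fun cK (fun z Kz => cheat z (KW Kz)).
have Cpsi n : Ck 1 W (fun z => softstep C n (th z)).
  by have [dpsi Cp _] := softstep_C1 C n; exact: (Ck1_comp oW Cp (fun _ _ => I) Cth).
have cpsi n z : W z -> {for z, continuous (fun z => softstep C n (th z) * heat z)}.
  by move=> Wz; apply: cvgM; [exact: (Ck1_continuous (Cpsi n))|exact: cheat].
have pos n : 0 <= \int[leb_time_space]_(z in Q) (softstep C n (th z) * heat z).
  have [dpsi Cp dpsi0] := softstep_C1 C n.
  have CF i := Ck1M oW (Cpsi n) (CG i).
  have div0 : \int[leb_time_space]_(z in Q) (\sum_i 'D_(ex R i)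
      (fun z => softstep C n (th z) * (k (th z) * 'D_(ex R i) th z)) z) = 0.
    apply: (@integral_div_cylinder R Omega t0 t1 domain W
      (fun i z => softstep C n (th z) * (k (th z) * 'D_(ex R i) th z)) oW KW CF)
      => r x g rt bx lg.
    transitivity (softstep C n (th (r, x)) * k (th (r, x)) *
        \sum_i 'D_(std_basis R i) g x * 'D_(ex R i) th (r, x)).
      by rewrite mulr_sumr; apply: eq_bigr => i _; ring.
    by rewrite neumann// mulr0.
  (* The null integral of the divergence is compared with that of softstep times heat: the two
     integrands differ by softstep' k |grad th|^2 <= 0. *)
  rewrite -{}div0; apply: le_Rintegral => //.
  - by apply: intK => // z Wz; apply: continuous_sum => i; exact: (Ck1_continuousD (CF i)).
  - by apply: intK => // z Wz; exact: cpsi.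
  move=> z Qz; have Wz := QW Qz; rewrite /heat mulr_sumr; apply: ler_sum => i _.
  rewrite (derive_C1M _ (Cpsi n) (CG i) Wz) gerDl.
  rewrite (derive_C1comp _ Cp I Cth Wz) mulrCA.
  apply: mulr_le0_ge0 => //.
  by rewrite -mulrA; apply: mulr_ge0; [apply: k0; exact: th0|rewrite -expr2 sqr_ge0].
have cvg : \int[leb_time_space]_(z in Q) (softstep C n (th z) * heat z)
    @[n --> \oo] --> \int[leb_time_space]_(z in cold) heat z.
  rewrite -Rintegral_cold; apply: (@Rintegral_bounded_cvg _ _ _ _ _ _ _ m) => //.
  - exact: cylinder_lty.
  - move=> n; apply: (cylinder_measurable_fun domain (t0 := t0) (t1 := t1)).
    by move=> z /KW Wz; exact: cpsi.
  - move=> n z Qz; rewrite normrM -[leRHS]mul1r; apply: ler_pM => //.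
      by have /andP[? ?] := softstep_itv C n (th z); rewrite ger0_norm.
    by apply: hm; exact: QK.
  - move=> z Qz; rewrite patchE; case: (leP (th z) C) => thz.
      rewrite mem_set//; under eq_fun do rewrite softstep_le// mul1r.
      exact: cvg_cst.
    rewrite memNset /=; last by rewrite leNgt thz.
    rewrite -[X in _ --> X](mul0r (heat z)).
    by apply: cvgM; [exact: softstep_cvg|exact: cvg_cst].
by apply: (cvgr_to_ge cvg); apply: nearW.
Qed.

Definition entropy_gap (z : R * space3 R) : R :=
  s (rho z) C - s (rho z) (Num.min (th z) C).

(** Formally this is rho times the material derivative of [entropy_gap] where th < C: there min(th,
    C) = th, and s(rho, C) varies only through rho. *)
Definition entropy_flux (z : R * space3 R) : R :=
  rho z * (a (rho z) C * material rho z - material (fun y => s (rho y) (th y)) z).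

Let compose (h : R -> R -> R) (z : R * space3 R) (y : R * space3 R -> R) :
  continuous_quadrant h -> W z -> 0 < y z -> {for z, continuous y} ->
  {for z, continuous (fun z : R * space3 R => h (rho z) (y z))}.
Proof.
move=> ch Wz y0 cy; apply: ch => //; first exact: rho0.
exact: (Ck1_continuous Crho).
Qed.

Lemma entropy_gap_slice_integrable r : `[t0, t1]%classic r ->
  leb3.-integrable Omega (fun x => (rho (r, x) * entropy_gap (r, x))%:E).
Proof.
move=> rt; apply: (domain_integrable domain (f := fun x => rho (r, x) * entropy_gap (r, x))).
move=> x cx; have Wz : W (r, x) by apply: KW.
apply: (@continuous_slicer R (space3 R) R (fun z => rho z * entropy_gap z) r x).
apply: cvgM; first exact: (Ck1_continuous Crho).
have cth := Ck1_continuous Cth Wz.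
apply: cvgB; apply: (compose (chain_s chain) Wz) => //.
- exact: cvg_cst.
- by rewrite lt_min th0.
- by apply: continuous_min => //; exact: cvg_cst.
Qed.

(** [entropy_gap] need not be C^1 across {th = C}. So [integral_material] is applied to [q n], with
    [softmin] in place of the minimum, and both sides pass to the limit. *)
Lemma truncated_entropy_balance :
  \int[leb3]_(x in Omega) (rho (t1, x) * entropy_gap (t1, x)) -
  \int[leb3]_(x in Omega) (rho (t0, x) * entropy_gap (t0, x)) =
  \int[leb_time_space]_(z in cold) entropy_flux z.
Proof.
pose m n z := softmin C n (th z).
have m0 n z : W z -> 0 < m n z.
  move=> Wz; have /andP[+ _] := softmin_itv C n (th z); apply: lt_le_trans.
  by rewrite lt_min th0.
have mitv n z : Num.min (th z) C <= m n z <= th z by exact: softmin_itv.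
have Cm n : Ck 1 W (m n).
  exact: (Ck1_comp oW (softmin_C1 C n) (fun _ _ => I) Cth).
have [CsC DsC] := chain_C1 chain oW Crho (Ck1_cst C oW) rho0 (fun _ _ => C0).
have [Cs Ds] := chain_C1 chain oW Crho Cth rho0 th0.
pose q n z := s (rho z) C - s (rho z) (m n z).
have Cq n : Ck 1 W (q n).
  have [Csm _] := chain_C1 chain oW Crho (Cm n) rho0 (m0 n).
  exact: (Ck1B oW CsC Csm).
have matq n z : W z -> material (q n) z =
    (a (rho z) C - a (rho z) (m n z)) * material rho z +
    - (b (rho z) (m n z) * dsoftmin C n (th z)) * material th z.
  move=> Wz; apply: material_lin => v.
  have [Csm Dsm] := chain_C1 chain oW Crho (Cm n) rho0 (m0 n).
  rewrite (derive_C1B v CsC Csm Wz) DsC// Dsm// derive_cst.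
  by rewrite (derive_C1comp v (softmin_C1 C n) I Cth Wz); ring.
have mats z : W z -> material (fun y => s (rho y) (th y)) z =
    a (rho z) (th z) * material rho z + b (rho z) (th z) * material th z.
  by move=> Wz; apply: material_lin => v; exact: Ds.
(* These constants bound every factor on the compact cylinder independently of n, giving the
   dominating constants below. *)
have [br br0 hr] := compact_bounded_fun cK (fun z Kz => Ck1_continuous Crho (KW Kz)).
have [bM bM0 hM] := compact_bounded_fun cK (fun z Kz => continuous_material Crho (KW Kz)).
have [bT bT0 hT] := compact_bounded_fun cK (fun z Kz => continuous_material Cth (KW Kz)).
have [ba ba0 ha] := quadrant_bound (chain_a chain).
have [bb bb0 hb] := quadrant_bound (chain_b chain).
have [bs bs0 hs] := quadrant_bound (chain_s chain).
have caC z : W z -> {for z, continuous (fun z => a (rho z) C)}.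
  by move=> Wz; apply: (compose (chain_a chain) Wz) => //; exact: cvg_cst.
have csC z : W z -> {for z, continuous (fun z => s (rho z) C)}.
  by move=> Wz; apply: (compose (chain_s chain) Wz) => //; exact: cvg_cst.
have [baC baC0 haC] := compact_bounded_fun cK (fun z Kz => caC z (KW Kz)).
have [bsC bsC0 hsC] := compact_bounded_fun cK (fun z Kz => csC z (KW Kz)).
have cvg_vol : \int[leb_time_space]_(z in Q) (rho z * material (q n) z)
    @[n --> \oo] --> \int[leb_time_space]_(z in cold) entropy_flux z.
  rewrite -Rintegral_cold.
  apply: (@Rintegral_bounded_cvg _ _ _ _ _ _ _ (br * ((baC + ba) * bM + bb * bT))) => //.
  - exact: cylinder_lty.
  - move=> n; apply: (cylinder_measurable_fun domain (t0 := t0) (t1 := t1)).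
    move=> z /KW Wz; apply: cvgM; first exact: (Ck1_continuous Crho).
    exact: (continuous_material (Cq n)).
  - move=> n z Qz; have Kz := QK Qz; rewrite normrM.
    apply: ler_pM => //; first exact: hr.
    rewrite matq; last exact: KW.
    apply: (le_trans (ler_normD _ _)); rewrite !normrM normrN normrM.
    apply: lerD; apply: ler_pM => //.
    + apply: (le_trans (ler_normB _ _)); apply: lerD; first exact: haC.
      exact: ha.
    + exact: hM.
    + rewrite -[leRHS]mulr1; apply: ler_pM => //; first exact: hb.
      by have /andP[? ?] := dsoftmin_itv C n (th z); rewrite ger0_norm.
    + exact: hT.
  - move=> z Qz; have Wz := QW Qz.
    have cmin : m n z @[n --> \oo] --> Num.min (th z) C by exact: softmin_cvg.
    under eq_fun do rewrite matq//.
    (* Up to C the integrand is [entropy_flux] for every n. Above C the value [m n z] tends to C and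
       its slope to 0, so both coefficients vanish in the limit. *)
    rewrite patchE; case: (leP (th z) C) => thz.
      rewrite mem_set//; under eq_fun do rewrite /m (softmin_le _ thz).1 (softmin_le _ thz).2.
      rewrite /entropy_flux mats//.
      suff -> : forall x y u v M N : R, x * ((y - u) * M + - (v * 1) * N) = x * (y * M - (u * M + v * N)).
        exact: cvg_cst.
      by move=> *; ring.
    rewrite memNset /=; last by rewrite leNgt thz.
    have mC : m n z @[n --> \oo] --> C by move: cmin; rewrite min_r// ltW.
    have crho : (fun _ : nat => rho z) @ \oo --> rho z by exact: cvg_cst.
    have ca : a (rho z) (m n z) @[n --> \oo] --> a (rho z) C.
      by apply: (chain_a chain) => //; exact: rho0.
    have cb : b (rho z) (m n z) @[n --> \oo] --> b (rho z) C.
      by apply: (chain_b chain) => //; exact: rho0.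
    have cd : dsoftmin C n (th z) @[n --> \oo] --> 0 by exact: dsoftmin_cvg.
    suff : rho z * ((a (rho z) C - a (rho z) (m n z)) * material rho z +
        - (b (rho z) (m n z) * dsoftmin C n (th z)) * material th z)
        @[n --> \oo] --> rho z * ((a (rho z) C - a (rho z) C) * material rho z +
        - (b (rho z) C * 0) * material th z).
      by rewrite subrr mul0r mulr0 oppr0 mul0r addr0 mulr0.
    apply: cvgM; first exact: cvg_cst.
    apply: cvgD; (apply: cvgM; last exact: cvg_cst).
      by apply: cvgB => //; exact: cvg_cst.
    by apply: cvgN; exact: cvgM.
have cvg_slice r : `[t0, t1]%classic r ->
    \int[leb3]_(x in Omega) (rho (r, x) * q n (r, x)) @[n --> \oo] -->
    \int[leb3]_(x in Omega) (rho (r, x) * entropy_gap (r, x)).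
  move=> rt.
  have Kr x : Omega x -> K (r, x) by move=> Ox; split=> //; exact: subset_closure.
  apply: (@Rintegral_bounded_cvg _ _ _ _ _ _ _ (br * (bsC + bs))).
  - exact: measurable_domain.
  - exact: leb3_domain_lty.
  - move=> n; apply: (base_continuous_measurable (f := fun x => rho (r, x) * q n (r, x))
      (countable_base3 R) (open_domain domain)) => x Ox.
    apply: (@continuous_slicer R (space3 R) R (fun z => rho z * q n z) r x).
    have Wz := KW (Kr x Ox).
    by apply: cvgM; [exact: (Ck1_continuous Crho)|exact: (Ck1_continuous (Cq n))].
  - move=> n x Ox; have Kz := Kr x Ox; rewrite normrM; apply: ler_pM => //.
      exact: hr.
    apply: (le_trans (ler_normB _ _)); apply: lerD; first exact: hsC.
    exact: hs.
  - move=> x Ox; have Wz := KW (Kr x Ox); apply: cvgM; first exact: cvg_cst.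
    apply: cvgB; first exact: cvg_cst.
    apply: (chain_s chain) => //; first exact: rho0.
    + by rewrite lt_min th0.
    + exact: cvg_cst.
    + exact: softmin_cvg.
have t0i : `[t0, t1]%classic t0 by rewrite /= in_itv/= lexx ltW.
have t1i : `[t0, t1]%classic t1 by rewrite /= in_itv/= lexx ltW.
have cvg_diff := cvgB (cvg_slice t1 t1i) (cvg_slice t0 t0i).
have E : (fun n => \int[leb3]_(x in Omega) (rho (t1, x) * q n (t1, x)) -
    \int[leb3]_(x in Omega) (rho (t0, x) * q n (t0, x))) =
  (fun n => \int[leb_time_space]_(z in Q) (rho z * material (q n) z)).
  by apply/funext => n; exact: (integral_material (Cq n)).
have {}cvg_diff : \int[leb_time_space]_(z in Q) (rho z * material (q n) z)
    @[n --> \oo] --> \int[leb3]_(x in Omega) (rho (t1, x) * entropy_gap (t1, x)) -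
    \int[leb3]_(x in Omega) (rho (t0, x) * entropy_gap (t0, x)).
  by rewrite -E; exact: cvg_diff.
exact: (cvg_unique _ cvg_diff cvg_vol).
Qed.

End entropy_balance.

(** * Classical solutions of the Navier-Stokes-Fourier system *)

Lemma derive_slice (R : realType) (V1 V2 : normedModType R) (W : set (V1 * V2))
    (f : V1 * V2 -> R) (g : V2 -> R) (O : set V2) (r : V1) (x v : V2) :
  open W -> Ck 1 W f -> open O -> O x -> W (r, x) ->
  (forall y, O y -> g y = f (r, y)) -> 'D_v g x = 'D_(0, v) f (r, x).
Proof.
move=> oW Cf oO Ox Wrx gf; rewrite -(Ck1_slice r oW Cf).2//.
apply: near_eq_derive; near=> y; apply: gf; near: y.
exact: open_nbhs_nbhs.
Unshelve. all: by end_near. Qed.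

Lemma derive1_slice (R : realType) (V : normedModType R) (W : set (R * V))
    (f : R * V -> R) (g : R -> R) (r : R) (x : V) :
  Ck 1 W f -> W (r, x) -> (\near r, g r = f (r, x)) ->
  derive1 g r = 'D_(1, 0) f (r, x).
Proof.
move=> Cf Wrx gf; rewrite derive1E (near_eq_derive _ gf).
have D : is_derive (r, x) ((1, 0) : R * V) f ('D_((1, 0) : R * V) f (r, x)).
  exact: (Ck1_is_derive _ Cf Wrx).
by have [] := (is_derive_fstP (V1 := R) (V2 := V) f r 1 x _).1 D.
Qed.

Lemma sqnorm_gt0 (R : realType) (v : 'rV[R]_3) : v != 0 -> 0 < sqnorm v.
Proof.
move=> v0; rewrite lt0r; apply/andP; split; last first.
  by apply: sumr_ge0 => i _; rewrite -expr2 sqr_ge0.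
apply: contra v0 => /eqP s0; apply/eqP/rowP => i; rewrite mxE.
have /(_ i isT)/eqP : forall i, true -> v 0 i * v 0 i = 0.
  by apply: psumr_eq0P s0 => j _; rewrite -expr2 sqr_ge0.
by rewrite mulf_eq0 orbb => /eqP.
Qed.

(** Each field has its own extension and open set. Their intersection is cut down to where the
    extended density and temperature are positive, so that s and the coefficients can be composed
    with them on all of [W]. *)
Lemma solution_extension (R : realType) (T : R) (Omega : set (space3 R))
    (p s : R -> R -> R) (mu eta kappa : R -> R)
    (rho theta : R -> space3 R -> R) (u : R -> space3 R -> 'rV[R]_3)
    (sigma : {measure set (mtime_space R) -> \bar R})
    (rho0 theta0 : space3 R -> R) (m0 : space3 R -> 'rV[R]_3) :
  classical_NSF_solution T Omega p s mu eta kappa rho theta u sigma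
    rho0 theta0 m0 ->
  exists (W : set (R * space3 R)) (rt tt : R * space3 R -> R)
    (wt : 'I_3 -> R * space3 R -> R),
    [/\ open W, forall r x, 0 <= r < T -> closure Omega x -> W (r, x),
     (forall z, W z -> 0 < rt z) /\ (forall z, W z -> 0 < tt z),
     [/\ forall k, Ck k W rt, forall k, Ck k W tt & forall i k, Ck k W (wt i)] &
     forall r x, 0 <= r < T -> closure Omega x ->
       [/\ rho r x = rt (r, x), theta r x = tt (r, x) &
           forall i, u r x 0 i = wt i (r, x)]].
Proof.
move=> sol.
have [U1 [rt [oU1 sU1 Cr Er]]] := nsf_rho_smooth sol.
have [U2 [tt_ [oU2 sU2 Ct Et]]] := nsf_theta_smooth sol.
pose P i (Ug : set (R * space3 R) * (R * space3 R -> R)) :=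
  [/\ open Ug.1, `[0, T[ `*` closure Omega `<=` Ug.1, forall k, Ck k Ug.1 Ug.2 &
      forall z, (`[0, T[ `*` closure Omega) z -> u z.1 z.2 0 i = Ug.2 z].
have [Ug HUg] : {Ug : 'I_3 -> set (R * space3 R) * (R * space3 R -> R) &
    forall i, P i (Ug i)}.
  apply: choice => i; have [U [g [? ? ? ?]]] := nsf_u_smooth sol i.
  by exists (U, g).
pose W := [set z | [/\ U1 z, U2 z, forall i, (Ug i).1 z, 0 < rt z & 0 < tt_ z]].
have itvT r x : 0 <= r < T -> closure Omega x -> (`[0, T[ `*` closure Omega) (r, x).
  by move=> rT cx; split=> //=; rewrite in_itv.
exists W, rt, tt_, (fun i => (Ug i).2); split.
- rewrite openE => z [U1z U2z Ugz rz tz].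
  have n1 : \forall y \near z, U1 y by exact: open_nbhs_nbhs.
  have n2 : \forall y \near z, U2 y by exact: open_nbhs_nbhs.
  have n3 : \forall y \near z, forall i, (Ug i).1 y.
    have H i : nbhs z (Ug i).1 by apply: open_nbhs_nbhs; split; [case: (HUg i)|].
    exact: (@filter_forall _ _ (fun i => (Ug i).1) (nbhs z) _ H).
  have n4 : \forall y \near z, 0 < rt y by exact: cvgr_gt (Ck1_continuous (Cr 1%N) U1z) _ rz.
  have n5 : \forall y \near z, 0 < tt_ y by exact: cvgr_gt (Ck1_continuous (Ct 1%N) U2z) _ tz.
  by near=> y; split; near: y.
- move=> r x rT cx; have rx := itvT r x rT cx; split.
  + exact: sU1.
  + exact: sU2.
  + by move=> i; have [_ + _ _] := HUg i; apply.
  + by rewrite -(Er _ rx); exact: (nsf_rho_gt0 sol).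
  + by rewrite -(Et _ rx); exact: (nsf_theta_gt0 sol).
- by split=> z [].
- split.
  + by move=> k; apply: Ck_subset (Cr k) => z [].
  + by move=> k; apply: Ck_subset (Ct k) => z [].
  + by move=> i k; have [_ _ Ck_ _] := HUg i; apply: Ck_subset (Ck_ k) => z [].
- move=> r x rT cx; have rx := itvT r x rT cx; split.
  + exact: (Er _ rx).
  + exact: (Et _ rx).
  + by move=> i; have [_ _ _ +] := HUg i; move=> /(_ _ rx).
Unshelve. all: by end_near. Qed.

Section solution.
Variables (R : realType) (T : R) (Omega : set (space3 R))
    (p e s : R -> R -> R) (mu eta kappa P S : R -> R)
    (rho theta : R -> space3 R -> R) (u : R -> space3 R -> 'rV[R]_3)
    (sigma : {measure set (mtime_space R) -> \bar R})
    (rho0 theta0 : space3 R -> R) (m0 : space3 R -> 'rV[R]_3).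
Hypothesis domain : smooth_bounded_domain Omega.
Hypothesis laws : constitutive_laws p e s mu eta kappa P S.
Hypothesis sol : classical_NSF_solution T Omega p s mu eta kappa rho theta u
  sigma rho0 theta0 m0.
Variables (W : set (R * space3 R)) (rt tt : R * space3 R -> R)
  (w : 'I_3 -> R * space3 R -> R).
Hypothesis oW : open W.
Hypothesis TW : forall r x, 0 <= r < T -> closure Omega x -> W (r, x).
Hypothesis rt0 : forall z, W z -> 0 < rt z.
Hypothesis tt0 : forall z, W z -> 0 < tt z.
Hypothesis Crt : forall k, Ck k W rt.
Hypothesis Ctt : forall k, Ck k W tt.
Hypothesis Cw : forall i k, Ck k W (w i).
Hypothesis ext : forall r x, 0 <= r < T -> closure Omega x ->
  [/\ rho r x = rt (r, x), theta r x = tt (r, x) &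
      forall i, u r x 0 i = w i (r, x)].
Variables (t0 t1 C : R).
Hypothesis t0_ge0 : 0 <= t0.
Hypothesis t01 : t0 < t1.
Hypothesis t1T : t1 < T.
Hypothesis C0 : 0 < C.

Let oO : open Omega. Proof. exact: open_domain. Qed.
Let OW r x : 0 <= r < T -> Omega x -> W (r, x).
Proof. by move=> rT Ox; apply: TW => //; exact: subset_closure. Qed.
Let extO r x : 0 <= r < T -> Omega x -> [/\ rho r x = rt (r, x),
  theta r x = tt (r, x) & forall i, u r x 0 i = w i (r, x)].
Proof. by move=> rT Ox; apply: ext => //; exact: subset_closure. Qed.
Let KW : closed_cylinder Omega t0 t1 `<=` W.
Proof.
move=> [r x] [/= + cx]; rewrite in_itv/= => /andP[r0 r1]; apply: TW => //.
by apply/andP; split; [exact: le_trans r0|exact: le_lt_trans t1T].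
Qed.
Let oot r : t0 < r < t1 -> 0 < r < T.
Proof.
move=> /andP[r0 r1].
by apply/andP; split; [exact: le_lt_trans r0|exact: lt_trans t1T].
Qed.
Let oo_co r : 0 < r < T -> 0 <= r < T.
Proof. by move=> /andP[r0 ->]; rewrite ltW. Qed.
Let Crt1 : Ck 1 W rt := Crt 1.
Let Ctt1 : Ck 1 W tt := Ctt 1.
Let Cw1 i : Ck 1 W (w i) := Cw i 1.
Let Cdtt i : Ck 1 W ('D_(ex R i) tt).
Proof. by have [_ /(_ (ex R i))[]] := Ctt 2%N. Qed.

Let dx (f : R -> space3 R -> R) (g : R * space3 R -> R) r x v : Ck 1 W g ->
  (forall r x, 0 <= r < T -> Omega x -> f r x = g (r, x)) ->
  0 <= r < T -> Omega x -> 'D_v (f r) x = 'D_(0, v) g (r, x).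
Proof.
move=> Cg fg rT Ox; apply: (derive_slice v oW Cg oO Ox (OW rT Ox)) => y Oy.
exact: fg.
Qed.

(** Agreement in a neighbourhood of [r] requires 0 < r: for negative times the given functions are
    arbitrary. *)
Let dt (f : R -> space3 R -> R) (g : R * space3 R -> R) r x : Ck 1 W g ->
  (forall r x, 0 <= r < T -> Omega x -> f r x = g (r, x)) ->
  0 < r < T -> Omega x -> derive1 (f ^~ x) r = 'D_(et R) g (r, x).
Proof.
move=> Cg fg rT Ox; apply: (derive1_slice Cg (OW (oo_co rT) Ox)).
near=> r'; have : `]0, T[%classic r'.
  near: r'; apply: open_nbhs_nbhs; split; first exact: itv_open.
  by rewrite /= in_itv.
by rewrite /= in_itv => rT'; exact: (fg _ _ (oo_co rT') Ox).
Unshelve. all: by end_near. Qed.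

Let dirichlet r x i : t0 < r < t1 -> boundary Omega x -> w i (r, x) = 0.
Proof.
move=> /oot/oo_co rT bx; have [cx _] := bx.
have [_ _ <-] := ext rT cx.
by rewrite (nsf_dirichlet sol rT bx) mxE.
Qed.

(** The Neumann condition is a limit from inside of the given gradient. There it equals the gradient
    of the extension, which is continuous up to [x], so the limit is its value at [x]; the factor
    [c] normalising the normal is nonzero. *)
Let neumann r x g : t0 < r < t1 -> boundary Omega x ->
  local_defining_function Omega x g ->
  \sum_i 'D_(std_basis R i) g x * 'D_(ex R i) tt (r, x) = 0.
Proof.
move=> /oot/oo_co rT bx lg; have [cx _] := bx; have Wz := TW rT cx.
pose c := (Num.sqrt (sqnorm (grad g x)))^-1.
have c0 : c != 0.
  by rewrite invr_eq0 gt_eqF// sqrtr_gt0 sqnorm_gt0//; case: lg => U [].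
have lim0 := nsf_neumann sol rT (ex_intro2 _ _ g lg erefl) bx.
pose h y := \sum_i 'D_(ex R i) tt (r, y) * (c * 'D_(std_basis R i) g x).
have ch : {for x, continuous h}.
  apply: continuous_sum => i; apply: cvgM; last exact: cvg_cst.
  apply: (@continuous_slicer R (space3 R) R ('D_(ex R i) tt) r x).
  exact: (Ck1_continuousD Ctt1).
(* Limits from inside are unique because [x] lies in the closure of Omega. *)
have FF : ProperFilter (within Omega (nbhs x)).
  apply: Build_ProperFilter_ex => A; rewrite /within/= => /nbhs_interior.
  move=> nA; have [y [Oy /interior_subset Ay]] := cx _ nA.
  by exists y; exact: Ay.
have lim1 : h y @[y --> within Omega (nbhs x)] --> h x.
  exact: cvg_within_filter ch.
have lim2 : h y @[y --> within Omega (nbhs x)] --> 0.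
  apply: cvg_trans lim0; apply: near_eq_cvg; near=> y.
  have Oy : Omega y by near: y; exact: withinT.
  rewrite /h /dot; apply: eq_bigr => i _; rewrite !mxE.
  congr (_ * _); apply: (dx (f := theta) _ Ctt1 _ rT Oy) => r' x' h' Ox'.
  by have [_ -> _] := extO h' Ox'.
have hx0 : h x = 0.
  exact: (cvg_unique (@Rhausdorff R) lim1 lim2).
have : c * \sum_i 'D_(std_basis R i) g x * 'D_(ex R i) tt (r, x) = 0.
  by rewrite -[RHS]hx0 /h mulr_sumr; apply: eq_bigr => i _; ring.
by move=> /eqP; rewrite mulf_eq0 (negbTE c0) => /eqP.
Unshelve. all: by end_near. Qed.

Let continuity z : cylinder Omega t0 t1 z ->
  'D_(et R) rt z + \sum_i 'D_(ex R i) (fun y => rt y * w i y) z = 0.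
Proof.
case: z => r x [/= rt01 Ox]; rewrite in_itv/= in rt01; have rT := oot rt01.
rewrite -[RHS](nsf_continuity sol rT Ox) /continuity_residual /div; congr (_ + _).
  apply/esym; apply: (dt (f := rho) Crt1 _ rT Ox) => r' x' rT' Ox'.
  by have [-> _ _] := extO rT' Ox'.
apply: eq_bigr => i _; apply/esym.
apply: (dx (f := fun r y => (rho r y *: u r y) 0 i) (g := fun z => rt z * w i z)
  _ (Ck1M oW Crt1 (Cw1 i)) _ (oo_co rT) Ox) => r' x' rT' Ox'.
by have [-> _ E] := extO rT' Ox'; rewrite mxE E.
Qed.

Let k (y : R) : R := kappa y / y.

Let k_C1 : exists dk, C1fun [set x | 0 < x] k dk.
Proof.
have pos : forall x : R, [set x : R | 0 < x] x -> x != 0.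
  by move=> x x0; rewrite gt_eqF.
eexists; exact: (C1funM (C1_halfline_C1fun (law_kappa_C1 laws)) (C1fun_inv pos)).
Qed.

Let k_ge0 x : 0 < x -> 0 <= k x.
Proof.
move=> x0; have [al [? [? [lo [hi [? [_ _ /andP[lo0 _] _ [_ _ H]]]]]]]] := law_transport laws.
have /andP[h _] := H x (ltW x0).
by apply: divr_ge0; [exact: le_trans (ltW lo0) h|exact: ltW].
Qed.

Let dtheta r x v : 0 <= r < T -> Omega x ->
  'D_v (theta r) x = 'D_(0, v) tt (r, x).
Proof.
move=> rT Ox; apply: (dx (f := theta) v Ctt1 _ rT Ox) => r' x' h Ox'.
by have [_ -> _] := extO h Ox'.
Qed.

Let du r x v i : 0 <= r < T -> Omega x ->
  'D_v (fun y => u r y 0 i) x = 'D_(0, v) (w i) (r, x).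
Proof.
move=> rT Ox; apply: (dx (f := fun r y => u r y 0 i) v (Cw1 i) _ rT Ox) => r' x' h Ox'.
by have [_ _ ->] := extO h Ox'.
Qed.

Lemma entropy_productionE a b r x : entropy_chain s a b -> t0 < r < t1 -> Omega x ->
  entropy_production s kappa rho theta u r x =
  rt (r, x) * material w (fun z => s (rt z) (tt z)) (r, x) - heat tt k (r, x).
Proof.
move=> ch rt01 Ox; have rT := oot rt01; have rT' := oo_co rT.
have Wz := OW rT' Ox.
have [Cs _] := chain_C1 ch oW Crt1 Ctt1 rt0 tt0.
have Qz : cylinder Omega t0 t1 (r, x) by split=> //=; rewrite in_itv.
rewrite -(material_conservative oW KW Crt1 Cw1 continuity Cs Qz).
rewrite /entropy_production /div; congr (_ + _ + _).
- apply: (dt (f := fun r x => rho r x * s (rho r x) (theta r x))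
    (Ck1M oW Crt1 Cs) _ rT Ox) => r' x' h Ox'.
  by have [-> -> _] := extO h Ox'.
- apply: eq_bigr => i _.
  apply: (dx (f := fun r y => ((rho r y * s (rho r y) (theta r y)) *: u r y) 0 i)
    (g := fun z => rt z * s (rt z) (tt z) * w i z) _
    (Ck1M oW (Ck1M oW Crt1 Cs) (Cw1 i)) _ rT' Ox) => r2 x' h Ox'.
  by have [-> -> E] := extO h Ox'; rewrite mxE E.
rewrite /heat -sumrN; apply: eq_bigr => i _.
have [dk Ck_k] := k_C1.
have Ckt : Ck 1 W (fun z => k (tt z)) by exact: (Ck1_comp oW Ck_k tt0 Ctt1).
have Cg := Ck1M oW Ckt (Cdtt i).
have [_ <-] := is_deriveN (Ck1_is_derive (ex R i) Cg Wz).
apply: (dx (f := fun r y => ((- kappa (theta r y) / theta r y) *: grad (theta r) y) 0 i)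
  (g := fun z => - (k (tt z) * 'D_(ex R i) tt z)) _ (Ck1N oW Cg) _ rT' Ox) => r2 x' h Ox'.
rewrite !mxE (dtheta _ h Ox').
by have [_ -> _] := extO h Ox'; rewrite /k !mulNr.
Qed.

Let divw z := \sum_i 'D_(ex R i) (w i) z.
(** Written with the extended fields, the dissipation is continuous on all of [W], hence bounded on
    the closed cylinder. *)
Let dissipation_ext z : R :=
  (mu (tt z) * (\sum_i \sum_j (2 * ('D_(ex R j) (w i) z + 'D_(ex R i) (w j) z) -
      (2 / 3 * divw z) *+ (i == j)) ^+ 2)
   + 2 * eta (tt z) * `|divw z| ^+ 2) / (2 * tt z)
  + kappa (tt z) * (\sum_i 'D_(ex R i) tt z * 'D_(ex R i) tt z) / tt z ^+ 2.

Let divE r x : 0 <= r < T -> Omega x -> div (u r) x = divw (r, x).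
Proof. by move=> rT Ox; apply: eq_bigr => i _; exact: du. Qed.

Lemma dissipationE r x : 0 <= r < T -> Omega x ->
  dissipation mu eta kappa theta u r x = dissipation_ext (r, x).
Proof.
move=> rT Ox; rewrite /dissipation /dissipation_ext (divE rT Ox).
have [_ -> _] := extO rT Ox; congr ((_ * _ + _) / _ + _ * _ / _).
- apply: eq_bigr => i _; apply: eq_bigr => j _; congr (_ ^+ 2).
  by rewrite !mxE (divE rT Ox) !du.
- by apply: eq_bigr => i _; rewrite !mxE dtheta.
Qed.

Let continuous_halfline (f : R -> R) z : C1_halfline f -> W z ->
  {for z, continuous (fun z => f (tt z))}.
Proof.
move=> /C1_halfline_C1fun Cf Wz; have [d _] := Cf _ (tt0 Wz).
apply: continuous_comp; first exact: (Ck1_continuous Ctt1).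
exact: is_derive_continuous d.
Qed.

Let continuous_divw z : W z -> {for z, continuous divw}.
Proof. by move=> Wz; apply: continuous_sum => i; exact: (Ck1_continuousD (Cw1 i)). Qed.

Lemma continuous_dissipation z : W z -> {for z, continuous dissipation_ext}.
Proof.
move=> Wz; have ctt := Ck1_continuous Ctt1 Wz; have cdiv := continuous_divw Wz.
have tz := tt0 Wz.
have sq (f : R * space3 R -> R) : {for z, continuous f} -> {for z, continuous (fun z => f z ^+ 2)}.
  by move=> cf; apply: (cvgM cf cf).
apply: cvgD; apply: cvgM.
- apply: cvgD; apply: cvgM.
  + exact: (continuous_halfline (law_mu_C1 laws) Wz).
  + apply: continuous_sum => i; apply: continuous_sum => j; apply: sq.
    apply: cvgB.
      apply: cvgM; first exact: cvg_cst.
      by apply: cvgD; [exact: (Ck1_continuousD (Cw1 i))|exact: (Ck1_continuousD (Cw1 j))].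
    by apply: cvgMn; apply: cvgM; [exact: cvg_cst|exact: cdiv].
  + by apply: cvgM; [exact: cvg_cst|exact: (continuous_halfline (law_eta_C1 laws) Wz)].
  + by apply: sq; exact: cvg_norm cdiv.
- apply: cvgV; first by rewrite mulf_neq0 ?gt_eqF.
  by apply: cvgM; [exact: cvg_cst|exact: ctt].
- apply: cvgM; first exact: (continuous_halfline (law_kappa_C1 laws) Wz).
  by apply: continuous_sum => i; apply: cvgM; exact: (Ck1_continuousD Ctt1).
- by apply: cvgV; [rewrite expf_neq0// gt_eqF|exact: sq ctt].
Qed.

Let itv_co r : `[t0, t1]%classic r -> 0 <= r < T.
Proof.
rewrite /= in_itv/= => /andP[r0 r1].
by apply/andP; split; [exact: le_trans r0|exact: le_lt_trans t1T].
Qed.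

Lemma truncated_entropy_integralE a b r : entropy_chain s a b ->
  `[t0, t1]%classic r ->
  (\int[leb3]_(x in Omega) (rho r x * truncated_entropy s rho theta C r x)%:E =
   (\int[leb3]_(x in Omega) (rt (r, x) * entropy_gap rt tt s C (r, x)))%:E)%E.
Proof.
move=> ch rt01; rewrite -EFin_Rintegral; first last.
- exact: (entropy_gap_slice_integrable domain KW Crt1 Ctt1 rt0 tt0 ch C0 rt01).
- exact: measurable_domain.
apply: eq_integral_EFin => x Ox; rewrite /truncated_entropy /entropy_gap /=.
by have [-> -> _] := extO (itv_co rt01) Ox.
Qed.

(** This turns the iterated extended-real integrals into finite space-time integrals, to which
    linearity and real arithmetic apply. *)
Lemma cold_slice_integralE (f : R -> space3 R -> R) (g : R * space3 R -> R) :
  (forall r x, t0 < r < t1 -> Omega x -> f r x = g (r, x)) ->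
  (forall z, W z -> {for z, continuous g}) ->
  (\int[lebesgue_measure]_(r in `[t0, t1])
     \int[leb3]_(x in cold_region Omega theta C r) (f r x)%:E =
   (\int[leb_time_space]_(z in cold Omega t0 t1 tt C) g z)%:E)%E.
Proof.
move=> fg cg; have mB := measurable_cold (t0 := t0) (t1 := t1) domain KW Ctt1 C.
have BQ : cold Omega t0 t1 tt C `<=` cylinder Omega t0 t1 by move=> z [].
have intg : leb_time_space.-integrable (cold Omega t0 t1 tt C) (EFin \o g).
  by apply: (cylinder_integrable domain mB BQ) => z /KW; exact: cg.
rewrite -EFin_Rintegral//; apply: (integral_time_slices mB BQ intg) => r rt01.
have h : t0 < r < t1 by move: rt01; rewrite /= in_itv.
have rT := oo_co (oot h).
have -> : cold_region Omega theta C r = [set x | cold Omega t0 t1 tt C (r, x)].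
  rewrite predeqE => x; split=> [[Ox /=]|[[_ Ox] /=]].
    by have [_ -> _] := extO rT Ox => ?; split.
  by move=> ?; split=> //=; have [_ -> _] := extO rT Ox.
by apply: eq_integral_EFin => x [[_ Ox] _]; exact: fg.
Qed.

(** On the cold set the dissipation is at most [sigma], which equals the integral of the entropy
    production, that is of [prod - heat]; the heat integral is nonnegative by [cold_heat_ge0]. *)
Lemma cold_dissipation_le a b : entropy_chain s a b ->
  \int[leb_time_space]_(z in cold Omega t0 t1 tt C) dissipation_ext z <=
  \int[leb_time_space]_(z in cold Omega t0 t1 tt C)
    (rt z * material w (fun z => s (rt z) (tt z)) z).
Proof.
move=> ch; have mB := measurable_cold (t0 := t0) (t1 := t1) domain KW Ctt1 C.
set B := cold Omega t0 t1 tt C in mB *.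
have BQ : B `<=` cylinder Omega t0 t1 by move=> z [].
have BT : B `<=` `]0, T[ `*` Omega.
  move=> [r x] /BQ[/= rt01 Ox]; split=> //=; rewrite in_itv/=; apply: oot.
  by move: rt01; rewrite in_itv.
have intg g : (forall z, W z -> {for z, continuous g}) ->
    leb_time_space.-integrable B (EFin \o g).
  by move=> cg; apply: (cylinder_integrable domain mB BQ) => z /KW; exact: cg.
have [dk Ck_k] := k_C1.
have [Cs _] := chain_C1 ch oW Crt1 Ctt1 rt0 tt0.
pose prod z := rt z * material w (fun z => s (rt z) (tt z)) z.
have cprod z : W z -> {for z, continuous prod}.
  move=> Wz; apply: cvgM; first exact: (Ck1_continuous Crt1).
  exact: (continuous_material Cw1 Cs).
have cheat z : W z -> {for z, continuous (heat tt k)}.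
  move=> Wz; apply: continuous_sum => i.
  have Ckt : Ck 1 W (fun z => k (tt z)) by exact: (Ck1_comp oW Ck_k tt0 Ctt1).
  exact: (Ck1_continuousD (Ck1M oW Ckt (Cdtt i))).
have cdiff z : W z -> {for z, continuous (fun z => prod z - heat tt k z)}.
  by move=> Wz; apply: cvgB; [exact: cprod|exact: cheat].
have heat0 := cold_heat_ge0 domain oW KW Ctt1 Cdtt tt0 neumann Ck_k k_ge0 C.
suff : (\int[leb_time_space]_(z in B) dissipation_ext z <=
    \int[leb_time_space]_(z in B) (prod z - heat tt k z)).
  rewrite RintegralB//; [|exact: intg|exact: intg].
  by move=> /le_trans; apply; rewrite gerBl.
rewrite -lee_fin -!EFin_Rintegral//; first last.
- by apply: intg; exact: continuous_dissipation.
- exact: intg.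
have BT' : B `<=` `[0, T] `*` closure Omega.
  move=> [r x] /BT[/= rT Ox].
  by split; [exact: subset_itv_oo_cc|exact: subset_closure].
(* [B] lies over the open interval ]t0, t1[, hence in the open set where [sigma] has a density, even
   for t0 = 0. *)
have := nsf_sigma sol mB BT'; rewrite setIidl// (nsf_entropy sol mB BT).
have diss z : B z -> dissipation mu eta kappa theta u z.1 z.2 = dissipation_ext z.
  move: z => [r x] /BT[/= rT Ox]; apply: dissipationE => //; apply: oo_co.
  by move: rT; rewrite in_itv.
have production z : B z -> entropy_production s kappa rho theta u z.1 z.2 =
    prod z - heat tt k z.
  by move: z => [r x] /BQ[/= rt01 Ox]; exact: (entropy_productionE ch).
by rewrite (eq_integral_EFin leb_time_space diss)
  (eq_integral_EFin leb_time_space production).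
Qed.

Lemma truncated_entropy_inequality :
  (\int[leb3]_(x in Omega) (rho t1 x * truncated_entropy s rho theta C t1 x)%:E
   + \int[lebesgue_measure]_(r in `[t0, t1])
       \int[leb3]_(x in cold_region Omega theta C r)
         (dissipation mu eta kappa theta u r x)%:E
   <= \int[lebesgue_measure]_(r in `[t0, t1])
        \int[leb3]_(x in cold_region Omega theta C r)
          (- rho r x ^+ 2 * D_rho s (rho r x) C * div (u r) x)%:E
      + \int[leb3]_(x in Omega)
          (rho t0 x * truncated_entropy s rho theta C t0 x)%:E)%E.
Proof.
have [a [b ch]] := entropy_chain_exists laws.
have mB := measurable_cold (t0 := t0) (t1 := t1) domain KW Ctt1 C.
set B := cold Omega t0 t1 tt C in mB *.
have BQ : B `<=` cylinder Omega t0 t1 by move=> z [].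
have intg g : (forall z, W z -> {for z, continuous g}) ->
    leb_time_space.-integrable B (EFin \o g).
  by move=> cg; apply: (cylinder_integrable domain mB BQ) => z /KW; exact: cg.
have [Cs _] := chain_C1 ch oW Crt1 Ctt1 rt0 tt0.
have t0i : `[t0, t1]%classic t0 by rewrite /= in_itv/= lexx ltW.
have t1i : `[t0, t1]%classic t1 by rewrite /= in_itv/= lexx ltW.
rewrite !(truncated_entropy_integralE ch)//.
rewrite (@cold_slice_integralE _ dissipation_ext); first last.
- exact: continuous_dissipation.
- by move=> r x rt01 Ox; apply: dissipationE => //; exact: oo_co (oot rt01).
pose f z := - rt z ^+ 2 * a (rt z) C * divw z.
have cf z : W z -> {for z, continuous f}.
  move=> Wz; have crt := Ck1_continuous Crt1 Wz.
  apply: cvgM; last exact: continuous_divw.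
  apply: cvgM; first by apply: cvgN; exact: (cvgM crt crt).
  by apply: (chain_a ch) => //; [exact: rt0|exact: cvg_cst].
rewrite (@cold_slice_integralE _ f) //; last first.
  move=> r x rt01 Ox; have rT := oo_co (oot rt01).
  rewrite (divE rT Ox); have [-> _ _] := extO rT Ox.
  by rewrite (entropy_chain_D_rho ch)//; apply: rt0; exact: OW.
rewrite -!EFinD lee_fin.
pose prod z := rt z * material w (fun z => s (rt z) (tt z)) z.
have cprod z : W z -> {for z, continuous prod}.
  move=> Wz; apply: cvgM; first exact: (Ck1_continuous Crt1).
  exact: (continuous_material Cw1 Cs).
(* The continuity equation replaces the material derivative of rho by -rho div u; this produces the
   integrand of the right-hand side of the claim. *)
have fluxE : \int[leb_time_space]_(z in B) entropy_flux rt tt w s a C z =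
    \int[leb_time_space]_(z in B) f z - \int[leb_time_space]_(z in B) prod z.
  rewrite -RintegralB//; [|exact: intg|exact: intg].
  apply: eq_Rintegral => z /set_mem /BQ Qz.
  rewrite /entropy_flux /f /prod /divw.
  by rewrite (material_rho KW Crt1 Cw1 continuity Qz); ring.
have balance := truncated_entropy_balance domain t01 oW KW Crt1 Ctt1 Cw1 rt0 tt0
  dirichlet continuity ch C0.
rewrite -/B fluxE in balance.
have combine (E1 E0 F G D : R) : E1 - E0 = F - G -> D <= G -> E1 + D <= F + E0.
  by lra.
exact: combine balance (cold_dissipation_le ch).
Qed.

End solution.

Unset Implicit Arguments.

Theorem proposition3p1 (R : realType) (T : R) (Omega : set (space3 R))
    (p e s : R -> R -> R) (mu eta kappa P S : R -> R)
    (rho theta : R -> space3 R -> R) (u : R -> space3 R -> 'rV[R]_3)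
    (sigma : {measure set (mtime_space R) -> \bar R})
    (rho0 theta0 : space3 R -> R) (m0 : space3 R -> 'rV[R]_3) (omega : R) :
  0 < T ->
  smooth_bounded_domain Omega ->
  constitutive_laws p e s mu eta kappa P S ->
  classical_NSF_solution T Omega p s mu eta kappa rho theta u sigma
    rho0 theta0 m0 ->
  3 < omega -> Linfty_Lp Omega T omega rho ->
  L2_H10 Omega T u ->
  forall t0 t C : R, 0 <= t0 -> t0 <= t -> t < T -> 0 < C ->
  (\int[leb3]_(x in Omega)
      (rho t x * truncated_entropy s rho theta C t x)%:E
   + \int[lebesgue_measure]_(r in `[t0, t])
       \int[leb3]_(x in cold_region Omega theta C r)
         (dissipation mu eta kappa theta u r x)%:E
   <= \int[lebesgue_measure]_(r in `[t0, t])
        \int[leb3]_(x in cold_region Omega theta C r)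
          (- rho r x ^+ 2 * D_rho s (rho r x) C * div (u r) x)%:E
      + \int[leb3]_(x in Omega)
          (rho t0 x * truncated_entropy s rho theta C t0 x)%:E)%E.
Proof.
move=> _ domain laws sol _ _ _ t0 t C t0_ge0; rewrite le_eqVlt => /predU1P[<-|t0t] tT C0.
  (* For t0 = t the time integrals run over a point and the two sides coincide; the cylinder results
     need t0 < t. *)
  by rewrite !set_itv1 !integral_set1 adde0 add0e.
have [W [rt [tt [w [oW TW [rt0 tt0] [Crt Ctt Cw] ext]]]]] := solution_extension sol.
exact: (truncated_entropy_inequality domain laws sol oW TW rt0 tt0 Crt Ctt Cw
  ext t0_ge0 t0t tT C0).
Qed.
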